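(* Let $\mathcal{A}$ be a real fibered affine line arrangement. The global monodromy $\mu:\pi_1(B,x_0)\to\mathrm{Aut}(H_1(F_0;\mathcal{L}_s))$ is determined by the maps $$\mu([\gamma_p])=\tau(x_0,x_p)^{-1}\,\mu_{x_p}\,\tau(x_0,x_p),\qquad p\in\pi(\mathcal{S}),$$ where $\tau(x_0,x_p)$ is the parallel transport and $\mu_{x_p}=\tau(x'_p,x_p)\circ\tau(x_p,x'_p)$ is the local monodromy around $p$.
   Context: $\mathcal{A}=\{\ell_1,\dots,\ell_n,\ell'_1,\dots,\ell'_m\}$ is a finite arrangement of affine lines in $\mathbb{C}^2$ (coordinates $x,y$), defined over $\mathbb{R}$, with complement $\mathcal{M}(\mathcal{A})$; $\pi(x,y)=x$; $\mathcal{S}$ is the set of singular points (points lying on at least two lines); so $\pi(\mathcal{S})\subset\mathbb{R}$. The vertical lines are $\ell'_j=\pi^{-1}(\xi)$ with $\xi\in\pi(\mathcal{S})$, and the horizontal lines satisfy $\pi(\ell_i)=\mathbb{C}$. ''Fibered'' means: for every $\xi\in\pi(\mathcal{S})$ the line $\pi^{-1}(\xi)$ belongs to $\mathcal{A}$. Put $B=\mathbb{C}\setminus\pi(\mathcal{S})$; then $\pi:\mathcal{M}(\mathcal{A})\to B$ is a fiber bundle with fiber $F_x=\mathbb{C}_x\setminus\bigcup_i\ell_i$, $\mathbb{C}_x=\pi^{-1}(x)$. A rank one local system on $\mathcal{M}(\mathcal{A})$ is given by assigning to each line a nonzero complex number (its parameter; $s_i$ for $\ell_i$) by which a standard positively oriented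 small circle around the line acts; $\mathcal{L}_x$ is its restriction to $F_x$. Fix a real base point $x_0\in B$ and write $F_0=F_{x_0}$, $\mathcal{L}_s=\mathcal{L}_{x_0}$. Fix $y_0$ with $\Im(y_0)\gg0$ and use $(x,y_0)$ as base point of $F_x$. Transport of fibers along a path in $B$, preserving these base points, induces an isomorphism of the fundamental groups of the end fibers compatible with the characters defining the local systems, hence an isomorphism of the vector spaces $H_1(F_x;\mathcal{L}_x)$ of the end fibers. For a loop $\gamma$ at $x_0$ the resulting automorphism of $H_1(F_0;\mathcal{L}_s)$ is $\mu([\gamma])$. For $x,x'\in\mathbb{R}\setminus\pi(\mathcal{S})$ let $\gamma(x,x')$ be a path $\gamma(t)$ in $B$ from $x$ to $x'$ with $\gamma\cap\mathbb{R}=\{x,x'\}$ and $\Im(\gamma(t))(x-x')\ge0$, and let $\tau(x,x'):H_1(F_x;\mathcal{L}_x)\to H_1(F_{x'};\mathcal{L}_{x'})$ be the transport along $\gamma(x,x')$. For $p\in\pi(\mathcal{S})$, $x_p,x'_p\in\mathbb{R}$ are two points very close to $p$ on opposite (symmetric) sides of $p$, $x_p$ being the one in the segment $[p,x_0]$. The elementary generators of $\pi_1(B,x_0)$ are the paths composed in sequence $$\gamma_p=\gamma(x_0,x_p)\,\gamma(x_p,x'_p)\,\gamma(x'_p,x_p)\,\gamma(x_0,x_p)^{-1}.$$ *)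

(* Defs.v *)
From HB Require Import structures.
From mathcomp Require Import all_boot all_order all_algebra.
From mathcomp Require Import generic_quotient ring_quotient.
From mathcomp Require Import all_classical all_reals all_analysis.
From mathcomp Require Import homotopy complex freeg.

Set Implicit Arguments.
Unset Strict Implicit.
Unset Printing Implicit Defensive.

Import Order.TTheory GRing.Theory Num.Theory.
Import numFieldNormedType.Exports.

Local Open Scope classical_set_scope.
Local Open Scope ring_scope.
Local Open Scope complex_scope.
Local Open Scope quotient_scope.

HB.instance Definition _ (R : realType) := PseudoPointedMetric.copy R[i] (R[i]^o).

Lemma continuous_into_set_type (X Y : topologicalType) (A : set Y)
    (f : X -> set_type A) : continuous (fun x => val (f x)) -> continuous f.
Proof. by move=> cf; apply: continuous_comp_initial. Qed.

Section Glue.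
Context (R : realType) (X Y : topologicalType).
Variables (r : X -> R) (c : R) (f g : X -> Y).

Lemma glue_continuous : continuous r -> continuous f -> continuous g ->
  (forall x, r x = c -> f x = g x) ->
  continuous (fun x => if r x <= c then f x else g x).
Proof.
move=> cr cf cg fg; apply/continuous_subspace_setT.
have -> : [set: X] = r @^-1` [set y | y <= c] `|` r @^-1` [set y | c <= y].
  by apply/seteqP; split=> // x _ /=; case: (leP (r x) c) => h; [left|right => //; exact: ltW].
apply: withinU_continuous.
- by apply: closed_comp => [x _|]; [exact: cr|exact: closed_le].
- by apply: closed_comp => [x _|]; [exact: cr|exact: closed_ge].
- apply: (@subspace_eq_continuous _ _ _ f) => [x|]; last exact: continuous_subspaceT.
  by move=> /set_mem /= rx; rewrite /from_subspace rx.
- apply: (@subspace_eq_continuous _ _ _ g) => [x|]; last exact: continuous_subspaceT.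
  move=> /set_mem /= cx; rewrite /from_subspace; case: (leP (r x) c) => // xc.
  by rewrite fg //; apply/eqP; rewrite eq_le xc cx.
Qed.

End Glue.

Section UnitInterval.
Variable R : realType.

Definition unit_interval : Type := set_type (`[0 : R, 1]%classic).

HB.instance Definition _ := Topological.on unit_interval.

Lemma clamp_subproof (r : R) :
  Order.max 0 (Order.min 1 r) \in (`[0 : R, 1]%classic).
Proof.
by rewrite inE /= in_itv /= le_max lexx /= ge_max ler01 ge_min lexx.
Qed.

(* The nearest point retraction of the line onto the unit interval. *)
Definition clamp (r : R) : unit_interval := SigSub (clamp_subproof r).

Lemma clamp_val (t : unit_interval) : clamp (val t) = t.
Proof.
apply: val_inj; rewrite /=; have := valP t; rewrite inE /= in_itv /= => /andP[t0 t1].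
by rewrite min_r // max_r.
Qed.

Lemma clampE (r : R) : 0 <= r <= 1 -> val (clamp r) = r.
Proof. by move=> /andP[r0 r1] /=; rewrite min_r // max_r. Qed.

Lemma clamp_continuous : continuous clamp.
Proof.
apply: continuous_into_set_type => /= x.
apply: (@continuous_max R R (cst 0)); first exact: cst_continuous.
by apply: (@continuous_min R R (cst 1)); first exact: cst_continuous.
Qed.

Lemma unit_interval_val_continuous :
  continuous (fun t : unit_interval => val t : R).
Proof. exact: initial_continuous. Qed.

Lemma clamp01 : clamp 0 != clamp 1.
Proof.
apply/eqP => /(congr1 val); rewrite !clampE ?lexx ?ler01 // => /eqP.
by rewrite eq_sym oner_eq0.
Qed.

HB.instance Definition _ := isBiPointed.Build unit_interval clamp01.

Lemma val_zero : val (zero : unit_interval) = 0.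
Proof. by rewrite clampE ?lexx ?ler01. Qed.

Lemma val_one : val (one : unit_interval) = 1.
Proof. by rewrite clampE ?lexx ?ler01. Qed.

End UnitInterval.

Section PathOperations.
Context (R : realType) (T : topologicalType).
Local Notation I := (unit_interval R).

Lemma path_clamp_continuous (x y : T) (p : {path I from x to y in T}) :
  continuous (fun r : R => p (clamp r)).
Proof.
move=> r; apply: continuous_comp; [exact: clamp_continuous|exact: cts_fun].
Qed.

Section Rev.
Context (x y : T) (p : {path I from x to y in T}).

Definition path_rev_fun (t : I) : T := p (clamp (1 - val t)).

Lemma path_rev_continuous : continuous path_rev_fun.
Proof.
move=> t; apply: (@continuous_comp _ _ _ (fun t : I => 1 - val t : R) (fun r => p (clamp r))).
  by apply: continuousB; [exact: cst_continuous|exact: unit_interval_val_continuous].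
exact: path_clamp_continuous.
Qed.

Lemma path_rev_zero : path_rev_fun zero = y.
Proof.
rewrite /path_rev_fun val_zero subr0; exact: path_one.
Qed.

Lemma path_rev_one : path_rev_fun one = x.
Proof.
rewrite /path_rev_fun val_one subrr; exact: path_zero.
Qed.

Definition path_rev : {path I from y to x in T} :=
  mk_path path_rev_continuous path_rev_zero path_rev_one.

End Rev.

Section Cat.
Context (x y z : T) (p : {path I from x to y in T}) (q : {path I from y to z in T}).

Definition path_cat_fun (t : I) : T :=
  if val t <= 2^-1 then p (clamp (2 * val t)) else q (clamp (2 * val t - 1)).

Lemma path_cat_continuous : continuous path_cat_fun.
Proof.
have c2 : continuous (fun t : I => 2 * val t : R).
  by move=> t; apply: (@continuousM R I (cst 2) (fun t => val t)); [exact: cst_continuous|exact: unit_interval_val_continuous].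
apply: glue_continuous => [||t|t t2].
- exact: unit_interval_val_continuous.
- move=> t; apply: (@continuous_comp _ _ _ (fun t : I => 2 * val t : R) (fun r => p (clamp r))).
    exact: c2.
  exact: path_clamp_continuous.
- apply: (@continuous_comp _ _ _ (fun t : I => 2 * val t - 1 : R) (fun r => q (clamp r))).
    by apply: continuousB; [exact: c2|exact: cst_continuous].
  exact: path_clamp_continuous.
- rewrite t2 mulfV ?pnatr_eq0 // subrr; exact: etrans path_one (esym path_zero).
Qed.

Lemma path_cat_zero : path_cat_fun zero = x.
Proof.
rewrite /path_cat_fun val_zero mulr0 invr_ge0 ler0n; exact: path_zero.
Qed.

Lemma path_cat_one : path_cat_fun one = z.
Proof.
rewrite /path_cat_fun val_one mulr1 leNgt invf_lt1 ?ltr0n // ltr1n /=.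
have -> : 2 - 1 = 1 :> R by rewrite (_ : 2 = 1 + 1) // addrK.
exact: path_one.
Qed.

Definition path_cat : {path I from x to z in T} :=
  mk_path path_cat_continuous path_cat_zero path_cat_one.

End Cat.

Definition path_homotopic (x y : T) (p q : {path I from x to y in T}) : Prop :=
  exists H : I * I -> T,
    [/\ continuous H,
        forall t, H (zero, t) = p t,
        forall t, H (one, t) = q t,
        forall s, H (s, zero) = x
      & forall s, H (s, one) = y].

End PathOperations.

Lemma continuous_pair (X Y Z : topologicalType) (f : X -> Y) (g : X -> Z) :
  continuous f -> continuous g -> continuous (fun x => (f x, g x)).
Proof. by move=> cf cg x; exact: (cvg_pair (cf x) (cg x)). Qed.

Section FundamentalGroupoid.
Context (R : realType) (T : topologicalType) (x y : T).
Local Notation I := (unit_interval R).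
Implicit Types p q r : {path I from x to y in T}.

Lemma path_homotopic_refl p : path_homotopic p p.
Proof.
exists (fun st => p st.2); split=> //; last 2 first.
- by move=> s; exact: path_zero.
- by move=> s; exact: path_one.
- move=> st; apply: continuous_comp; [exact: cvg_snd|exact: cts_fun].
Qed.

Lemma path_homotopic_sym p q : path_homotopic p q -> path_homotopic q p.
Proof.
move=> [H [cH Hp Hq Hx Hy]]; exists (fun st => H (clamp (1 - val st.1), st.2)); split.
- move=> st; apply: (@continuous_comp _ _ _ (fun st : I * I => (clamp (1 - val st.1) : I, st.2)) H); last exact: cH.
  apply: continuous_pair => {}st; last exact: cvg_snd.
  apply: (@continuous_comp _ _ _ (fun st : I * I => 1 - val st.1 : R) (@clamp R)); last exact: clamp_continuous.
  apply: continuousB; first exact: cst_continuous.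
  by apply: (@continuous_comp _ _ _ fst); [exact: cvg_fst|exact: unit_interval_val_continuous].
- by move=> t; rewrite val_zero subr0; exact: Hq.
- by move=> t; rewrite val_one subrr; exact: Hp.
- by move=> s; exact: Hx.
- by move=> s; exact: Hy.
Qed.

Lemma path_homotopic_trans q p r :
  path_homotopic p q -> path_homotopic q r -> path_homotopic p r.
Proof.
move=> [H [cH Hp Hq Hx Hy]] [K [cK Kq Kr Kx Ky]].
exists (fun st => if val st.1 <= 2^-1 :> R then H (clamp (2 * val st.1), st.2)
                  else K (clamp (2 * val st.1 - 1), st.2)).
have c1 : continuous (fun st : I * I => val st.1 : R).
  by move=> st; apply: (@continuous_comp _ _ _ fst); [exact: cvg_fst|exact: unit_interval_val_continuous].
have c2 : continuous (fun st : I * I => 2 * val st.1 : R).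
  by move=> t; apply: (@continuousM R _ (cst 2) (fun st : I * I => val st.1)); [exact: cst_continuous|exact: c1].
have half0 : (0 : R) <= 2^-1 by rewrite invr_ge0 ler0n.
have half1 : ((1 : R) <= 2^-1) = false.
  by rewrite leNgt invf_lt1 ?ltr0n // ltr1n.
split.
- apply: glue_continuous => //.
  + move=> st; apply: (@continuous_comp _ _ _ (fun st : I * I => (clamp (2 * val st.1) : I, st.2)) H); last exact: cH.
    apply: continuous_pair => {}st; last exact: cvg_snd.
    apply: (@continuous_comp _ _ _ (fun st : I * I => 2 * val st.1 : R) (@clamp R)); last exact: clamp_continuous.
    exact: c2.
  + move=> st; apply: continuous_comp; last exact: cK.
    apply: continuous_pair => {}st; last exact: cvg_snd.
    apply: (@continuous_comp _ _ _ (fun st : I * I => 2 * val st.1 - 1 : R) (@clamp R)); last exact: clamp_continuous.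
    by apply: continuousB; [exact: c2|exact: cst_continuous].
  + move=> [s t] /= ->; rewrite mulfV ?pnatr_eq0 // subrr.
    by rewrite -[clamp 1]/(one : I) -[clamp 0]/(zero : I) Hq Kq.
- by move=> t; rewrite val_zero half0 mulr0; exact: Hp.
- move=> t; rewrite val_one half1 mulr1 (_ : 2 - 1 = 1 :> R); first exact: Kr.
  by rewrite (_ : 2 = 1 + 1) // addrK.
- by move=> s; case: ifP => _; [exact: Hx|exact: Kx].
- by move=> s; case: ifP => _; [exact: Hy|exact: Ky].
Qed.

Definition path_homotopicb : rel {path I from x to y in T} :=
  fun p q => `[< path_homotopic p q >].

Lemma path_homotopicb_equiv : equiv_class_of path_homotopicb.
Proof.
split=> [p|p q|q p r].
- by apply/asboolP; exact: path_homotopic_refl.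
- by apply/asboolP/asboolP; exact: path_homotopic_sym.
- by move=> /asboolP pq /asboolP qr; apply/asboolP; exact: path_homotopic_trans pq qr.
Qed.

Canonical path_homotopicb_equivrel := EquivRelPack path_homotopicb_equiv.
Canonical path_homotopicb_encmodrel := defaultEncModRel path_homotopicb.

Definition pi1 := {eq_quot path_homotopicb}.
HB.instance Definition _ := Choice.on pi1.
HB.instance Definition _ : EqQuotient _ path_homotopicb pi1 := EqQuotient.on pi1.

Definition hclass (p : {path I from x to y in T}) : pi1 := \pi_pi1 p.

End FundamentalGroupoid.

Arguments pi1 R {T} x y.

(* The product a b runs through a first. *)
Definition pi1_mul (R : realType) (T : topologicalType) (x y z : T)
    (a : pi1 R x y) (b : pi1 R y z) : pi1 R x z :=
  hclass (path_cat (repr a) (repr b)).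

Definition pi1_inv (R : realType) (T : topologicalType) (x y : T)
    (a : pi1 R x y) : pi1 R y x :=
  hclass (path_rev (repr a)).

Section Simplices.
Context (R : realType).
Local Notation I := (unit_interval R).

(* The standard 2-simplex, with vertices v0 = (0, 0), v1 = (1, 0) and
   v2 = (0, 1). *)
Definition triangle : Type :=
  set_type [set st : R * R | [/\ 0 <= st.1, 0 <= st.2 & st.1 + st.2 <= 1]].

HB.instance Definition _ := Topological.on triangle.

Lemma unit_interval_ge0 (t : I) : 0 <= val t :> R.
Proof. by have := valP t; rewrite inE /= in_itv /= => /andP[]. Qed.

Lemma unit_interval_le1 (t : I) : val t <= 1 :> R.
Proof. by have := valP t; rewrite inE /= in_itv /= => /andP[]. Qed.

Lemma face01_subproof (t : I) : (val t, 0) \in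
  [set st : R * R | [/\ 0 <= st.1, 0 <= st.2 & st.1 + st.2 <= 1]].
Proof.
by apply/mem_set; split=> //=; rewrite ?addr0 ?unit_interval_ge0 ?unit_interval_le1.
Qed.

Lemma face02_subproof (t : I) : (0, val t) \in
  [set st : R * R | [/\ 0 <= st.1, 0 <= st.2 & st.1 + st.2 <= 1]].
Proof.
by apply/mem_set; split=> //=; rewrite ?add0r ?unit_interval_ge0 ?unit_interval_le1.
Qed.

Lemma face12_subproof (t : I) : (1 - val t, val t) \in
  [set st : R * R | [/\ 0 <= st.1, 0 <= st.2 & st.1 + st.2 <= 1]].
Proof.
by apply/mem_set; split=> //=; rewrite ?subrK ?subr_ge0 ?unit_interval_ge0 ?unit_interval_le1.
Qed.

(* The edges of the triangle; faceij runs from vi to vj. *)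
Definition face01 (t : I) : triangle := SigSub (face01_subproof t).
Definition face02 (t : I) : triangle := SigSub (face02_subproof t).
Definition face12 (t : I) : triangle := SigSub (face12_subproof t).

Lemma face01_continuous : continuous face01.
Proof.
apply: continuous_into_set_type; apply: continuous_pair.
  exact: unit_interval_val_continuous.
by move=> ?; exact: cst_continuous.
Qed.

Lemma face02_continuous : continuous face02.
Proof.
apply: continuous_into_set_type; apply: continuous_pair.
  by move=> ?; exact: cst_continuous.
exact: unit_interval_val_continuous.
Qed.

Lemma face12_continuous : continuous face12.
Proof.
apply: continuous_into_set_type; apply: continuous_pair.
  move=> t; apply: continuousB; first exact: cst_continuous.
  exact: unit_interval_val_continuous.
exact: unit_interval_val_continuous.
Qed.

HB.instance Definition _ := isContinuous.Build _ _ face01 face01_continuous.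
HB.instance Definition _ := isContinuous.Build _ _ face02 face02_continuous.
HB.instance Definition _ := isContinuous.Build _ _ face12 face12_continuous.

End Simplices.

Section PathMap.
Context (R : realType) (T U : topologicalType).
Local Notation I := (unit_interval R).

Definition path_of (s : continuousType I T) : {path I from s zero to s one in T} :=
  mk_path (@cts_fun _ _ s) erefl erefl.

Definition path_map (f : continuousType T U) (x y : T)
    (p : {path I from x to y in T}) : {path I from f x to f y in U} :=
  f \o p.

End PathMap.

(* A rank one local system, as a one-dimensional representation of the
   fundamental groupoid: every stalk is identified with C, and [hol p] is the
   parallel transport from the stalk at the origin of [p] to the stalk at its
   end. *)
Record local_system (R : realType) (T : topologicalType) := LocalSystem {
  hol : forall x y : T, {path (unit_interval R) from x to y in T} -> R[i];
  hol_neq0 : forall x y (p : {path (unit_interval R) from x to y in T}),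
    hol p != 0;
  hol_homotopic : forall x y (p q : {path (unit_interval R) from x to y in T}),
    path_homotopic p q -> hol p = hol q;
  hol_cat : forall x y z (p : {path (unit_interval R) from x to y in T})
    (q : {path (unit_interval R) from y to z in T}),
    hol (path_cat p q) = hol p * hol q }.

Section Pullback.
Context (R : realType) (T U : topologicalType).
Variables (f : continuousType T U) (L : local_system R U).
Local Notation I := (unit_interval R).

Definition pullback_hol (x y : T) (p : {path I from x to y in T}) : R[i] :=
  hol L (path_map f p).

Lemma pullback_hol_homotopic (x y : T) (p q : {path I from x to y in T}) :
  path_homotopic p q -> pullback_hol p = pullback_hol q.
Proof.
move=> [H [cH Hp Hq Hx Hy]]; apply: hol_homotopic; exists (f \o H); split=> /=.
- by move=> st; apply: continuous_comp; [exact: cH|exact: cts_fun].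
- by move=> t; rewrite Hp.
- by move=> t; rewrite Hq.
- by move=> s; rewrite Hx.
- by move=> s; rewrite Hy.
Qed.

Lemma pullback_hol_cat (x y z : T) (p : {path I from x to y in T})
    (q : {path I from y to z in T}) :
  pullback_hol (path_cat p q) = pullback_hol p * pullback_hol q.
Proof.
rewrite /pullback_hol -hol_cat; congr (hol L _); apply/path_eqP => t /=.
by rewrite /path_map /path_cat /mk_path /= /path_cat_fun; case: ifP.
Qed.

Definition pullback : local_system R T :=
  LocalSystem (fun x y p => hol_neq0 L (path_map f p))
    pullback_hol_homotopic pullback_hol_cat.

End Pullback.

Lemma fglift_linear (S : nzRingType) (K : choiceType) (V : lmodType S) (f : K -> V) :
  linear (fglift f : {freeg K / S} -> V).
Proof.
have fB (c d : {freeg K / S}) : fglift f (c - d) = fglift f c - fglift f d.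
  exact: lift_is_additive.
have f0 : fglift f (0 : {freeg K / S}) = 0 by rewrite -(subrr 0) fB subrr.
have fN (c : {freeg K / S}) : fglift f (- c) = - fglift f c by rewrite -sub0r fB f0 sub0r.
have fD (c d : {freeg K / S}) : fglift f (c + d) = fglift f c + fglift f d.
  by rewrite -[in LHS](opprK d) fB fN opprK.
move=> a c d; rewrite fD; congr (_ + _).
elim/(@freeg_ind_dom0 S K) : c => [|k s c _ _ IH]; first by rewrite scaler0 f0 scaler0.
rewrite scalerDr !fD scalerDr IH; congr (_ + _).
have -> : a *: << k *g s >> = << a * k *g s >> :> {freeg K / S}.
  by apply/eqP/freeg_eqP => t; rewrite coeffZ !coeffU mulrA.
by rewrite !liftU scalerA.
Qed.

(* Singular chains with coefficients in L, in degrees 0, 1 and 2: a simplex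
   carries a coefficient in the stalk of L at its first vertex. *)
Section Homology.
Context (R : realType) (T : topologicalType) (L : local_system R T).
Local Notation I := (unit_interval R).
Local Notation triangle := (triangle R).

Definition chain0 := {freeg T / R[i]}.
Definition chain1 := {freeg (continuousType I T) / R[i]}.
Definition chain2 := {freeg (continuousType triangle T) / R[i]}.

HB.instance Definition _ := GRing.Lmodule.on chain0.
HB.instance Definition _ := GRing.Lmodule.on chain1.
HB.instance Definition _ := GRing.Lmodule.on chain2.

Definition boundary1 : chain1 -> chain0 :=
  fglift (fun s : continuousType I T =>
    << hol L (path_of s) *g s one >> - << s zero >> : chain0).

Definition boundary2 : chain2 -> chain1 :=
  fglift (fun s : continuousType triangle T =>
    let s01 : continuousType I T := s \o @face01 R in
    let s02 : continuousType I T := s \o @face02 R in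
    let s12 : continuousType I T := s \o @face12 R in
    << hol L (path_of s01) *g s12 >> - << s02 >> + << s01 >> : chain1).

HB.instance Definition _ :=
  @GRing.isLinear.Build _ chain1 chain0 _ boundary1 (fglift_linear _).
HB.instance Definition _ :=
  @GRing.isLinear.Build _ chain2 chain1 _ boundary2 (fglift_linear _).

Definition is_cycle : {pred chain1} := [pred c | boundary1 c == 0].

Lemma is_cycle_submod : submod_closed is_cycle.
Proof.
split=> [|a c d]; first by rewrite inE linear0.
by rewrite !inE => /eqP c0 /eqP d0; rewrite linearP /= c0 d0 scaler0 addr0.
Qed.

HB.instance Definition _ :=
  GRing.isSubmodClosed.Build _ chain1 is_cycle is_cycle_submod.

Definition cycle := {c : chain1 | c \in is_cycle}.
HB.instance Definition _ := SubChoice.on cycle.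
HB.instance Definition _ := [SubChoice_isSubLmodule of cycle by <:].

Definition is_boundary : {pred cycle} :=
  fun z => `[< exists b : chain2, boundary2 b = val z >].

Lemma is_boundary_submod : submod_closed is_boundary.
Proof.
split=> [|a z w]; first by apply/asboolP; exists 0; rewrite !linear0.
move=> /asboolP[b bz] /asboolP[c cw]; apply/asboolP; exists (a *: b + c).
by rewrite !linearP /= bz cw.
Qed.

HB.instance Definition _ :=
  GRing.isSubmodClosed.Build _ cycle is_boundary is_boundary_submod.

Definition H1 := Quotient.quot is_boundary.
HB.instance Definition _ := GRing.Zmodule.on H1.
HB.instance Definition _ := Quotient.on H1.

Definition homology_class (z : cycle) : H1 := \pi_H1 z.

Definition scaleH1 (a : R[i]) (u : H1) : H1 := homology_class (a *: repr u).

Lemma homology_classP (z w : cycle) :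
  (homology_class z == homology_class w) = (z - w \in is_boundary).
Proof. by rewrite Quotient.idealrBE. Qed.

Lemma homology_classD (z w : cycle) :
  homology_class (z + w) = homology_class z + homology_class w.
Proof. exact: (raddfD (\pi_(Quotient.quot is_boundary))). Qed.

Lemma homology_classZ (a : R[i]) (z : cycle) :
  homology_class (a *: z) = scaleH1 a (homology_class z).
Proof.
apply/eqP; rewrite homology_classP -scalerBr rpredZ //.
by rewrite -homology_classP; apply/eqP; rewrite /homology_class reprK.
Qed.

Lemma repr_class (u : H1) : homology_class (repr u) = u.
Proof. by rewrite /homology_class reprK. Qed.

Lemma scaleH1A (a b : R[i]) (u : H1) : scaleH1 a (scaleH1 b u) = scaleH1 (a * b) u.
Proof. by rewrite -[u]repr_class -!homology_classZ scalerA. Qed.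

Lemma scaleH11 : left_id 1 scaleH1.
Proof. by move=> u; rewrite -[u in LHS]repr_class -homology_classZ scale1r repr_class. Qed.

Lemma scaleH1Dr : right_distributive scaleH1 +%R.
Proof.
move=> a u v; rewrite -[u]repr_class -[v]repr_class.
by rewrite -!homology_classZ -!homology_classD -homology_classZ scalerDr.
Qed.

Lemma scaleH1Dl (u : H1) : {morph scaleH1^~ u : a b / a + b}.
Proof.
by move=> a b; rewrite -[u]repr_class -!homology_classZ -homology_classD scalerDl.
Qed.

HB.instance Definition _ := GRing.Zmodule_isLmodule.Build R[i] H1
  scaleH1A scaleH11 scaleH1Dr scaleH1Dl.

End Homology.

Section Functoriality.
Context (R : realType) (T U : topologicalType).
Variables (L : local_system R T) (L' : local_system R U).
Variables (f : continuousType T U) (phi : T -> R[i]).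
Local Notation I := (unit_interval R).

(* The maps phi x from the stalk of L at x to the stalk of L' at f x form an
   isomorphism from L to the pullback of L' along f. *)
Definition is_local_system_iso : Prop :=
  (forall x, phi x != 0) /\
  (forall (x y : T) (p : {path I from x to y in T}),
     phi y * hol L p = hol L' (path_map f p) * phi x).

Definition chain1_map : chain1 R T -> chain1 R U :=
  fglift (fun s : continuousType I T =>
    << phi (s zero) *g (f \o s : continuousType I U) >> : chain1 R U).

Definition induces_on_H1 (F : H1 L -> H1 L') : Prop :=
  forall z : cycle L, exists2 w : cycle L',
    val w = chain1_map (val z) & F (homology_class z) = homology_class w.

End Functoriality.

(* A real line of C^2 is either the graph of a real affine function (it is then
   called horizontal: it projects onto the x-axis) or vertical; the injectivity
   conditions say that the lines are pairwise distinct. *)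
Record arrangement (R : realType) := Arrangement {
  nhor : nat;
  nver : nat;
  slope : 'I_nhor -> R;
  intercept : 'I_nhor -> R;
  abscissa : 'I_nver -> R;
  hor_inj : injective (fun i => (slope i, intercept i));
  ver_inj : injective abscissa }.

Section Arrangement.
Context (R : realType) (A : arrangement R).

Definition line_index : finType := ('I_(nhor A) + 'I_(nver A))%type.

Definition line (l : line_index) : set (R[i] * R[i]) :=
  match l with
  | inl i => [set z | z.2 = (slope i)%:C * z.1 + (intercept i)%:C]
  | inr j => [set z | z.1 = (abscissa j)%:C]
  end.

Definition singular_points : set (R[i] * R[i]) :=
  [set z | exists l l' : line_index, [/\ l != l', line l z & line l' z]].

Definition piS : set R[i] := fst @` singular_points.

Definition complement_set : set (R[i] * R[i]) :=
  [set z | forall l, ~ line l z].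

Definition fiber_set (x : R[i]) : set R[i] :=
  [set y | forall i : 'I_(nhor A), ~ line (inl i) (x, y)].

End Arrangement.

Record fibered_arrangement (R : realType) := FiberedArrangement {
  arr :> arrangement R;
  vertical_singular : forall j : 'I_(nver arr), piS arr (abscissa j)%:C;
  fibered : forall xi : R[i], piS arr xi ->
    exists l : line_index arr, line l = [set z | z.1 = xi] }.

Section Fibration.
Context (R : realType) (A : fibered_arrangement R).
Local Notation I := (unit_interval R).

Definition complement : Type := set_type (complement_set A).
HB.instance Definition _ := Topological.on complement.

Definition base : Type := set_type (~` piS A).
HB.instance Definition _ := Topological.on base.

Definition fiber (x : base) : Type := set_type (fiber_set A (val x)).
HB.instance Definition _ (x : base) := Topological.on (fiber x).

Lemma fiber_incl_subproof (x : base) (y : fiber x) :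
  (val x, val y) \in complement_set A.
Proof.
apply/mem_set => -[i|j] /=; first exact: (set_mem (valP y)).
move=> xj; suff: piS A (val x) by exact: (set_mem (valP x)).
by have -> : val x = (abscissa j)%:C := xj; exact: vertical_singular.
Qed.

Definition fiber_incl (x : base) (y : fiber x) : complement :=
  SigSub (fiber_incl_subproof y).

Lemma fiber_incl_continuous (x : base) : continuous (@fiber_incl x).
Proof.
apply: continuous_into_set_type; apply: continuous_pair.
  by move=> ?; exact: cst_continuous.
exact: initial_continuous.
Qed.

HB.instance Definition _ (x : base) :=
  isContinuous.Build (fiber x) complement (@fiber_incl x) (@fiber_incl_continuous x).

Definition circle (t : I) : R[i] :=
  cos (2 * pi * val t) +i* sin (2 * pi * val t).

(* A small positively oriented circle around the line l is the boundary of a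
   disc { q + u v : |u| <= 1 } lying in a complex line through a point q of l
   and meeting the arrangement at q only. *)
Definition has_parameters (L : local_system R complement)
    (s : line_index A -> R[i]) : Prop :=
  forall (l : line_index A) (q v : R[i] * R[i]),
    line l q ->
    (forall l', l' != l -> ~ line l' q) ->
    (forall u : R[i], 0 < `|u| <= 1 ->
       complement_set A (q.1 + u * v.1, q.2 + u * v.2)) ->
    forall (w : complement) (c : {path I from w to w in complement}),
      (forall t, val (c t) = (q.1 + circle t * v.1, q.2 + circle t * v.2)) ->
      hol L c = s l.

Variable L : local_system R complement.

Definition fiber_system (x : base) : local_system R (fiber x) :=
  pullback (@fiber_incl x) L.

Section Transport.
Variable y0 : R[i].

(* The path stays in the region where y0 lies above all the points of the
   fiber on the horizontal lines, which is what "Im y0 >> 0" stands for: there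
   the points (x, y0) can be used as base points of the fibers. *)
Definition below (x x' : base) (g : {path I from x to x' in base}) : Prop :=
  forall (t : I) (i : 'I_(nhor A)),
    complex.Im ((slope i)%:C * val (g t) + (intercept i)%:C) < complex.Im y0.

Section AlongPath.
Context (x x' : base) (g : {path I from x to x' in base}).

Definition pullback_bundle : Type :=
  set_type [set ty : I * R[i] | fiber_set A (val (g ty.1)) ty.2].
HB.instance Definition _ := Topological.on pullback_bundle.

Definition pointed_trivialization (h : I * fiber x -> pullback_bundle) : Prop :=
  [/\ continuous h,
      exists2 k : pullback_bundle -> I * fiber x,
        continuous k & cancel h k /\ cancel k h,
      forall t z, (val (h (t, z))).1 = t,
      forall z, (val (h (zero, z))).2 = val z
    & forall t z, val z = y0 -> (val (h (t, z))).2 = y0].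

Definition is_transport
    (F : {linear H1 (fiber_system x) -> H1 (fiber_system x')}) : Prop :=
  exists (h : I * fiber x -> pullback_bundle)
         (f : continuousType (fiber x) (fiber x'))
         (phi : fiber x -> R[i]),
    [/\ pointed_trivialization h,
        forall z, val (f z) = (val (h (one, z))).2,
        is_local_system_iso (fiber_system x) (fiber_system x') f phi,
        forall z, val z = y0 -> phi z = 1
      & induces_on_H1 f phi F].

End AlongPath.

(* The transport along a homotopy class of paths is computed on any
   representative which is low enough for the base points (x, y0). *)
Definition transport (x x' : base) (c : pi1 R x x') :
    {linear H1 (fiber_system x) -> H1 (fiber_system x')} :=
  xget (\0 : {linear H1 (fiber_system x) -> H1 (fiber_system x')})
    [set F | exists g : {path I from x to x' in base},
       [/\ hclass g = c, below g & is_transport g F]].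

End Transport.

Definition is_real (x : base) : Prop := complex.Im (val x) = 0.

Definition half_plane_path (x x' : base) (g : {path I from x to x' in base}) :
    Prop :=
  (forall t : I, is_real (g t) -> g t = x \/ g t = x') /\
  (forall t : I,
     0 <= complex.Im (val (g t)) * (complex.Re (val x) - complex.Re (val x'))).

(* The points x and x' are symmetric with respect to p, x lies in the segment
   [p, x0], and p is the only point of piS within distance |x - p| of p. *)
Definition close_pair (x0 : base) (p : R[i]) (x x' : base) : Prop :=
  [/\ exists2 t : R, 0 <= t <= 1 & val x = p + t%:C * (val x0 - p),
      val x' - p = - (val x - p)
    & forall q, piS A q -> q != p -> `|val x - p| < `|q - p|].

End Fibration.

(* Meaningful for bijective maps only. *)
Definition inverse (U V : nmodType) (f : U -> V) (v : V) : U :=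
  xget 0 [set u | f u = v].

Definition elementary_loop (R : realType) (A : fibered_arrangement R)
    (g : forall x x' : base A, {path (unit_interval R) from x to x' in base A})
    (x0 x x' : base A) : pi1 R x0 x0 :=
  pi1_mul (pi1_mul (pi1_mul (hclass (g x0 x)) (hclass (g x x')))
                   (hclass (g x' x)))
          (pi1_inv (hclass (g x0 x))).

(* Main.v *)
(** Over the base, the points of the fiber on the horizontal lines never meet,
    so a path of base points is followed by an ambient isotopy of the complex
    line, built from many small explicit piecewise linear pushes; it also fixes
    y0.  This gives existence of the transport along every path whose points
    lie low enough below y0, and multiplying the imaginary parts by a small
    constant brings any homotopy class with real ends into that range.
    Two trivializations, even over two homotopic paths, end in homotopic maps
    of fibers, and the stalk isomorphism phi is determined by its value at y0
    because fibers are path connected; a prism operator on chains with local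
    coefficients then shows that the induced map on H1 is unique.  Hence
    transport is a functor on homotopy classes of paths with real ends, and the
    formula for mu([gamma_p]) is an instance of functoriality.

    For the last clause, the elementary loops generate the fundamental group:
    for real w, let l_w be the loop going to w in one half plane and back in the
    other.  Then gamma_p is l_{x'_p} followed by the inverse of l_{x_p}, so all
    l_w are generated, by induction on the number of points of pi(S) between x0
    and w; and any loop is cut into pieces lying in one closed half plane. *)

Require Import Defs.
From HB Require Import structures.
From mathcomp Require Import all_boot all_order all_algebra.
From mathcomp Require Import generic_quotient.
From mathcomp Require Import all_classical all_reals all_analysis.
From mathcomp Require Import homotopy complex freeg.
From mathcomp Require Import ring lra.

Set Implicit Arguments.
Unset Strict Implicit.
Unset Printing Implicit Defensive.

Import Order.TTheory GRing.Theory Num.Theory.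
Import numFieldNormedType.Exports.

Local Open Scope classical_set_scope.
Local Open Scope ring_scope.
Local Open Scope complex_scope.
Local Open Scope quotient_scope.

(** * Continuity *)

(** [transport] is a choice among all maps satisfying [is_transport], over all low representatives
    and all trivializations, so constructing one transport does not compute it: an arbitrary
    competitor has to be compared with the constructed one. The comparison is asymmetric. A
    trivialization is defined on fibers only and cannot be shifted to another path; an isotopy of
    the whole complex line can. [lifts] therefore records the transports that come from isotopies,
    and uniqueness is proved between one [is_transport] and one [lifts]. The pushes are piecewise
    linear because their inverses are then explicit and continuous, also in the parameters. Scaling
    imaginary parts by a nonzero factor preserves the base because pi(S) is real, but it moves
    nonreal ends; this is why functoriality is confined to real ends. A loop may cross the real line
    infinitely often, so it is not cut at its crossings: its small pieces are deformed to pairs of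
    segments. Generation is formulated for an arbitrary predicate closed under the group operations,
    to be applied to the classes on which two representations agree. *)

Section Continuity.
Context (R : realType) (X : topologicalType).
Implicit Types f g : X -> R.

Lemma contD f g : continuous f -> continuous g -> continuous (fun x => f x + g x).
Proof. by move=> cf cg x; apply: continuousD; [exact: cf|exact: cg]. Qed.

Lemma contN f : continuous f -> continuous (fun x => - f x).
Proof. by move=> cf x; apply: continuousN; exact: cf. Qed.

Lemma contM f g : continuous f -> continuous g -> continuous (fun x => f x * g x).
Proof. by move=> cf cg x; apply: continuousM; [exact: cf|exact: cg]. Qed.

Lemma contV f : (forall x, f x != 0) -> continuous f -> continuous (fun x => (f x)^-1).
Proof. by move=> f0 cf x; apply: continuousV; [exact: f0|exact: cf]. Qed.

Lemma contmax f g : continuous f -> continuous g ->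
  continuous (fun x => Order.max (f x) (g x)).
Proof. by move=> cf cg x; apply: (@continuous_max R X f g); [exact: cf|exact: cg]. Qed.

Lemma contmin f g : continuous f -> continuous g ->
  continuous (fun x => Order.min (f x) (g x)).
Proof. by move=> cf cg x; apply: (@continuous_min R X f g); [exact: cf|exact: cg]. Qed.

Lemma contabs f : continuous f -> continuous (fun x => `|f x|).
Proof. by move=> cf x; apply: continuous_comp; [exact: cf|exact: norm_continuous]. Qed.

End Continuity.

Lemma cont_cst (X Y : topologicalType) (y : Y) : continuous (fun _ : X => y).
Proof. by move=> x; exact: cst_continuous. Qed.

Lemma cont_comp (X Y Z : topologicalType) (f : X -> Y) (g : Y -> Z) :
  continuous g -> continuous f -> continuous (fun x => g (f x)).
Proof. by move=> cg cf x; apply: continuous_comp; [exact: cf|exact: cg]. Qed.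

Lemma cont_id (X : topologicalType) : continuous (fun x : X => x).
Proof. by move=> x; exact: cvg_id. Qed.

Lemma cont_fst (X Y : topologicalType) : continuous (fun x : X * Y => x.1).
Proof. by move=> x; exact: cvg_fst. Qed.

Lemma cont_snd (X Y : topologicalType) : continuous (fun x : X * Y => x.2).
Proof. by move=> x; exact: cvg_snd. Qed.

Lemma cont_fst_comp (X Y Z : topologicalType) (f : X -> Y * Z) :
  continuous f -> continuous (fun x => (f x).1).
Proof. exact/cont_comp/cont_fst. Qed.

Lemma cont_snd_comp (X Y Z : topologicalType) (f : X -> Y * Z) :
  continuous f -> continuous (fun x => (f x).2).
Proof. exact/cont_comp/cont_snd. Qed.

Lemma cont_val (X Y : topologicalType) (A : set Y) (f : X -> set_type A) :
  continuous f -> continuous (fun x => val (f x)).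
Proof. by apply: cont_comp; exact: initial_continuous. Qed.

Section ComplexContinuity.
Context (R : realType).
Implicit Types z w : R[i].

Lemma Re_le_norm z : `|complex.Re z| <= complex.Re `|z|.
Proof.
case: z => a b /=; rewrite -(@sqrtr_sqr R a); apply: ler_wsqrtr.
by rewrite lerDl sqr_ge0.
Qed.

Lemma Im_le_norm z : `|complex.Im z| <= complex.Re `|z|.
Proof.
case: z => a b /=; rewrite -(@sqrtr_sqr R b); apply: ler_wsqrtr.
by rewrite lerDr sqr_ge0.
Qed.

Lemma norm_le_ReIm z :
  complex.Re `|z| <= `|complex.Re z| + `|complex.Im z|.
Proof.
case: z => a b /=; rewrite -[leRHS]ger0_norm ?addr_ge0 //.
rewrite -[leRHS]sqrtr_sqr; apply: ler_wsqrtr.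
rewrite sqrrD !real_normK ?num_real //.
have := mulr_ge0 (normr_ge0 a) (normr_ge0 b); lra.
Qed.

(** The norm of [R[i]] is complex valued, so balls have complex radii whose order forces a zero
    imaginary part. Squares with a real side give the same neighbourhoods and reduce continuity to
    real and imaginary parts. *)
Lemma near_complex z (P : R[i] -> Prop) :
  (\forall w \near z, P w) <->
  exists2 e : R, 0 < e & forall w, `|complex.Re (w - z)| < e ->
    `|complex.Im (w - z)| < e -> P w.
Proof.
split.
- move=> /(@nbhs_ballP R[i] (R[i]^o)) [[e e'] /= e0 He].
  move: e0; rewrite ltcE /= => /andP[/eqP e'0 e0].
  exists (e / 2); first by rewrite divr_gt0.
  move=> w Rw Iw; apply: He; rewrite -ball_normE /= distrC ltcE /= e'0 eqxx /=.
  apply: le_lt_trans (norm_le_ReIm (w - z)) _.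
  by rewrite [ltRHS](splitr e) ltrD.
- move=> [e e0 He]; apply/(@nbhs_ballP R[i] (R[i]^o)); exists e%:C => /=.
    by rewrite ltcR.
  move=> w; rewrite -ball_normE /= distrC ltcE => /andP[_ lte].
  by apply: He; apply: le_lt_trans lte; [exact: Re_le_norm|exact: Im_le_norm].
Qed.

Lemma cont_Re (X : topologicalType) (f : X -> R[i]) :
  continuous f -> continuous (fun x => complex.Re (f x)).
Proof.
move=> cf x; apply/cvgrPdist_lt => e e0.
have := cf x; move=> /(_ [set w | `|complex.Re (f x) - complex.Re w| < e]); apply.
apply/near_complex; exists e => // w Rw _ /=; rewrite distrC.
by move: Rw; case: (w) (f x) => a b [c d].
Qed.

Lemma cont_Im (X : topologicalType) (f : X -> R[i]) :
  continuous f -> continuous (fun x => complex.Im (f x)).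
Proof.
move=> cf x; apply/cvgrPdist_lt => e e0.
have := cf x; move=> /(_ [set w | `|complex.Im (f x) - complex.Im w| < e]); apply.
apply/near_complex; exists e => // w _ Iw /=; rewrite distrC.
by move: Iw; case: (w) (f x) => a b [c d].
Qed.

Lemma cont_complex (X : topologicalType) (f g : X -> R) :
  continuous f -> continuous g -> continuous (fun x => f x +i* g x : R[i]).
Proof.
move=> cf cg x P /near_complex[e e0 He].
have := cf x; move=> /cvgrPdist_lt /(_ e e0) nf.
have := cg x; move=> /cvgrPdist_lt /(_ e e0) ng.
rewrite -[nbhs _ _]/(\forall y \near x, P (f y +i* g y)).
near=> y; apply: He.
  suff: `|f x - f y| < e by rewrite distrC.
  by near: y; exact: nf.
suff: `|g x - g y| < e by rewrite distrC.
by near: y; exact: ng.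
Unshelve. all: by end_near.
Qed.

Lemma cont_complexE (X : topologicalType) (f : X -> R[i]) :
  continuous (fun x => complex.Re (f x)) -> continuous (fun x => complex.Im (f x)) ->
  continuous f.
Proof.
move=> cr ci; rewrite (_ : f = fun x => complex.Re (f x) +i* complex.Im (f x)).
  exact: cont_complex.
by apply/funext => x; case: (f x).
Qed.
End ComplexContinuity.

Lemma cont_ival (R : realType) (X : topologicalType) (f : X -> unit_interval R) :
  continuous f -> continuous (fun x => val (f x) : R).
Proof. exact/cont_comp/unit_interval_val_continuous. Qed.

Lemma cont_clamp (R : realType) (X : topologicalType) (f : X -> R) :
  continuous f -> continuous (fun x => clamp (f x)).
Proof. exact/cont_comp/clamp_continuous. Qed.

Ltac cont_hyp h := lazymatch h with
  | (fun x => ?c x) => lazymatch goal with H : continuous c |- _ => exact H end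
  | _ => lazymatch goal with H : continuous h |- _ => exact H end
  end.
Ltac cont1 := lazymatch goal with |- continuous ?h => lazymatch h with
  | (fun x => x) => exact: cont_id
  | (fun _ => ?c) => exact: cont_cst
  | (@fst _ _) => exact: cont_fst
  | (@snd _ _) => exact: cont_snd
  | (fun x => @?f x + @?g x) => apply (@contD _ _ f g)
  | (fun x => - @?f x) => apply (@contN _ _ f)
  | (fun x => @?f x * @?g x) => apply (@contM _ _ f g)
  | (fun x => Order.max (@?f x) (@?g x)) => apply (@contmax _ _ f g)
  | (fun x => Order.min (@?f x) (@?g x)) => apply (@contmin _ _ f g)
  | (fun x => `|@?f x|) => apply (@contabs _ _ f)
  | (fun x => complex.Re (@?f x)) => apply (@cont_Re _ _ f)
  | (fun x => complex.Im (@?f x)) => apply (@cont_Im _ _ f)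
  | (fun x => @?f x +i* @?g x) => apply (@cont_complex _ _ f g)
  | (fun x => (@?f x, @?g x)) => apply (@continuous_pair _ _ _ f g)
  | (fun x => (@?f x).1) => apply (@cont_fst_comp _ _ _ f)
  | (fun x => (@?f x).2) => apply (@cont_snd_comp _ _ _ f)
  | (fun x => clamp (@?f x)) => apply (@cont_clamp _ _ f)
  | _ => first [cont_hyp h | apply: cont_ival | apply: cont_val]
  end end.
Ltac cont := cbn beta; repeat (cont1; cbn beta).

(** * The fundamental groupoid *)

(** Only a maximum or minimum whose arguments contain no further one is split, so the case analysis
    goes from the inside outwards. *)
Ltac minmax_free a := lazymatch a with
  | context [Order.max _ _] => fail
  | context [Order.min _ _] => fail
  | _ => idtac
  end.
Ltac minmax := repeat match goal with
  | |- context [Order.max ?a ?b] => minmax_free a; minmax_free b; case: (leP a b) => ?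
  | |- context [Order.min ?a ?b] => minmax_free a; minmax_free b; case: (leP a b) => ?
  end; try (exfalso; lra).

Section PathAlgebra.
Context (R : realType) (T : topologicalType).
Local Notation I := (unit_interval R).

Lemma clamp0 : clamp 0 = zero :> I. Proof. by []. Qed.
Lemma clamp1 : clamp 1 = one :> I. Proof. by []. Qed.

Lemma clamp_le0 (r : R) : r <= 0 -> clamp r = zero :> I.
Proof.
move=> r0; apply: val_inj; rewrite val_zero /= min_r ?max_l //.
exact: le_trans r0 ler01.
Qed.

Lemma clamp_ge1 (r : R) : 1 <= r -> clamp r = one :> I.
Proof. by move=> r1; apply: val_inj; rewrite val_one /= min_l // max_r. Qed.

(** The straight homotopy from [u] to [v] in the parameter plane is mapped by [Q]. The groupoid laws
    use it with [Q] a path extended by [clamp], holonomy squares with [Q] a map on the square. *)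
Lemma path_homotopic_param (Q : R * R -> T) (u v : I -> R * R) (x y : T)
    (p q : {path I from x to y in T}) :
  continuous Q -> continuous u -> continuous v ->
  u zero = v zero -> u one = v one ->
  (forall t, p t = Q (u t)) -> (forall t, q t = Q (v t)) -> path_homotopic p q.
Proof.
move=> cQ cu cv uv0 uv1 pE qE.
pose w (st : I * I) : R * R :=
  ((1 - val st.1) * (u st.2).1 + val st.1 * (v st.2).1,
   (1 - val st.1) * (u st.2).2 + val st.1 * (v st.2).2).
have cw : continuous w.
  have cu2 : continuous (fun st : I * I => u st.2) by apply: cont_comp cu _; cont.
  have cv2 : continuous (fun st : I * I => v st.2) by apply: cont_comp cv _; cont.
  by rewrite /w; cont.
have wuv s t : u t = v t -> w (s, t) = v t.
  rewrite /w /= => ->; rewrite -!mulrDl !subrK !mul1r.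
  by case: (v t).
exists (Q \o w); split=> [|t|t|s|s] /=.
- exact: cont_comp cQ cw.
- rewrite pE /w; cbn [fst snd]; rewrite val_zero subr0 !mul1r !mul0r !addr0; by case: (u t).
- by rewrite qE /w; cbn [fst snd]; rewrite val_one subrr !mul1r !mul0r !add0r; case: (v t).
- by rewrite wuv // -qE; exact: path_zero.
- by rewrite wuv // -qE; exact: path_one.
Qed.

Lemma path_homotopic_reparam (Q : R -> T) (u v : I -> R) (x y : T)
    (p q : {path I from x to y in T}) :
  continuous Q -> continuous u -> continuous v ->
  u zero = v zero -> u one = v one ->
  (forall t, p t = Q (u t)) -> (forall t, q t = Q (v t)) -> path_homotopic p q.
Proof.
move=> cQ cu cv uv0 uv1 pE qE.
apply: (@path_homotopic_param (fun a => Q a.1)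
  (fun t => (u t, 0)) (fun t => (v t, 0))) => //=.
- by apply: cont_comp cQ _; cont.
- by cont.
- by cont.
- by rewrite uv0.
- by rewrite uv1.
Qed.

(** Both sides are constant outside of the unit interval, so the formula holds for every real [r]
    and nested concatenations unfold without range conditions. *)
Lemma path_catE (x y z : T) (p : {path I from x to y in T})
    (q : {path I from y to z in T}) (r : R) :
  path_cat p q (clamp r) =
  if r <= 2^-1 then p (clamp (2 * r)) else q (clamp (2 * r - 1)).
Proof.
rewrite -[path_cat p q (clamp r)]/(path_cat_fun p q (clamp r)) /path_cat_fun.
have [r0|r0] := leP r 0.
  rewrite (@clamp_le0 r) // val_zero; case: ifPn => h1; case: ifPn => h2; try (exfalso; lra).
  by rewrite !clamp_le0 //; lra.
have [r1|r1] := leP r 1; last first.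
  rewrite (@clamp_ge1 r (ltW r1)) val_one; case: ifPn => h1; case: ifPn => h2; try (exfalso; lra).
  by rewrite !clamp_ge1 //; lra.
by rewrite clampE //; lra.
Qed.

Definition path_cst (x : T) : {path I from x to x in T} := cst x.

Lemma path_cat_cong (x y z : T) (p p' : {path I from x to y in T})
    (q q' : {path I from y to z in T}) :
  path_homotopic p p' -> path_homotopic q q' ->
  path_homotopic (path_cat p q) (path_cat p' q').
Proof.
move=> [H [cH Hp Hp' Hx Hy]] [K [cK Kq Kq' Ky Kz]].
exists (fun st : I * I => if val st.2 <= 2^-1 :> R then H (st.1, clamp (2 * val st.2))
                          else K (st.1, clamp (2 * val st.2 - 1))).
split=> [|t|t|s|s].
- apply: glue_continuous; [by cont|apply: cont_comp cH _; cont|apply: cont_comp cK _; cont|].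
  move=> [s t] /= ->; rewrite mulfV ?pnatr_eq0 // subrr.
  by rewrite clamp0 clamp1 Hy Ky.
- by rewrite -[t in RHS]clamp_val path_catE Hp Kq.
- by rewrite -[t in RHS]clamp_val path_catE Hp' Kq'.
- by cbn beta iota delta [fst snd]; rewrite val_zero mulr0 Hx ifT // invr_ge0.
- cbn beta iota delta [fst snd]; rewrite val_one ifF; last by apply/negbTE; rewrite -ltNge; lra.
  by rewrite (_ : 2 * 1 - 1 = 1 :> R) ?Kz //; lra.
Qed.

Lemma path_rev_cong (x y : T) (p p' : {path I from x to y in T}) :
  path_homotopic p p' -> path_homotopic (path_rev p) (path_rev p').
Proof.
move=> [H [cH Hp Hp' Hx Hy]].
exists (fun st : I * I => H (st.1, clamp (1 - val st.2))); split=> [|t|t|s|s].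
- by apply: cont_comp cH _; cont.
- by rewrite Hp.
- by rewrite Hp'.
- by cbn beta iota delta [fst snd]; rewrite val_zero subr0 Hy.
- by cbn beta iota delta [fst snd]; rewrite val_one subrr Hx.
Qed.

Lemma path_catA (x y z w : T) (p : {path I from x to y in T})
    (q : {path I from y to z in T}) (r : {path I from z to w in T}) :
  path_homotopic (path_cat p (path_cat q r)) (path_cat (path_cat p q) r).
Proof.
(* The left side gives [p], [q], [r] the times 1/2, 1/4, 1/4, the right side 1/4, 1/4, 1/2. The
   maximum of three affine functions is the change of time, with breaks at 1/2 and 3/4. *)
apply: (@path_homotopic_reparam (fun a => path_cat (path_cat p q) r (clamp a))
  (fun t => Order.max (Order.max (val t / 2) (val t - 4^-1)) (2 * val t - 1)) (fun t => val t)).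
- exact: path_clamp_continuous.
- by cont.
- by cont.
- rewrite val_zero max_l; first by rewrite max_l; lra.
  by rewrite le_max; apply/orP; left; lra.
- cbn beta; rewrite val_one max_r; first by lra.
  by rewrite ge_max; apply/andP; split; lra.
- move=> t; rewrite -[t in LHS]clamp_val path_catE.
  have [t1|t1] := leP (val t) 2^-1.
    rewrite (_ : Order.max _ _ = val t / 2); last first.
      by minmax; lra.
    rewrite path_catE ifT; last by lra.
    rewrite path_catE ifT; last by lra.
    by congr (p (clamp _)); lra.
  have [t2|t2] := leP (val t) (3 / 4).
    rewrite (_ : Order.max _ _ = val t - 4^-1); last first.
      by minmax; lra.
    rewrite path_catE ifT; last by lra.
    rewrite path_catE ifT; last by lra.
    rewrite path_catE ifF; last by lra.
    by congr (q (clamp _)); lra.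
  rewrite (_ : Order.max _ _ = 2 * val t - 1); last first.
    by minmax; lra.
  rewrite path_catE ifF; last by lra.
  rewrite path_catE ifF; last by lra.
  by congr (r (clamp _)); lra.
- by move=> t; rewrite clamp_val.
Qed.

Lemma path_cat1 (x y : T) (p : {path I from x to y in T}) :
  path_homotopic (path_cat p (path_cst y)) p.
Proof.
apply: (@path_homotopic_reparam (fun a => p (clamp a))
  (fun t => Order.min 1 (2 * val t)) (fun t => val t)).
- exact: path_clamp_continuous.
- by cont.
- by cont.
- by cbn beta iota delta [fst snd]; rewrite val_zero; minmax; lra.
- by cbn beta iota delta [fst snd]; rewrite val_one; minmax; lra.
- move=> t; rewrite -[t in LHS]clamp_val path_catE.
  case: leP => t2; first by rewrite min_r //; lra.
  by rewrite min_l ?clamp1 ?path_one //; lra.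
- by move=> t; rewrite clamp_val.
Qed.

Lemma path_1cat (x y : T) (p : {path I from x to y in T}) :
  path_homotopic (path_cat (path_cst x) p) p.
Proof.
apply: (@path_homotopic_reparam (fun a => p (clamp a))
  (fun t => Order.max 0 (2 * val t - 1)) (fun t => val t)).
- exact: path_clamp_continuous.
- by cont.
- by cont.
- by cbn beta iota delta [fst snd]; rewrite val_zero; minmax; lra.
- by cbn beta iota delta [fst snd]; rewrite val_one; minmax; lra.
- move=> t; rewrite -[t in LHS]clamp_val path_catE.
  case: leP => t2; last by rewrite max_r //; lra.
  by rewrite max_l ?clamp0 ?path_zero //; lra.
- by move=> t; rewrite clamp_val.
Qed.

Lemma path_revE (x y : T) (p : {path I from x to y in T}) (r : R) :
  path_rev p (clamp r) = p (clamp (1 - r)).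
Proof.
rewrite -[path_rev p (clamp r)]/(path_rev_fun p (clamp r)) /path_rev_fun.
have [r0|r0] := leP r 0.
  rewrite (@clamp_le0 r) // val_zero subr0 [in RHS]clamp_ge1 ?clamp1 //; lra.
have [r1|r1] := leP r 1; last first.
  by rewrite [in LHS](@clamp_ge1 r (ltW r1)) val_one subrr [in RHS]clamp_le0 ?clamp0 //; lra.
by rewrite clampE //; lra.
Qed.

Lemma path_catV (x y : T) (p : {path I from x to y in T}) :
  path_homotopic (path_cat p (path_rev p)) (path_cst x).
Proof.
apply: (@path_homotopic_reparam (fun a => p (clamp a))
  (fun t => Order.min (2 * val t) (2 - 2 * val t)) (fun t => 0)).
- exact: path_clamp_continuous.
- by cont.
- by cont.
- by cbn beta iota delta [fst snd]; rewrite val_zero; minmax; lra.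
- by cbn beta iota delta [fst snd]; rewrite val_one; minmax; lra.
- move=> t; rewrite -[t in LHS]clamp_val path_catE path_revE.
  case: leP => t2; first by rewrite min_l //; lra.
  by rewrite min_r; [congr (p (clamp _)); lra|lra].
- by move=> t; rewrite clamp0 path_zero.
Qed.

Lemma path_revK (x y : T) (p : {path I from x to y in T}) :
  path_rev (path_rev p) = p.
Proof.
apply/path_eqP => t; rewrite -[t in LHS]clamp_val !path_revE -[t in RHS]clamp_val.
by congr (p (clamp _)); lra.
Qed.

Lemma path_Vcat (x y : T) (p : {path I from x to y in T}) :
  path_homotopic (path_cat (path_rev p) p) (path_cst y).
Proof. by have := path_catV (path_rev p); rewrite path_revK. Qed.

Lemma hclassE (x y : T) (p q : {path I from x to y in T}) :
  hclass p = hclass q <-> path_homotopic p q.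
Proof.
split=> [/eqmodP/asboolP //|pq].
by apply/eqmodP/asboolP.
Qed.

Lemma hclass_repr (x y : T) (c : pi1 R x y) : hclass (repr c) = c.
Proof. exact: reprK. Qed.

Lemma repr_hclass (x y : T) (p : {path I from x to y in T}) :
  path_homotopic (repr (hclass p)) p.
Proof. by apply/hclassE; rewrite hclass_repr. Qed.

Lemma pi1_mulE (x y z : T) (p : {path I from x to y in T})
    (q : {path I from y to z in T}) :
  pi1_mul (hclass p) (hclass q) = hclass (path_cat p q).
Proof. by apply/hclassE/path_cat_cong; exact: repr_hclass. Qed.

Lemma pi1_invE (x y : T) (p : {path I from x to y in T}) :
  pi1_inv (hclass p) = hclass (path_rev p).
Proof. by apply/hclassE/path_rev_cong; exact: repr_hclass. Qed.

Lemma pi1_ind (x y : T) (P : pi1 R x y -> Prop) :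
  (forall p, P (hclass p)) -> forall c, P c.
Proof. by move=> Pp c; rewrite -(hclass_repr c). Qed.

Lemma pi1_mulA (x y z w : T) (a : pi1 R x y) (b : pi1 R y z) (c : pi1 R z w) :
  pi1_mul a (pi1_mul b c) = pi1_mul (pi1_mul a b) c.
Proof.
elim/pi1_ind: a => p; elim/pi1_ind: b => q; elim/pi1_ind: c => r.
by rewrite !pi1_mulE; apply/hclassE/path_catA.
Qed.

Lemma pi1_mul1 (x y : T) (a : pi1 R x y) : pi1_mul a (hclass (path_cst y)) = a.
Proof. by elim/pi1_ind: a => p; rewrite pi1_mulE; apply/hclassE/path_cat1. Qed.

Lemma pi1_1mul (x y : T) (a : pi1 R x y) : pi1_mul (hclass (path_cst x)) a = a.
Proof. by elim/pi1_ind: a => p; rewrite pi1_mulE; apply/hclassE/path_1cat. Qed.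

Lemma pi1_mulV (x y : T) (a : pi1 R x y) : pi1_mul a (pi1_inv a) = hclass (path_cst x).
Proof. by elim/pi1_ind: a => p; rewrite pi1_invE pi1_mulE; apply/hclassE/path_catV. Qed.

Lemma pi1_Vmul (x y : T) (a : pi1 R x y) : pi1_mul (pi1_inv a) a = hclass (path_cst y).
Proof. by elim/pi1_ind: a => p; rewrite pi1_invE pi1_mulE; apply/hclassE/path_Vcat. Qed.

Lemma pi1_mulVK (x y z : T) (a : pi1 R x y) (b : pi1 R z y) :
  pi1_mul (pi1_mul a (pi1_inv b)) b = a.
Proof. by rewrite -pi1_mulA pi1_Vmul pi1_mul1. Qed.

Lemma pi1_mulKV (x y z : T) (a : pi1 R x y) (b : pi1 R y z) :
  pi1_mul (pi1_mul a b) (pi1_inv b) = a.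
Proof. by rewrite -pi1_mulA pi1_mulV pi1_mul1. Qed.

Lemma pi1_invK (x y : T) (a : pi1 R x y) : pi1_inv (pi1_inv a) = a.
Proof. by elim/pi1_ind: a => p; rewrite !pi1_invE path_revK. Qed.

Lemma pi1_invM (x y z : T) (a : pi1 R x y) (b : pi1 R y z) :
  pi1_inv (pi1_mul a b) = pi1_mul (pi1_inv b) (pi1_inv a).
Proof.
rewrite -[LHS]pi1_mul1 -(pi1_mulV a) pi1_mulA; congr pi1_mul.
by rewrite -[LHS](pi1_mulKV _ b) -(pi1_mulA _ a b) pi1_Vmul pi1_1mul.
Qed.

Section Holonomy.
Variable L : local_system R T.

(** The constant path is homotopic to its own square, so its holonomy is a nonzero idempotent. *)
Lemma hol_cst (x : T) : hol L (path_cst x) = 1.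
Proof.
apply: (mulfI (hol_neq0 L (path_cst x))); rewrite mulr1 -hol_cat.
exact: hol_homotopic (path_cat1 (path_cst x)).
Qed.

(* The square [Q] read along its left and top edges, or along its bottom and
   right edges. *)
Lemma hol_square (Q : I * I -> T) (x y z w : T)
    (b : {path I from x to y in T}) (r : {path I from y to w in T})
    (l : {path I from x to z in T}) (t : {path I from z to w in T}) :
  continuous Q ->
  (forall a, b a = Q (a, zero)) -> (forall a, r a = Q (one, a)) ->
  (forall a, l a = Q (zero, a)) -> (forall a, t a = Q (a, one)) ->
  hol L b * hol L r = hol L l * hol L t.
Proof.
move=> cQ bE rE lE tE; rewrite -!hol_cat; apply: hol_homotopic.
apply: (@path_homotopic_param (fun st => Q (clamp st.1, clamp st.2))
  (fun a => (Order.min 1 (2 * val a), Order.max 0 (2 * val a - 1)))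
  (fun a => (Order.max 0 (2 * val a - 1), Order.min 1 (2 * val a)))).
- by apply: cont_comp cQ _; cont.
- by cont.
- by cont.
- by cbn beta iota delta [fst snd]; rewrite val_zero ; congr pair; minmax; lra.
- by cbn beta iota delta [fst snd]; rewrite val_one ; congr pair; minmax; lra.
- move=> s; rewrite -[s in LHS]clamp_val path_catE; cbn beta iota delta [fst snd].
  case: leP => s1; last by rewrite min_l ?max_r ?clamp1 ?rE //; lra.
  by rewrite min_r ?max_l ?clamp0 ?bE //; lra.
- move=> s; rewrite -[s in LHS]clamp_val path_catE; cbn beta iota delta [fst snd].
  case: leP => s1; last by rewrite min_l ?max_r ?clamp1 ?tE //; lra.
  by rewrite min_r ?max_l ?clamp0 ?lE //; lra.
Qed.

End Holonomy.

End PathAlgebra.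

(** * Homology with local coefficients *)

Section FreeLinear.
Context (S : nzRingType) (K : choiceType).
Local Notation FK := {freeg K / S}.

(** Universal property of the free module; identities between chain maps reduce through it to a
    single simplex. *)
Lemma fglift_unique (V : lmodType S) (G : FK -> V) (f : K -> V) :
  linear G -> (forall k, G << k >> = f k) -> forall c, G c = fglift f c.
Proof.
move=> linG Gf.
pose G' : {linear FK -> V} := HB.pack G (GRing.isLinear.Build _ _ _ _ G linG).
pose f' : {linear FK -> V} :=
  HB.pack (fglift f : FK -> V) (GRing.isLinear.Build _ _ _ _ _ (fglift_linear f)).
elim/(@freeg_ind_dom0 S K) => [|k s c _ _ IH].
  by rewrite -[LHS]/(G' 0) -[RHS]/(f' 0) !linear0.
have -> : << k *g s >> = k *: << s >> :> FK.
  by apply/eqP/freeg_eqP => t; rewrite coeffZ !coeffU mul1r.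
have Gs : G' << s >> = f' << s >>.
  by rewrite -[LHS]/(G << s >>) Gf -[RHS]/(fglift f << s >>) liftU scale1r.
have IH' : G' c = f' c by [].
by rewrite -[LHS]/(G' (k *: << s >> + c)) -[RHS]/(f' (k *: << s >> + c)) !linearP Gs IH'.
Qed.

Lemma linear_fglift (V W : lmodType S) (G : {linear V -> W}) (f : K -> V) c :
  G (fglift f c) = fglift (fun k => G (f k)) c.
Proof.
apply: (fglift_unique (G := fun c => G (fglift f c))) => [a d e|k].
  by rewrite fglift_linear linearP.
by rewrite liftU scale1r.
Qed.

Lemma eq_fglift (V : lmodType S) (f g : K -> V) (c : FK) :
  f =1 g -> fglift f c = fglift g c.
Proof. by move=> /funext ->. Qed.

Lemma fgliftB (V : lmodType S) (f g : K -> V) (c : FK) :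
  fglift (fun k => f k - g k) c = fglift f c - fglift g c.
Proof.
apply/esym; apply: (fglift_unique (G := fun c => fglift f c - fglift g c)).
  by move=> a d e; rewrite !fglift_linear scalerBr opprD addrACA.
by move=> k; rewrite !liftU !scale1r.
Qed.

Lemma fglift_id (c : FK) : fglift (fun k => << k >> : FK) c = c.
Proof. by apply/esym; apply: (fglift_unique (G := idfun)). Qed.

Lemma scale_freeg (a b : S) (k : K) : a *: << b *g k >> = << (a * b) *g k >> :> FK.
Proof. by apply/eqP/freeg_eqP => t; rewrite coeffZ !coeffU mulrA. Qed.

End FreeLinear.

Section Boundaries.
Context (R : realType) (T : topologicalType) (L : local_system R T).
Local Notation I := (unit_interval R).
Local Notation triangle := (triangle R).

Lemma boundary1E (a : R[i]) (s : continuousType I T) :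
  boundary1 L << a *g s >> =
  << a * hol L (path_of s) *g s one >> - << a *g s zero >>.
Proof. by rewrite /boundary1 liftU scalerBr !scale_freeg mulr1. Qed.

Lemma boundary2E (a : R[i]) (s : continuousType triangle T) :
  boundary2 L << a *g s >> =
  << a * hol L (path_of (s \o @face01 R : continuousType I T))
     *g (s \o @face12 R : continuousType I T) >> -
  << a *g (s \o @face02 R : continuousType I T) >> +
  << a *g (s \o @face01 R : continuousType I T) >>.
Proof. by rewrite /boundary2 liftU scalerDr scalerBr !scale_freeg mulr1. Qed.

Lemma face12_zero : face12 zero = face01 one :> triangle.
Proof. by apply: val_inj; congr pair; rewrite ?val_zero ?val_one ?subr0. Qed.

Lemma face02_zero : face02 zero = face01 zero :> triangle.
Proof. by apply: val_inj; congr pair; rewrite val_zero. Qed.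

End Boundaries.

Section InducedMap.
Context (R : realType) (T U : topologicalType).
Variables (L : local_system R T) (L' : local_system R U).
Variables (f : continuousType T U) (phi : T -> R[i]).
Local Notation I := (unit_interval R).
Local Notation triangle := (triangle R).
Hypothesis iso : is_local_system_iso L L' f phi.

HB.instance Definition _ :=
  @GRing.isLinear.Build _ (chain1 R T) (chain1 R U) _ (chain1_map f phi)
    (fglift_linear _).

Definition chain0_map : chain0 R T -> chain0 R U :=
  fglift (fun x : T => << phi x *g f x >> : chain0 R U).

HB.instance Definition _ :=
  @GRing.isLinear.Build _ (chain0 R T) (chain0 R U) _ chain0_map (fglift_linear _).

Definition chain2_map : chain2 R T -> chain2 R U :=
  fglift (fun s : continuousType triangle T =>
    << phi (s (face01 zero)) *g (f \o s : continuousType triangle U) >> : chain2 R U).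

Lemma chain1_mapE (a : R[i]) (s : continuousType I T) :
  chain1_map f phi << a *g s >> =
  << a * phi (s zero) *g (f \o s : continuousType I U) >>.
Proof. by rewrite /chain1_map liftU scale_freeg. Qed.

Lemma chain0_mapE (a : R[i]) (x : T) :
  chain0_map << a *g x >> = << a * phi x *g f x >>.
Proof. by rewrite /chain0_map liftU scale_freeg. Qed.

Lemma hol_path_map (s : continuousType I T) :
  phi (s one) * hol L (path_of s) =
  hol L' (path_of (f \o s : continuousType I U)) * phi (s zero).
Proof.
rewrite (proj2 iso); congr (hol L' _ * _).
by apply/path_eqP => t.
Qed.

Lemma boundary1_chain_map (c : chain1 R T) :
  boundary1 L' (chain1_map f phi c) = chain0_map (boundary1 L c).
Proof.
rewrite /chain1_map linear_fglift [in RHS]/boundary1 (linear_fglift chain0_map).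
apply: eq_fglift => s.
rewrite linearB /= !chain0_mapE boundary1E mul1r.
by rewrite mulrC -hol_path_map mulrC.
Qed.

(** The coefficient on the edge from v1 to v2 has been carried from the stalk at v0 along the edge
    from v0 to v1; naturality of [phi] along that edge moves it past the chain map. *)
Lemma boundary2_chain_map (c : chain2 R T) :
  boundary2 L' (chain2_map c) = chain1_map f phi (boundary2 L c).
Proof.
rewrite /chain2_map linear_fglift [in RHS]/boundary2 linear_fglift.
apply: eq_fglift => s.
rewrite linearD linearB /= !chain1_mapE boundary2E /=.
rewrite face12_zero face02_zero !mul1r.
have := hol_path_map (s \o @face01 R); rewrite /= mulrC => ->.
rewrite [_ * phi _]mulrC.
(* The two bracketings are the same function with different continuity proofs. *)
have fsA (g : continuousType I triangle) :
    ((f \o s) \o g : continuousType I U) = (f \o (s \o g) : continuousType I U).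
  exact/continuousEP.
have -> := congr1 (fun g => hol L' (path_of g)) (fsA (@face01 R)).
by congr (_ - _ + _); congr Freeg; congr (_ :: _); congr pair; exact: fsA.
Qed.

Lemma chain1_map_cycle (z : Defs.cycle L) : chain1_map f phi (val z) \in is_cycle L'.
Proof.
by have := valP z; rewrite !inE boundary1_chain_map => /eqP ->; rewrite linear0.
Qed.

Definition cycle_map (z : Defs.cycle L) : Defs.cycle L' :=
  exist _ (chain1_map f phi (val z)) (chain1_map_cycle z).

Lemma cycle_map_linear : linear cycle_map.
Proof. by move=> a z w; apply: val_inj; rewrite /= !linearP. Qed.

HB.instance Definition _ :=
  @GRing.isLinear.Build _ (Defs.cycle L) (Defs.cycle L') _ cycle_map cycle_map_linear.

Lemma cycle_map_class (z w : Defs.cycle L) : homology_class z = homology_class w ->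
  homology_class (cycle_map z) = homology_class (cycle_map w).
Proof.
move=> /eqP; rewrite homology_classP => /asboolP[b bzw].
apply/eqP; rewrite homology_classP -linearB; apply/asboolP.
by exists (chain2_map b); rewrite boundary2_chain_map bzw.
Qed.

Definition H1_map (u : H1 L) : H1 L' := homology_class (cycle_map (repr u)).

Lemma H1_map_class (z : Defs.cycle L) :
  H1_map (homology_class z) = homology_class (cycle_map z).
Proof. by apply: cycle_map_class; rewrite repr_class. Qed.

Lemma H1_map_linear : linear H1_map.
Proof.
move=> a u v; rewrite -[u]repr_class -[v]repr_class.
rewrite -[a *: _]/(scaleH1 a _) -homology_classZ -homology_classD !H1_map_class.
by rewrite linearP homology_classD homology_classZ.
Qed.

HB.instance Definition _ :=
  @GRing.isLinear.Build _ (H1 L) (H1 L') _ H1_map H1_map_linear.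

Lemma H1_map_induced : induces_on_H1 f phi (H1_map : {linear H1 L -> H1 L'}).
Proof. by move=> z; exists (cycle_map z) => //; exact: H1_map_class. Qed.

Lemma induced_exists : exists F : {linear H1 L -> H1 L'}, induces_on_H1 f phi F.
Proof. by exists H1_map; exact: H1_map_induced. Qed.

End InducedMap.

Lemma local_system_iso_id (R : realType) (T : topologicalType)
    (L : local_system R T) : is_local_system_iso L L idfun (fun=> 1).
Proof.
split=> [x|x y p]; first exact: oner_neq0.
by rewrite mul1r mulr1; congr (hol L _); apply/path_eqP.
Qed.

Lemma induced_id (R : realType) (T : topologicalType) (L : local_system R T) :
  induces_on_H1 (idfun : continuousType T T) (fun=> 1) (idfun : H1 L -> H1 L).
Proof.
move=> z; exists z => //; rewrite -[LHS]fglift_id /chain1_map.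
apply: eq_fglift => s; congr << _ *g _ >>.
exact/continuousEP.
Qed.

Section InducedComposition.
Context (R : realType) (T U V : topologicalType).
Variables (L : local_system R T) (L' : local_system R U) (L'' : local_system R V).
Variables (f : continuousType T U) (phi : T -> R[i]).
Variables (g : continuousType U V) (psi : U -> R[i]).

Lemma local_system_iso_comp :
  is_local_system_iso L L' f phi -> is_local_system_iso L' L'' g psi ->
  is_local_system_iso L L'' (g \o f) (fun x => psi (f x) * phi x).
Proof.
move=> [phi0 phiE] [psi0 psiE]; split=> [x|x y p]; first by rewrite mulf_neq0.
rewrite -mulrA phiE mulrA psiE -mulrA; congr (hol L'' _ * _).
exact/path_eqP.
Qed.

Lemma induced_comp (F : H1 L -> H1 L') (G : H1 L' -> H1 L'') :
  induces_on_H1 f phi F -> induces_on_H1 g psi G ->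
  induces_on_H1 (g \o f) (fun x => psi (f x) * phi x) (G \o F).
Proof.
move=> HF HG z; have [w wE Fz] := HF z; have [v vE Gw] := HG w.
exists v; last by rewrite /= Fz Gw.
rewrite vE wE [chain1_map f phi _]/chain1_map linear_fglift; apply: eq_fglift => s.
rewrite /= chain1_mapE mulrC; congr << _ *g _ >>.
exact/continuousEP.
Qed.

End InducedComposition.

(** The two paths have different types: the ends of [path_of p] equal [x] and [y] only through the
    equations stored in [p], which are eliminated. *)
Lemma hol_path_of (R : realType) (T : topologicalType) (L : local_system R T)
    (x y : T) (p : {path (unit_interval R) from x to y in T}) :
  hol L (path_of p) = hol L p.
Proof.
case: p => p [[cp] [p0 p1]]; move: (p0) (p1); case: _ / p0; case: _ / p1 => p0' p1'.
by congr (hol L _); apply/path_eqP.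
Qed.

Section Prism.
Context (R : realType) (T U : topologicalType).
Variables (L : local_system R T) (L' : local_system R U).
Variables (f0 f1 : continuousType T U) (phi0 phi1 : T -> R[i]).
Local Notation I := (unit_interval R).
Local Notation triangle := (triangle R).
Variable Theta : I * T -> U.
Hypothesis cTheta : continuous Theta.
Hypothesis Theta0 : forall x, Theta (zero, x) = f0 x.
Hypothesis Theta1 : forall x, Theta (one, x) = f1 x.
Hypothesis iso0 : is_local_system_iso L L' f0 phi0.

Lemma trace_continuous x : continuous (fun s : I => Theta (s, x)).
Proof. by apply: cont_comp cTheta _; cont. Qed.

Definition trace x : {path I from f0 x to f1 x in U} :=
  mk_path (@trace_continuous x) (Theta0 x) (Theta1 x).

Hypothesis phi01 : forall x, phi1 x = hol L' (trace x) * phi0 x.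

(* The square I x I is cut along its diagonal into two triangles. *)
Lemma lower_continuous (s : continuousType I T) :
  continuous (fun a : triangle => Theta (clamp (val a).2, s (clamp ((val a).1 + (val a).2)))).
Proof.
have cs : continuous (fun a : triangle => s (clamp ((val a).1 + (val a).2))).
  by apply: cont_comp (@cts_fun _ _ s) _; cont.
by apply: cont_comp cTheta _; cont.
Qed.

Lemma upper_continuous (s : continuousType I T) :
  continuous (fun a : triangle => Theta (clamp ((val a).1 + (val a).2), s (clamp (val a).2))).
Proof.
have cs : continuous (fun a : triangle => s (clamp (val a).2)).
  by apply: cont_comp (@cts_fun _ _ s) _; cont.
by apply: cont_comp cTheta _; cont.
Qed.

Definition lower (s : continuousType I T) : continuousType triangle U :=
  mkcts (@lower_continuous s).
Definition upper (s : continuousType I T) : continuousType triangle U :=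
  mkcts (@upper_continuous s).

Definition prism0 : chain0 R T -> chain1 R U :=
  fglift (fun x : T => << phi0 x *g (trace x : continuousType I U) >> : chain1 R U).

HB.instance Definition _ :=
  @GRing.isLinear.Build _ (chain0 R T) (chain1 R U) _ prism0 (fglift_linear _).

Definition prism1 : chain1 R T -> chain2 R U :=
  fglift (fun s : continuousType I T =>
    << phi0 (s zero) *g upper s >> - << phi0 (s zero) *g lower s >> : chain2 R U).

Lemma prism0E (a : R[i]) (x : T) :
  prism0 << a *g x >> = << a * phi0 x *g (trace x : continuousType I U) >>.
Proof. by rewrite /prism0 liftU scale_freeg. Qed.

(** The two triangles share the diagonal, which cancels ([E3]). The sides at times zero and one give
    the two chain maps, the tracks of the end points give the prism over the boundary; [phi01]
    matches the coefficients at time one. *)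
Lemma prism_boundary (c : chain1 R T) :
  boundary2 L' (prism1 c) =
  chain1_map f1 phi1 c - chain1_map f0 phi0 c - prism0 (boundary1 L c).
Proof.
rewrite /prism1 linear_fglift /chain1_map -fgliftB [in RHS]/boundary1 (linear_fglift prism0).
rewrite -fgliftB; apply: eq_fglift => s.
rewrite !linearB /= !prism0E !boundary2E.
have c1 (t : I) : clamp (val t) = t := clamp_val t.
have E1 : (upper s \o @face01 R : continuousType I U) = (trace (s zero) : continuousType I U).
  by apply/continuousEP => t; rewrite /= /mkcts /mk_path /= addr0 c1 clamp0.
have E2 : (upper s \o @face12 R : continuousType I U) = (f1 \o s : continuousType I U).
  by apply/continuousEP => t; rewrite /= /mkcts /= subrK c1 clamp1 Theta1.
have E3 : (upper s \o @face02 R : continuousType I U) = (lower s \o @face02 R : continuousType I U).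
  by apply/continuousEP => t; rewrite /= /mkcts /= add0r.
have E4 : (lower s \o @face01 R : continuousType I U) = (f0 \o s : continuousType I U).
  by apply/continuousEP => t; rewrite /= /mkcts /= addr0 c1 clamp0 Theta0.
have E5 : (lower s \o @face12 R : continuousType I U) = (trace (s one) : continuousType I U).
  by apply/continuousEP => t; rewrite /= /mkcts /= subrK c1 clamp1.
have -> := congr1 (fun g => hol L' (path_of g)) E1.
have -> := congr1 (fun g => hol L' (path_of g)) E4.
rewrite hol_path_of E1 E2 E3 E4 E5 phi01 mul1r.
rewrite [phi0 (s zero) * hol L' (path_of _)]mulrC -(hol_path_map iso0).
rewrite [phi0 (s one) * _]mulrC [phi0 (s zero) * _]mulrC.
have cancel (V : zmodType) (a b d e g : V) :
    a - e + d - (b - e + g) = a - g + (- b - - d).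
  rewrite opprK !opprD opprK [a - e + d]addrAC [- b + e]addrC -[e - b - g]addrA.
  by rewrite [LHS]addrA subrK [- b - g]addrC addrACA [- b + d]addrC.
exact: cancel.
Qed.

(** On a cycle the term [prism0 (boundary1 L c)] vanishes, so the two images differ by the boundary
    of a prism. *)
Lemma induced_homotopic (F0 F1 : H1 L -> H1 L') :
  induces_on_H1 f0 phi0 F0 -> induces_on_H1 f1 phi1 F1 -> F0 =1 F1.
Proof.
move=> HF0 HF1 u; rewrite -[u]repr_class.
have [w wE ->] := HF0 (repr u); have [w' w'E ->] := HF1 (repr u).
apply/esym/eqP; rewrite homology_classP; apply/asboolP; exists (prism1 (val (repr u))).
rewrite prism_boundary linearB /= wE w'E.
have := valP (repr u); rewrite inE => /eqP ->.
by rewrite linear0 subr0.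
Qed.

End Prism.

(** * Ambient isotopies of the complex line *)

Section Push.
Context (R : realType).
Implicit Types (m x y : R).

Definition bump x : R := Order.max 0 (1 - `|x|).

(* [push m] is piecewise linear, moves 0 to m and is the identity outside of
   the interval from -1 to 1. *)
Definition push m x : R := x + m * bump x.
(** Inverse of [push m]. If [x] is the image of a point in the interval from -1 to 1, the bump
    height at that point is one of the two quotients, according to its sign, and it is the smaller
    one. *)
Definition pull m x : R :=
  x - m * Order.max 0 (Order.min ((1 + x) * (1 + m)^-1) ((1 - x) * (1 - m)^-1)).

(** The bound keeps the slopes [1 + m] and [1 - m] of the two inner pieces positive. *)
Lemma pushK m x : `|m| <= 2^-1 -> pull m (push m x) = x.
Proof.
rewrite ler_norml => /andP[m1 m2].
have e1 : 1 + m != 0 by rewrite lt0r_neq0 //; lra.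
have e2 : 1 - m != 0 by rewrite lt0r_neq0 //; lra.
rewrite /push /bump.
have [x0|x0] := leP 0 x.
  rewrite ger0_norm //; have [x1|x1] := leP x 1.
    rewrite max_r; last by lra.
    rewrite /pull; have -> : (1 - (x + m * (1 - x))) * (1 - m)^-1 = 1 - x by field.
    rewrite min_r; last by rewrite ler_pdivlMr; nra.
    by rewrite max_r ?addrK //; lra.
  rewrite max_l; last by lra.
  rewrite mulr0 addr0 /pull max_l ?mulr0 ?subr0 //.
  by rewrite ge_min; apply/orP; right; rewrite ler_pdivrMr; lra.
rewrite ltr0_norm // opprK; have [x1|x1] := leP (-1) x.
  rewrite max_r; last by lra.
  rewrite /pull; have -> : (1 + (x + m * (1 + x))) * (1 + m)^-1 = 1 + x by field.
  rewrite min_l; last by rewrite ler_pdivlMr; nra.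
  by rewrite max_r ?addrK //; lra.
rewrite max_l; last by lra.
rewrite mulr0 addr0 /pull max_l ?mulr0 ?subr0 //.
by rewrite ge_min; apply/orP; left; rewrite ler_pdivrMr; lra.
Qed.

Lemma pullK m y : `|m| <= 2^-1 -> push m (pull m y) = y.
Proof.
rewrite ler_norml => /andP[m1 m2].
have e1 : 1 + m != 0 by rewrite lt0r_neq0 //; lra.
have e2 : 1 - m != 0 by rewrite lt0r_neq0 //; lra.
rewrite /pull; set a := _ * _^-1; set b := (1 - y) * _.
have aE : (1 + m) * a = 1 + y by rewrite /a; field.
have bE : (1 - m) * b = 1 - y by rewrite /b; field.
have [ab|ab] := leP a b.
  have [a0|a0] := leP 0 a.
    rewrite /push /bump ler0_norm; last by nra.
    by rewrite max_r; nra.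
  rewrite /push /bump mulr0 subr0 max_l ?mulr0 ?addr0 //.
  by rewrite ler0_norm; nra.
have [a0|a0] := leP 0 b.
  rewrite /push /bump ger0_norm; last by nra.
  by rewrite max_r; nra.
rewrite /push /bump mulr0 subr0 max_l ?mulr0 ?addr0 //.
by rewrite ger0_norm; nra.
Qed.

Lemma push0 m : push m 0 = m.
Proof. by rewrite /push /bump normr0 subr0 max_r ?ler01 // add0r mulr1. Qed.

Lemma push_out m x : 1 <= `|x| -> push m x = x.
Proof. by move=> x1; rewrite /push /bump max_l ?mulr0 ?addr0 // subr_le0. Qed.

Lemma push_0m x : push 0 x = x.
Proof. by rewrite /push mul0r addr0. Qed.

Lemma bump_ge0 x : 0 <= bump x.
Proof. by rewrite /bump le_max lexx. Qed.

Lemma bump_le1 x : bump x <= 1.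
Proof. by rewrite /bump ge_max ler01 lerBlDr lerDl normr_ge0. Qed.

Lemma bump_out x : 1 <= `|x| -> bump x = 0.
Proof. by move=> x1; rewrite /bump max_l // subr_le0. Qed.

Lemma bump0 : bump 0 = 1.
Proof. by rewrite /bump normr0 subr0 max_r. Qed.

(** Truncating the displacement makes pushes invertible for every centre and every amount, so
    invertibility needs no closeness condition. *)
Definition cut x : R := Order.max (- 2^-1) (Order.min 2^-1 x).

Lemma cut_le x : `|cut x| <= 2^-1.
Proof. by rewrite /cut ler_norml; apply/andP; split; minmax; lra. Qed.

Lemma cut_id x : `|x| <= 2^-1 -> cut x = x.
Proof. by rewrite /cut ler_norml => /andP[? ?]; minmax; lra. Qed.

Lemma cut_bump_le x y : `|cut x * bump y| <= 2^-1.
Proof.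
rewrite normrM (ger0_norm (bump_ge0 y)) -[leRHS]mulr1.
by apply: ler_pM; rewrite ?cut_le ?bump_le1 ?bump_ge0.
Qed.

Variable d : R.
Hypothesis d0 : 0 < d.
Implicit Types (c z : R[i]) (a : R).

(** The horizontal displacement in units of [d], damped with the vertical distance from the centre.
    It sees [z] only through its imaginary part, which [hpush] preserves, so inversion works on each
    horizontal line separately. *)
Definition shift_amount c a z : R := cut (a * d^-1) * bump ((complex.Im z - complex.Im c) * d^-1).

Definition hpush c a z : R[i] :=
  (complex.Re c + d * push (shift_amount c a z) ((complex.Re z - complex.Re c) * d^-1))
    +i* complex.Im z.
Definition hpull c a z : R[i] :=
  (complex.Re c + d * pull (shift_amount c a z) ((complex.Re z - complex.Re c) * d^-1))
    +i* complex.Im z.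

Definition swap z : R[i] := complex.Im z +i* complex.Re z.

Lemma swapK : involutive swap. Proof. by case. Qed.

Definition vpush c a z : R[i] := swap (hpush (swap c) a (swap z)).
Definition vpull c a z : R[i] := swap (hpull (swap c) a (swap z)).

(** Distance at least [e] in the maximum norm of the two coordinates. *)
Definition far (e : R) z c := e <= `|complex.Re z - complex.Re c| \/
  e <= `|complex.Im z - complex.Im c|.

Lemma scale_shift x y : (x + d * y - x) * d^-1 = y.
Proof. by rewrite addrAC subrr add0r mulrC mulKf // gt_eqF. Qed.

Lemma hpushK c a z : hpull c a (hpush c a z) = z.
Proof.
have E : shift_amount c a (hpush c a z) = shift_amount c a z by [].
rewrite /hpull E /hpush /= scale_shift pushK; last exact: cut_bump_le.
by rewrite mulrC divfK ?gt_eqF // addrC subrK; case: z {E}.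
Qed.

Lemma hpullK c a z : hpush c a (hpull c a z) = z.
Proof.
have E : shift_amount c a (hpull c a z) = shift_amount c a z by [].
rewrite /hpush E /hpull /= scale_shift pullK; last exact: cut_bump_le.
by rewrite mulrC divfK ?gt_eqF // addrC subrK; case: z {E}.
Qed.

Lemma hpush_center c a : `|a| <= d / 2 -> hpush c a c = (complex.Re c + a) +i* complex.Im c.
Proof.
move=> ad; rewrite /hpush /shift_amount !subrr !mul0r push0 bump0 mulr1 cut_id.
  by rewrite mulrC divfK ?gt_eqF.
by rewrite normrM normfV (gtr0_norm d0) ler_pdivrMr // mulrC.
Qed.

Lemma hpush_0 c z : hpush c 0 z = z.
Proof.
rewrite /hpush /shift_amount mul0r cut_id ?normr0 ?invr_ge0 // mul0r push_0m.
by rewrite mulrC divfK ?gt_eqF // addrC subrK; case: z.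
Qed.

Lemma hpush_far c a z : far d z c -> hpush c a z = z.
Proof.
have le1 x : d <= `|x| -> 1 <= `|x * d^-1|.
  by move=> dx; rewrite normrM normfV (gtr0_norm d0) ler_pdivlMr ?mul1r.
have E : complex.Re c + d * ((complex.Re z - complex.Re c) / d) = complex.Re z.
  by rewrite mulrC divfK ?gt_eqF // addrC subrK.
move=> [/le1 zc|/le1 zc]; rewrite /hpush.
  by rewrite push_out // E; case: (z).
by rewrite /shift_amount bump_out // mulr0 push_0m E; case: (z).
Qed.

Lemma vpushK c a z : vpull c a (vpush c a z) = z.
Proof. by rewrite /vpull /vpush swapK hpushK swapK. Qed.

Lemma vpullK c a z : vpush c a (vpull c a z) = z.
Proof. by rewrite /vpull /vpush swapK hpullK swapK. Qed.

(** The horizontal push brings [c] to the corner with the real part of [c'] and the imaginary part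
    of [c]; the vertical push is centred at that corner. *)
Definition move c c' z : R[i] :=
  vpush (complex.Re c' +i* complex.Im c) (complex.Im c' - complex.Im c)
    (hpush c (complex.Re c' - complex.Re c) z).
Definition unmove c c' z : R[i] :=
  hpull c (complex.Re c' - complex.Re c)
    (vpull (complex.Re c' +i* complex.Im c) (complex.Im c' - complex.Im c) z).

Definition close c c' :=
  `|complex.Re c' - complex.Re c| <= d / 2 /\ `|complex.Im c' - complex.Im c| <= d / 2.

Lemma moveK c c' z : unmove c c' (move c c' z) = z.
Proof. by rewrite /unmove /move vpushK hpushK. Qed.

Lemma unmoveK c c' z : move c c' (unmove c c' z) = z.
Proof. by rewrite /unmove /move hpullK vpullK. Qed.

Lemma move_center c c' : close c c' -> move c c' c = c'.
Proof.
move=> [cRe cIm]; rewrite /move hpush_center // (addrC (complex.Re c)) subrK /vpush.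
by rewrite hpush_center //= (addrC (complex.Im c)) subrK; case: (c').
Qed.

Lemma move_id c z : move c c z = z.
Proof. by rewrite /move !subrr /vpush !hpush_0 swapK. Qed.

(** The first push acts within [d] of [c], the second within [d] of a corner at distance at most
    [d / 2] from [c]; both are trivial at distance [2 * d]. *)
Lemma move_far c c' z : close c c' -> far (2 * d) z c -> move c c' z = z.
Proof.
have dp := d0; move=> [cRe _] zc; rewrite /move hpush_far; last first.
  by case: zc => zc; [left|right]; apply: le_trans _ zc; lra.
rewrite /vpush hpush_far ?swapK //; case: zc => zc; rewrite /far /=; [right|left].
  move: cRe zc; rewrite -[X in `|X| <= d / 2](opprB (complex.Re c)).
  rewrite normrN => cRe zc.
  have := ler_normB (complex.Re z - complex.Re c') (complex.Re c - complex.Re c').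
  rewrite opprB addrA subrK. by lra.
by lra.
Qed.

End Push.

Section PushContinuity.
Context (R : realType) (X : topologicalType) (d : R).

Lemma cont_bump (f : X -> R) : continuous f -> continuous (fun x => bump (f x)).
Proof. by move=> cf; rewrite /bump; cont. Qed.

Lemma cont_shift_amount (c z : X -> R[i]) (a : X -> R) :
  continuous c -> continuous a -> continuous z ->
  continuous (fun x => shift_amount d (c x) (a x) (z x)).
Proof.
move=> cc ca cz; rewrite /shift_amount /cut; apply: contM; first by cont.
by apply: cont_bump; cont.
Qed.

Lemma cont_hpush (c z : X -> R[i]) (a : X -> R) :
  continuous c -> continuous a -> continuous z ->
  continuous (fun x => hpush d (c x) (a x) (z x)).
Proof.
move=> cc ca cz; have cs := cont_shift_amount cc ca cz.
rewrite /hpush /push; apply: cont_complex; last by cont.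
apply: contD; first by cont.
apply: contM; first by cont.
apply: contD; first by cont.
by apply: contM => //; apply: cont_bump; cont.
Qed.

Lemma cont_hpull (c z : X -> R[i]) (a : X -> R) :
  continuous c -> continuous a -> continuous z ->
  continuous (fun x => hpull d (c x) (a x) (z x)).
Proof.
move=> cc ca cz; have cs := cont_shift_amount cc ca cz.
have ms x : `|shift_amount d (c x) (a x) (z x)| <= 2^-1 by exact: cut_bump_le.
have c1 : continuous (fun x => (1 + shift_amount d (c x) (a x) (z x))^-1).
  apply: contV => [x|]; last by cont.
  by have := ms x; rewrite ler_norml => /andP[? ?]; rewrite lt0r_neq0 //; lra.
have c2 : continuous (fun x => (1 - shift_amount d (c x) (a x) (z x))^-1).
  apply: contV => [x|]; last by cont.
  by have := ms x; rewrite ler_norml => /andP[? ?]; rewrite lt0r_neq0 //; lra.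
by rewrite /hpull /pull; cont.
Qed.

Lemma cont_swap (z : X -> R[i]) : continuous z -> continuous (fun x => swap (z x)).
Proof. by move=> cz; rewrite /swap; cont. Qed.

Lemma cont_move (c c' z : X -> R[i]) :
  continuous c -> continuous c' -> continuous z ->
  continuous (fun x => move d (c x) (c' x) (z x)).
Proof.
move=> cc cc' cz; rewrite /move /vpush.
by apply: cont_swap; apply: cont_hpush; [apply: cont_swap| |apply: cont_swap; apply: cont_hpush];
  cont.
Qed.

Lemma cont_unmove (c c' z : X -> R[i]) :
  continuous c -> continuous c' -> continuous z ->
  continuous (fun x => unmove d (c x) (c' x) (z x)).
Proof.
move=> cc cc' cz; rewrite /unmove /vpull.
apply: cont_hpull; [by []|by cont|].
by apply: cont_swap; apply: cont_hpull; [apply: cont_swap| |apply: cont_swap]; cont.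
Qed.

End PushContinuity.

Section Moves.
Context (R : realType) (K : finType) (d : R).
Hypothesis d0 : 0 < d.
Implicit Types (c : K -> R[i]) (z : R[i]).

Fixpoint moves c c' (s : seq K) z : R[i] :=
  if s is i :: s' then moves c c' s' (move d (c i) (c' i) z) else z.

Fixpoint unmoves c c' (s : seq K) z : R[i] :=
  if s is i :: s' then unmove d (c i) (c' i) (unmoves c c' s' z) else z.

Lemma movesK c c' s z : unmoves c c' s (moves c c' s z) = z.
Proof. by elim: s z => //= i s IH z; rewrite IH moveK. Qed.

Lemma unmovesK c c' s z : moves c c' s (unmoves c c' s z) = z.
Proof. by elim: s z => //= i s IH z; rewrite unmoveK // IH. Qed.

Lemma moves_id c c' s z : c =1 c' -> moves c c' s z = z.
Proof. by move=> cc'; elim: s z => //= i s IH z; rewrite IH cc' move_id. Qed.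

Lemma moves_far c c' s z : (forall i, close d (c i) (c' i)) ->
  (forall i, i \in s -> far (2 * d) z (c i)) -> moves c c' s z = z.
Proof.
move=> cc'; elim: s z => //= i s IH z zf.
rewrite move_far //; last by apply: zf; rewrite mem_head.
by apply: IH => j js; apply: zf; rewrite inE js orbT.
Qed.

Lemma far_close (e : R) z z' (w : R[i]) :
  far e z w -> close d z z' -> far (e - d / 2) z' w.
Proof.
have aux (x y x' : R) : e <= `|x - y| -> `|x' - x| <= d / 2 -> e - d / 2 <= `|x' - y|.
  move=> h1 h2; have := ler_normB (x' - y) (x' - x).
  by rewrite (_ : x' - y - (x' - x) = x - y); [lra|ring].
by move=> [zc|zc] [zRe zIm]; [left|right]; apply: aux zc _.
Qed.

(** Until its turn comes, [c i] is out of reach of the other moves. After it, the point sits at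
    [c' i], still at least [3 * d - d / 2] away from the remaining centres, hence beyond [2 * d]. *)
Lemma moves_center c c' s i : (forall i, close d (c i) (c' i)) ->
  (forall i j, i != j -> far (3 * d) (c i) (c j)) ->
  uniq s -> i \in s -> moves c c' s (c i) = c' i.
Proof.
have dp := d0; move=> cc' cf; elim: s => //= j s IH /andP[js us]; rewrite inE.
have [-> _|ij /= is'] := eqVneq i j.
  rewrite move_center // moves_far // => k ks.
  have jk : j != k by apply: contraNneq js => ->.
  have := far_close (cf j k jk) (cc' j).
  by case=> h; [left|right]; apply: le_trans _ h; lra.
rewrite move_far // ?IH //.
by case: (cf i j ij) => h; [left|right]; apply: le_trans _ h; lra.
Qed.

Lemma cont_moves (X : topologicalType) (c c' : K -> X -> R[i]) (z : X -> R[i]) s :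
  (forall i, continuous (c i)) -> (forall i, continuous (c' i)) -> continuous z ->
  continuous (fun x => moves (c^~ x) (c'^~ x) s (z x)).
Proof.
move=> cc cc'; elim: s z => [|i s IH] z cz; first exact: cz.
apply: (IH (fun x => move d (c i x) (c' i x) (z x))).
exact (@cont_move _ _ d _ _ _ (cc i) (cc' i) cz).
Qed.

Lemma cont_unmoves (X : topologicalType) (c c' : K -> X -> R[i]) (z : X -> R[i]) s :
  (forall i, continuous (c i)) -> (forall i, continuous (c' i)) -> continuous z ->
  continuous (fun x => unmoves (c^~ x) (c'^~ x) s (z x)).
Proof.
move=> cc cc'; elim: s z => [|i s IH] z cz; first exact: cz.
exact (@cont_unmove _ _ d _ _ _ (cc i) (cc' i) (IH z cz)).
Qed.

End Moves.

Section Isotopy.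
Context (R : realType).
Local Notation I := (unit_interval R).

(** Continuity of the inverse in time and point together is part of the data: the inverse of a
    trivialization and the comparison of two transports both depend on it. *)
Record isotopy := Isotopy {
  iso_fun : I -> R[i] -> R[i];
  iso_inv : I -> R[i] -> R[i];
  iso_cont : continuous (fun ty : I * R[i] => iso_fun ty.1 ty.2);
  iso_inv_cont : continuous (fun ty : I * R[i] => iso_inv ty.1 ty.2);
  isoK : forall t y, iso_inv t (iso_fun t y) = y;
  iso_invK : forall t y, iso_fun t (iso_inv t y) = y }.

(** Compactness of the square. The uniform constants for separation, displacement, lowness and
    subdivision all come from here. *)
Lemma segment2_near (P : R -> R * R -> Prop) :
  (forall x : R * R, \forall x' \near x & e \near (0 : R)^'+, P e x') ->
  exists2 e : R, 0 < e & forall x : R * R, 0 <= x.1 <= 1 -> 0 <= x.2 <= 1 -> P e x.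
Proof.
move=> cover.
have cS : compact ((`[0, 1]%classic : set R) `*` (`[0, 1]%classic : set R)).
  by apply: compact_setX; exact: segment_compact.
move/compact_near_coveringP in cS.
have nP : \forall e \near (0 : R)^'+, (`[0, 1] `*` `[0, 1] `<=` P e)%classic.
  by apply: cS => x _; exact: cover.
have [e [e0 SP]] := filter_ex (filterI (nbhs_right_gt (0 : R)) nP).
exists e => // x x1 x2; apply: SP; split; rewrite /= in_itv //.
Qed.

Section AmbientIsotopy.
Variables (K : finType) (z : K -> I * I -> R[i]).
Hypothesis cz : forall i, continuous (z i).
Hypothesis z_inj : forall i j p, i != j -> z i p <> z j p.

Let w i (p : R * R) := z i (clamp p.1, clamp p.2).

Lemma cont_w i : continuous (w i).
Proof.
apply: (@cont_comp _ _ _ (fun p : R * R => (clamp p.1, clamp p.2)) (z i) (@cz i)).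
by cont.
Qed.

Lemma uniform_far : exists2 d : R, 0 < d & forall x : R * R, 0 <= x.1 <= 1 -> 0 <= x.2 <= 1 ->
  forall i j, i != j -> far (3 * d) (w i x) (w j x).
Proof.
apply: segment2_near => x.
pose F := filter_prod (nbhs x) ((0 : R)^'+).
have FF : Filter F by exact: filter_prod_filter.
apply: (@filter_forall _ _ (fun i (p : (R * R) * R) =>
  forall j, i != j -> far (3 * p.2) (w i p.1) (w j p.1)) F FF) => i.
apply: (@filter_forall _ _ (fun j (p : (R * R) * R) =>
  i != j -> far (3 * p.2) (w i p.1) (w j p.1)) F FF) => j.
have [<-|ij] := eqVneq i j.
  by apply: (@filterS _ F FF setT) => //; exact: filterT.
have aux (g : R * R -> R) : continuous g -> 0 < g x ->
    \forall x' \near x & d \near 0^'+, 3 * d <= g x'.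
  move=> cg gx; exists ([set x' | g x / 2 < g x'], [set d | d < g x / 6]) => /=.
    split; last by apply: nbhs_right_lt; lra.
    by have /cvgr_gt/(_ (g x / 2)) := cg x; apply; lra.
  by move=> [x' d] /= [? ?]; lra.
have cR := @cont_w i; have cR' := @cont_w j.
have [Rij|/eqP Rij] := eqVneq (complex.Re (w i x)) (complex.Re (w j x)).
  have Iij : complex.Im (w i x) != complex.Im (w j x).
    apply/eqP => Iij; apply: (@z_inj i j (clamp x.1, clamp x.2) ij).
    move: Rij Iij; rewrite /w; case: (z i _) (z j _) => a b [a' b'] /= -> -> //.
  have : 0 < `|complex.Im (w i x) - complex.Im (w j x)| by rewrite normr_gt0 subr_eq0.
  move=> /(aux (fun p => `|complex.Im (w i p) - complex.Im (w j p)|)) H.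
  have {}H := H ltac:(cont).
  by apply: (@filterS _ F FF _ _ _ H) => p h _; right.
have : 0 < `|complex.Re (w i x) - complex.Re (w j x)| by rewrite normr_gt0 subr_eq0; apply/eqP.
move=> /(aux (fun p => `|complex.Re (w i p) - complex.Re (w j p)|)) H.
have {}H := H ltac:(cont).
by apply: (@filterS _ F FF _ _ _ H) => p h _; left.
Qed.

Lemma uniform_close d : 0 < d -> exists2 e : R, 0 < e & forall x : R * R, 0 <= x.1 <= 1 -> 0 <= x.2 <= 1 ->
  forall i q, `|q - x.1| <= e -> close d (w i x) (w i (q, x.2)).
Proof.
move=> d0; apply: segment2_near => x.
pose F := filter_prod (nbhs x) ((0 : R)^'+).
have FF : Filter F by exact: filter_prod_filter.
apply: (@filter_forall _ _ (fun i (p : (R * R) * R) =>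
  forall q, `|q - p.1.1| <= p.2 -> close d (w i p.1) (w i (q, p.1.2))) F FF) => i.
have near_x (g : R * R -> R) : continuous g -> \forall p \near x, `|g p - g x| < d / 4.
  move=> cg; have d4 : 0 < d / 4 by lra.
  have /cvgrPdist_lt/(_ _ d4) := cg x.
  by apply: filterS => p; rewrite distrC.
(* A deviation of [d / 4] from the value at [x], for each of two points, leaves at most [d / 2]
   between them; halving the radius keeps both points in the ball. *)
have H : nbhs x [set p | `|complex.Re (w i p) - complex.Re (w i x)| < d / 4 /\
    `|complex.Im (w i p) - complex.Im (w i x)| < d / 4].
  apply: filterI; first exact: (near_x _ (cont_Re (@cont_w i))).
  exact: (near_x _ (cont_Im (@cont_w i))).
have /nbhs_ballP[r /= r0 xr] := H.
exists (ball x (r / 2), [set e | e < r / 2]) => /=.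
  split; first by apply: nbhsx_ballx; lra.
  by apply: nbhs_right_lt; lra.
move=> [p e] /= [[p1 p2] er] q qp.
have xrp : ball x r p by split; [move: p1|move: p2]; apply: le_ball; lra.
have [pR pI] := xr p xrp.
have [qR qI] : [set p | `|complex.Re (w i p) - complex.Re (w i x)| < d / 4 /\
    `|complex.Im (w i p) - complex.Im (w i x)| < d / 4] (q, p.2).
  apply: xr; split; last by move: p2; apply: le_ball; lra.
  move: p1; rewrite /ball /= => p1.
  have := ler_distD p.1 x.1 q; rewrite (distrC p.1 q); lra.
move: pR pI qR qI; rewrite !ltr_norml /close !ler_norml => /andP[? ?] /andP[? ?].
by move=> /andP[? ?] /andP[? ?]; split; apply/andP; split; lra.
Qed.

(* In N + 1 steps, no point moves by more than a sixth of the minimal distance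
   between two points, so that each point is pushed within a square of its own. *)
Section Steps.
Variables (d : R) (N : nat).
Hypothesis d0 : 0 < d.
Hypothesis wfar : forall x : R * R, 0 <= x.1 <= 1 -> 0 <= x.2 <= 1 ->
  forall i j, i != j -> far (3 * d) (w i x) (w j x).
Hypothesis wclose : forall x : R * R, 0 <= x.1 <= 1 -> 0 <= x.2 <= 1 ->
  forall i q, `|q - x.1| <= N.+1%:R^-1 -> close d (w i x) (w i (q, x.2)).

Let node (k : nat) (i : K) (t : I) := w i (k%:R / N.+1%:R, val t).

Fixpoint steps k (t : I) y :=
  if k is k'.+1 then moves d (node k' ^~ t) (node k ^~ t) (enum K) (steps k' t y) else y.

Fixpoint unsteps k (t : I) y :=
  if k is k'.+1 then unsteps k' t (unmoves d (node k' ^~ t) (node k ^~ t) (enum K) y) else y.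

Lemma cont_node k i : continuous (node k i).
Proof.
apply: (@cont_comp _ _ _ (fun t : I => (k%:R / N.+1%:R : R, val t : R)) (w i) (@cont_w i)).
by cont.
Qed.

Lemma cont_node_fst k i : continuous (fun ty : I * R[i] => node k i ty.1).
Proof. by apply: (@cont_comp _ _ _ fst (node k i) (@cont_node k i)); cont. Qed.

Lemma cont_steps k : continuous (fun ty : I * R[i] => steps k ty.1 ty.2).
Proof.
elim: k => [|k IH]; first exact: cont_snd.
exact (@cont_moves _ _ d _ (fun i (ty : I * R[i]) => node k i ty.1)
  (fun i (ty : I * R[i]) => node k.+1 i ty.1) _ (enum K)
  (@cont_node_fst k) (@cont_node_fst k.+1) IH).
Qed.

Lemma cont_unsteps (X : topologicalType) (t : X -> I) (y : X -> R[i]) k :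
  continuous t -> continuous y -> continuous (fun x => unsteps k (t x) (y x)).
Proof.
move=> ct; elim: k y => [|k IH] y cy; first exact: cy.
apply: (IH (fun x => unmoves d (node k ^~ (t x)) (node k.+1 ^~ (t x)) (enum K) (y x))).
have cn j i : continuous (fun x => node j i (t x)).
  exact: (@cont_comp _ _ _ t (node j i) (@cont_node j i)).
exact (@cont_unmoves _ _ d _ (fun i x => node k i (t x))
  (fun i x => node k.+1 i (t x)) _ (enum K) (@cn k) (@cn k.+1) cy).
Qed.

Lemma stepsK k t y : unsteps k t (steps k t y) = y.
Proof. by elim: k y => //= k IH y; rewrite movesK. Qed.

Lemma unstepsK k t y : steps k t (unsteps k t y) = y.
Proof. by elim: k y => //= k IH y; rewrite IH unmovesK. Qed.

Lemma frac01 k : (k <= N.+1)%N -> 0 <= (k%:R / N.+1%:R : R) <= 1.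
Proof.
move=> kN; rewrite divr_ge0 ?ler0n //= ler_pdivrMr ?ltr0n //.
by rewrite mul1r ler_nat.
Qed.

Lemma steps_node k t i : (k <= N.+1)%N -> steps k t (node 0 i t) = node k i t.
Proof.
elim: k => //= k IH kN; rewrite IH ?(ltnW kN) //.
have t01 : 0 <= val t <= 1 by rewrite unit_interval_ge0 unit_interval_le1.
have k01 := frac01 (ltnW kN).
apply: moves_center; rewrite ?enum_uniq ?mem_enum //.
- move=> j; apply: (@wclose (k%:R / N.+1%:R, val t)) => //=.
  rewrite -mulrBl -natrB // subSnn mul1r normfV ger0_norm //.
- by move=> j l jl; apply: (@wfar (k%:R / N.+1%:R, val t)).
Qed.

(** A parameter at which no point moves gives the identity map. This yields the identity at the
    start of a path, and at both ends of a homotopy with fixed ends. *)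
Lemma steps_cst k t : (forall i s, z i (s, t) = z i (zero, t)) ->
  forall y, steps k t y = y.
Proof.
move=> zcst; elim: k => //= k IH y; rewrite IH moves_id // => i.
by rewrite /node /w /= clamp_val !zcst.
Qed.

End Steps.

(** The argument of the isotopy is the second coordinate of the square, a parameter of the family.
    The motion runs along the first coordinate and only its final effect is kept. *)
Lemma ambient_isotopy : exists F : isotopy,
  (forall i t, iso_fun F t (z i (zero, t)) = z i (one, t)) /\
  (forall t, (forall i s, z i (s, t) = z i (zero, t)) -> forall y, iso_fun F t y = y).
Proof.
have [d d0 wfar] := uniform_far.
have [e e0 wclose] := uniform_close d0.
pose N := Num.truncn e^-1.
have Ne : N.+1%:R^-1 <= e.
  rewrite -[leRHS]invrK lef_pV2 ?posrE ?invr_gt0 ?ltr0n //.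
  by apply/ltW; apply: truncnS_gt.
have {}wclose (x : R * R) : 0 <= x.1 <= 1 -> 0 <= x.2 <= 1 ->
    forall i q, `|q - x.1| <= N.+1%:R^-1 -> close d (w i x) (w i (q, x.2)).
  by move=> x1 x2 i q qN; apply: wclose => //; exact: le_trans Ne.
exists (Isotopy (@cont_steps d N N.+1)
  (@cont_unsteps d N _ fst snd N.+1 (@cont_fst _ _) (@cont_snd _ _))
  (stepsK N d0 N.+1) (unstepsK N d0 N.+1)); split=> [i t|t zt y].
  have := steps_node d0 wfar wclose t i (leqnn N.+1).
  rewrite /w mul0r divff ?pnatr_eq0 //; cbn beta iota delta [fst snd].
  by rewrite clamp_val.
exact: (steps_cst N d0 N.+1 zt).
Qed.

End AmbientIsotopy.
End Isotopy.

(** * The base and the horizontal lines *)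

Section ComplexAlgebraContinuity.
Context (R : realType) (X : topologicalType).
Implicit Types f g : X -> R[i].

Lemma ReM (z w : R[i]) :
  complex.Re (z * w) = complex.Re z * complex.Re w - complex.Im z * complex.Im w.
Proof. by case: z w => a b [c d]. Qed.

Lemma ImM (z w : R[i]) :
  complex.Im (z * w) = complex.Re z * complex.Im w + complex.Im z * complex.Re w.
Proof. by case: z w => a b [c d]. Qed.

Lemma ReD (z w : R[i]) : complex.Re (z + w) = complex.Re z + complex.Re w.
Proof. by case: z w => a b [c d]. Qed.

Lemma ImD (z w : R[i]) : complex.Im (z + w) = complex.Im z + complex.Im w.
Proof. by case: z w => a b [c d]. Qed.

Lemma complex_ext (z w : R[i]) : complex.Re z = complex.Re w ->
  complex.Im z = complex.Im w -> z = w.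
Proof. by case: z w => a b [c d] /= -> ->. Qed.

Lemma contcD f g : continuous f -> continuous g -> continuous (fun x => f x + g x).
Proof.
move=> cf cg; apply: cont_complexE.
  rewrite (_ : (fun x => _) = fun x => complex.Re (f x) + complex.Re (g x)); first by cont.
  by apply/funext => x; rewrite ReD.
rewrite (_ : (fun x => _) = fun x => complex.Im (f x) + complex.Im (g x)); first by cont.
by apply/funext => x; rewrite ImD.
Qed.

Lemma contcM f g : continuous f -> continuous g -> continuous (fun x => f x * g x).
Proof.
move=> cf cg; apply: cont_complexE.
  rewrite (_ : (fun x => _) = fun x =>
    complex.Re (f x) * complex.Re (g x) - complex.Im (f x) * complex.Im (g x)); first by cont.
  by apply/funext => x; rewrite ReM.
rewrite (_ : (fun x => _) = fun x =>
  complex.Re (f x) * complex.Im (g x) + complex.Im (f x) * complex.Re (g x)); first by cont.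
by apply/funext => x; rewrite ImM.
Qed.

End ComplexAlgebraContinuity.

Section SetType.
Context (R : realType) (Y : topologicalType) (S : set Y).
Local Notation I := (unit_interval R).

Lemma set_type_lift (X : topologicalType) (f : X -> Y) :
  continuous f -> (forall x, S (f x)) ->
  exists2 u : X -> set_type S, continuous u & forall x, val (u x) = f x.
Proof.
move=> cf Sf; exists (fun x => SigSub (mem_set (Sf x))) => //.
by apply: continuous_into_set_type.
Qed.

Lemma set_type_path (f : I -> Y) (x y : set_type S) :
  continuous f -> (forall t, S (f t)) -> f zero = val x -> f one = val y ->
  exists p : {path I from x to y in set_type S}, forall t, val (p t) = f t.
Proof.
move=> cf Sf f0 f1; have [u cu uE] := set_type_lift cf Sf.
have u0 : u zero = x by apply: val_inj; rewrite uE.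
have u1 : u one = y by apply: val_inj; rewrite uE.
by exists (mk_path cu u0 u1).
Qed.

Lemma set_type_homotopic (x y : set_type S) (p q : {path I from x to y in set_type S})
    (H : I * I -> Y) :
  continuous H -> (forall st, S (H st)) ->
  (forall t, H (zero, t) = val (p t)) -> (forall t, H (one, t) = val (q t)) ->
  (forall s, H (s, zero) = val x) -> (forall s, H (s, one) = val y) ->
  path_homotopic p q.
Proof.
move=> cH SH Hp Hq Hx Hy; have [u cu uE] := set_type_lift cH SH.
by exists u; split=> // t; apply: val_inj; rewrite uE.
Qed.

End SetType.

Section Geometry.
Context (R : realType) (A : fibered_arrangement R).
Local Notation I := (unit_interval R).

Definition hline (i : 'I_(nhor A)) (x : R[i]) : R[i] :=
  (slope i)%:C * x + (intercept i)%:C.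

Lemma Re_hline i x : complex.Re (hline i x) = slope i * complex.Re x + intercept i.
Proof. by rewrite /hline ReD ReM /= mul0r subr0. Qed.

Lemma Im_hline i x : complex.Im (hline i x) = slope i * complex.Im x.
Proof. by rewrite /hline ImD ImM /= mul0r !addr0. Qed.

Lemma cont_hline (X : topologicalType) i (f : X -> R[i]) :
  continuous f -> continuous (fun x => hline i (f x)).
Proof.
move=> cf; apply: cont_complexE.
  rewrite (_ : (fun x => _) = fun x => slope i * complex.Re (f x) + intercept i); first by cont.
  by apply/funext => x; rewrite Re_hline.
rewrite (_ : (fun x => _) = fun x => slope i * complex.Im (f x)); first by cont.
by apply/funext => x; rewrite Im_hline.
Qed.

Lemma piS_abscissa (xi : R[i]) : piS A xi <-> exists j, xi = (@abscissa _ A j)%:C.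
Proof.
split=> [/fibered[[i|j] lE]|[j ->]]; last exact: vertical_singular.
  (* A horizontal line has a point over [xi + 1], so it is not the fiber over [xi]. *)
  have : line (inl i) (xi + 1, hline i (xi + 1)) by [].
  rewrite lE /= => /eqP; rewrite -subr_eq0 addrC addKr oner_eq0 //.
exists j; have : line (inr j) ((abscissa j)%:C, 0) by [].
by rewrite lE /= => ->.
Qed.

Lemma piS_real (xi : R[i]) : piS A xi -> complex.Im xi = 0.
Proof. by move=> /piS_abscissa[j ->]. Qed.

Lemma base_notin (x : base A) : ~ piS A (val x).
Proof. exact: (set_mem (valP x)). Qed.

Lemma hline_inj (x : base A) i j : i != j -> hline i (val x) <> hline j (val x).
Proof.
move=> ij ijx; apply: (@base_notin x); exists (val x, hline i (val x)) => //.
by exists (inl i), (inl j).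
Qed.

Lemma fiber_neq (x : base A) (y : fiber x) i : val y <> hline i (val x).
Proof. exact: (set_mem (valP y)). Qed.

Lemma cont_base_val (X : topologicalType) (u : X -> base A) :
  continuous u -> continuous (fun x => val (u x)).
Proof. exact: cont_val. Qed.

Lemma base_lift (X : topologicalType) (f : X -> R[i]) :
  continuous f -> (forall x, ~ piS A (f x)) ->
  exists2 u : X -> base A, continuous u & forall x, val (u x) = f x.
Proof. by move=> cf Sf; exact: (@set_type_lift _ (~` piS A) _ f cf Sf). Qed.

Definition squash (l : R) (x : R[i]) : R[i] := complex.Re x +i* (l * complex.Im x).

(** A squashed point can be real only if it was real before, and then it has not moved. *)
Lemma squash_notin (l : R) (x : R[i]) : l != 0 -> ~ piS A x -> ~ piS A (squash l x).
Proof.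
move=> l0 xS sS; apply: xS; move: (sS); rewrite (_ : squash l x = x) //.
have /eqP := piS_real sS; rewrite /= mulf_eq0 (negbTE l0) /= => /eqP Ix.
by apply: complex_ext => //=; rewrite Ix mulr0.
Qed.

Lemma cont_squash (X : topologicalType) (l : X -> R) (f : X -> R[i]) :
  continuous l -> continuous f -> continuous (fun x => squash (l x) (f x)).
Proof. by move=> cl cf; rewrite /squash; cont. Qed.

Lemma squash_real (l : R) (x : R[i]) : complex.Im x = 0 -> squash l x = x.
Proof. by case: x => a b /= ->; rewrite /squash /= mulr0. Qed.

Lemma squash1 (x : R[i]) : squash 1 x = x.
Proof. by case: x => a b; rewrite /squash mul1r. Qed.

Variable y0 : R[i].
Hypothesis y0_gt0 : 0 < complex.Im y0.

Definition low (x : R[i]) : Prop :=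
  forall i, complex.Im (hline i x) < complex.Im y0.

(** Lowness bounds the imaginary parts from above only: nonpositive ones stay below the positive
    [complex.Im y0], positive ones shrink. *)
Lemma low_squash (l : R) (x : R[i]) : 0 <= l <= 1 -> low x -> low (squash l x).
Proof.
move=> /andP[l0 l1] lx i; have := lx i; rewrite !Im_hline /= mulrCA => h.
have [a0|a0] := leP (slope i * complex.Im x) 0.
  by apply: le_lt_trans y0_gt0; rewrite mulr_ge0_le0.
apply: le_lt_trans h; rewrite -[leRHS]mul1r ler_wpM2r // ltW //.
Qed.

Lemma low_real (x : R[i]) : complex.Im x = 0 -> low x.
Proof. by move=> x0 i; rewrite Im_hline x0 mulr0. Qed.

Lemma squash_low (H : I * I -> base A) : continuous H ->
  exists2 e : R, 0 < e <= 1 & forall st, low (squash e (val (H st))).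
Proof.
move=> cH; have y0p := y0_gt0.
have [e e0 He] : exists2 e : R, 0 < e & forall x : R * R, 0 <= x.1 <= 1 -> 0 <= x.2 <= 1 ->
    forall i : 'I_(nhor A), e * (slope i * complex.Im (val (H (clamp x.1, clamp x.2)))) < complex.Im y0.
  apply: segment2_near => x.
  pose F := filter_prod (nbhs x) ((0 : R)^'+).
  have FF : Filter F by exact: filter_prod_filter.
  apply: (@filter_forall _ _ (fun (i : 'I_(nhor A)) (p : (R * R) * R) =>
    p.2 * (slope i * complex.Im (val (H (clamp p.1.1, clamp p.1.2)))) < complex.Im y0) F FF) => i.
  pose g (p : R * R) := slope i * complex.Im (val (H (clamp p.1, clamp p.2))).
  have cg : continuous g.
    have cHc : continuous (fun p : R * R => H (clamp p.1, clamp p.2)).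
      by apply: (@cont_comp _ _ _ (fun p : R * R => (clamp p.1, clamp p.2)) H cH); cont.
    have cv := cont_base_val cHc.
    by rewrite /g; cont.
  (* A positive upper bound of [g] near [x], so that every positive [e] below [complex.Im y0 / v]
     works there. *)
  pose v := `|g x| + 1; have v0 : 0 < v by rewrite /v ltr_wpDl.
  exists ([set p | g p < v], [set e | 0 < e /\ e < complex.Im y0 / v]) => /=.
    split; last by apply: filterI; [exact: nbhs_right_gt|apply: nbhs_right_lt; rewrite divr_gt0].
    have /cvgr_lt/(_ v) := cg x; apply.
    by rewrite /v; apply: le_lt_trans (ler_norm _) _; rewrite ltrDl.
  move=> [p e] /= [gp [e0 ev]]; rewrite -/(g p).
  move: ev; rewrite ltr_pdivlMr // => ev; apply: le_lt_trans ev.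
  by apply: ler_wpM2l; apply: ltW.
exists (Order.min e 1).
  by rewrite lt_min e0 ltr01 ge_min lexx orbT.
(* Squashing by [Order.min e 1] is squashing by [e] followed by squashing by this ratio, which
   preserves lowness. *)
have me : 0 <= Order.min e 1 / e <= 1.
  apply/andP; split; last by rewrite ler_pdivrMr // mul1r ge_min lexx.
  by apply: divr_ge0; rewrite ?ltW // lt_min e0 ltr01.
move=> [s t].
have <- : squash (Order.min e 1 / e) (squash e (val (H (s, t)))) = squash (Order.min e 1) (val (H (s, t))).
  by rewrite /squash /= mulrA divfK ?gt_eqF.
apply: low_squash => // i; rewrite Im_hline /= mulrCA.
by have := He (val s, val t); rewrite /= !clamp_val !unit_interval_ge0 !unit_interval_le1; apply.
Qed.

End Geometry.

Section LowPaths.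
Context (R : realType) (A : fibered_arrangement R).
Local Notation I := (unit_interval R).
Variable y0 : R[i].
Hypothesis y0_gt0 : 0 < complex.Im y0.
Variables (x x' : base A).
Hypotheses (xR : is_real x) (x'R : is_real x').
Implicit Types g : {path I from x to x' in base A}.

Lemma below_representative g : exists2 g', path_homotopic g g' & below y0 g'.
Proof.
have cg : continuous (fun st : I * I => g st.2).
  by apply: (@cont_comp _ _ _ snd g (@cts_fun _ _ g)); cont.
have [e /andP[e0 e1] elow] := squash_low y0_gt0 cg.
have cgv : continuous (fun t => val (g t)) by exact: (cont_base_val (@cts_fun _ _ g)).
have cgv2 := cont_base_val cg.
have en0 : e != 0 by rewrite gt_eqF.
have gx : g zero = x := path_zero.
have gx' : g one = x' := path_one.
have [||||g' g'E] := @set_type_path R _ (~` piS A) (fun t => squash e (val (g t))) x x'.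
- exact: (cont_squash (@cont_cst _ _ e) cgv).
- by move=> t; apply: squash_notin => //; exact: base_notin.
- by rewrite gx squash_real.
- by rewrite gx' squash_real.
exists g'; last by move=> t i; rewrite g'E; exact: (elow (zero, t)).
(* The factor runs from 1 to [e] without vanishing, and the real ends stay fixed throughout. *)
pose l (st : I * I) := 1 - val st.1 + val st.1 * e.
have lp st : l st != 0.
  rewrite gt_eqF // /l; have s0 := unit_interval_ge0 st.1; have s1 := unit_interval_le1 st.1.
  by have [|] := leP (val st.1) 2^-1; nra.
apply: (@set_type_homotopic R _ (~` piS A) x x' g g' (fun st => squash (l st) (val (g st.2)))).
- by apply: (cont_squash _ cgv2); rewrite /l; cont.
- by move=> st; apply: squash_notin => //; exact: base_notin.
- move=> t; rewrite /l; cbn beta iota delta [fst snd].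
  by rewrite val_zero subr0 mul0r addr0 squash1.
- move=> t; rewrite /l; cbn beta iota delta [fst snd].
  by rewrite val_one subrr add0r mul1r g'E.
- by move=> s; cbn beta iota delta [fst snd]; rewrite gx squash_real.
- by move=> s; cbn beta iota delta [fst snd]; rewrite gx' squash_real.
Qed.

(* Squash the paths, then apply the squashed homotopy, then unsquash. *)
Lemma low_homotopy g g' : below y0 g -> below y0 g' -> path_homotopic g g' ->
  exists H : I * I -> base A, [/\ continuous H,
    forall t, H (zero, t) = g t, forall t, H (one, t) = g' t,
    (forall s, H (s, zero) = x) /\ (forall s, H (s, one) = x') &
    forall st, low A y0 (val (H st))].
Proof.
move=> bg bg' [H [cH Hg Hg' Hx Hx']].
have [e /andP[e0 e1] elow] := squash_low y0_gt0 cH.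
(* In the outer thirds the factor passes between 1 and [e]; it equals [e] in the middle third, where
   alone the homotopy advances. *)
pose l (st : I * I) := Order.max e (Order.max (1 - 3 * val st.1) (3 * val st.1 - 2)).
pose h (st : I * I) := H (clamp (3 * val st.1 - 1), st.2).
have ch : continuous h.
  by apply: (@cont_comp _ _ _ (fun st : I * I => (clamp (3 * val st.1 - 1), st.2)) H cH); cont.
have chv := cont_base_val ch.
have cl : continuous l by rewrite /l; cont.
have l01 st : 0 < l st <= 1.
  rewrite /l; have s0 := unit_interval_ge0 st.1; have s1 := unit_interval_le1 st.1.
  by rewrite lt_max e0 orTb andTb !ge_max e1 andTb; apply/andP; split; lra.
have [|st|K cK KE] := @base_lift R A _ (fun st => squash (l st) (val (h st))).
- exact: (cont_squash cl chv).
- by apply: squash_notin; [case/andP: (l01 st) => /gt_eqF ->|exact: base_notin].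
exists K; split=> //.
- move=> t; apply: val_inj; rewrite KE /l /h; cbn beta iota delta [fst snd].
  rewrite val_zero mulr0 subr0 !sub0r clamp_le0 ?lerN10 // Hg.
  rewrite max_r; first by rewrite max_l ?squash1 //; lra.
  by rewrite le_max; apply/orP; left; lra.
- move=> t; apply: val_inj; rewrite KE /l /h; cbn beta iota delta [fst snd].
  rewrite val_one mulr1 clamp_ge1 ?Hg'; last by lra.
  rewrite max_r; last by rewrite le_max; apply/orP; right; lra.
  rewrite max_r; last by lra.
  by rewrite (_ : 3 - 2 = 1 :> R) ?squash1 //; ring.
- by split=> s; apply: val_inj; rewrite KE /h ?Hx ?Hx' squash_real.
- move=> [s t]; rewrite KE; have /andP[l0 l1] := l01 (s, t).
  have low_l u : low A y0 u -> low A y0 (squash (l (s, t)) u).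
    by apply: low_squash => //; rewrite ltW.
  have [s1|s1] := leP (val s) 3^-1.
    rewrite /h clamp_le0; last by cbn beta iota delta [fst snd]; lra.
    by rewrite Hg; apply: low_l => i; exact: bg.
  have [s2|s2] := leP (2 / 3) (val s).
    rewrite /h clamp_ge1; last by cbn beta iota delta [fst snd]; lra.
    by rewrite Hg'; apply: low_l => i; exact: bg'.
  rewrite (_ : l (s, t) = e); first exact: elow.
  rewrite /l; cbn beta iota delta [fst snd]; rewrite max_l // ge_max.
  by apply/andP; split; lra.
Qed.

End LowPaths.

(** * Isotopies following the horizontal lines *)

Section Carries.
Context (R : realType) (A : fibered_arrangement R).
Local Notation I := (unit_interval R).
Variable y0 : R[i].

Record carries (F : isotopy R) (x : base A) (g : I -> base A) : Prop := Carries {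
  carries_hline : forall (i : 'I_(nhor A)) t, iso_fun F t (hline i (val x)) = hline i (val (g t));
  carries_y0 : forall t, iso_fun F t y0 = y0;
  carries_zero : forall y, iso_fun F zero y = y }.

Lemma low_neq (x : R[i]) (i : 'I_(nhor A)) : low A y0 x -> hline i x <> y0.
Proof. by move=> lx xy; have := lx i; rewrite xy ltxx. Qed.

Lemma low_fiber (x : base A) : low A y0 (val x) -> exists z : fiber x, val z = y0.
Proof.
move=> lx; have y0x : y0 \in fiber_set A (val x).
  by apply/mem_set => i /esym; exact: low_neq.
by exists (SigSub y0x).
Qed.

(* y0 is treated as one more point, which does not move. *)
Lemma carry_homotopy (H : I * I -> base A) : continuous H ->
  (forall st, low A y0 (val (H st))) ->
  exists F : isotopy R,
    [/\ forall (i : 'I_(nhor A)) t, iso_fun F t (hline i (val (H (zero, t)))) = hline i (val (H (one, t))),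
        forall t, iso_fun F t y0 = y0
      & forall t, (forall s, H (s, t) = H (zero, t)) -> forall y, iso_fun F t y = y].
Proof.
move=> cH Hlow.
pose z (o : option 'I_(nhor A)) (st : I * I) :=
  if o is Some i then hline i (val (H st)) else y0.
have cz o : continuous (z o).
  by case: o => [i|]; [exact: (cont_hline (cont_base_val cH))|exact: cont_cst].
have zinj o o' st : o != o' -> z o st <> z o' st.
  case: o o' => [i|] [j|] //= ij.
  - exact: hline_inj.
  - exact: (low_neq (Hlow st)).
  - by move=> /esym; exact: (low_neq (Hlow st)).
have [F [Fz Fcst]] := ambient_isotopy cz zinj.
exists F; split=> [i t|t|t Ht y]; [exact: (Fz (Some i))|exact: (Fz None)|].
by apply: Fcst => -[i|] s //=; rewrite Ht.
Qed.

Lemma carries_exists (x x' : base A) (g : {path I from x to x' in base A}) :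
  below y0 g -> exists F, carries F x g.
Proof.
move=> bg.
(* The square with value [g] at the product of the two times: its first row is constant, its last
   row is [g], and its column at time zero is constant, which gives the identity there. *)
have cH : continuous (fun st : I * I => g (clamp (val st.1 * val st.2))).
  by apply: (@cont_comp _ _ _ (fun st : I * I => clamp (val st.1 * val st.2)) g (@cts_fun _ _ g)); cont.
have [|F [Fh Fy Fcst]] := carry_homotopy cH; first by move=> st i; exact: bg.
exists F; split=> // [i t|y].
  have := Fh i t; cbn beta iota delta [fst snd].
  by rewrite val_zero val_one mul0r mul1r clamp_val clamp0 path_zero.
by apply: Fcst => s; cbn beta iota delta [fst snd]; rewrite val_zero !mulr0.
Qed.

(** The second isotopy acts after the final map of the first; the halves agree at time 1/2 because
    [G] starts at the identity. *)
Lemma isotopy_cat (F G : isotopy R) : (forall y, iso_fun G zero y = y) ->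
  exists E : isotopy R, forall t y,
    iso_fun E t y = if val t <= 2^-1 then iso_fun F (clamp (2 * val t)) y
                    else iso_fun G (clamp (2 * val t - 1)) (iso_fun F one y).
Proof.
move=> G0.
have G0' y : iso_inv G zero y = y by rewrite -{1}(G0 y) isoK.
pose e (t : I) y := if val t <= 2^-1 then iso_fun F (clamp (2 * val t)) y
              else iso_fun G (clamp (2 * val t - 1)) (iso_fun F one y).
pose e' (t : I) y := if val t <= 2^-1 then iso_inv F (clamp (2 * val t)) y
               else iso_inv F one (iso_inv G (clamp (2 * val t - 1)) y).
have cf (f : I -> R[i] -> R[i]) (X : topologicalType) (u : X -> I) (v : X -> R[i]) :
    continuous (fun ty : I * R[i] => f ty.1 ty.2) -> continuous u -> continuous v ->
    continuous (fun a => f (u a) (v a)).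
  move=> cf cu cv.
  by apply: (@cont_comp _ _ _ (fun a => (u a, v a)) (fun ty => f ty.1 ty.2) cf); cont.
have c2 : continuous (fun ty : I * R[i] => clamp (2 * val ty.1) : I) by cont.
have c21 : continuous (fun ty : I * R[i] => clamp (2 * val ty.1 - 1) : I) by cont.
have c1 : continuous (fun ty : I * R[i] => val ty.1 : R) by cont.
have cone : continuous (fun ty : I * R[i] => one : I) by exact: cont_cst.
have cy : continuous (fun ty : I * R[i] => ty.2) by exact: cont_snd.
have ce : continuous (fun ty : I * R[i] => e ty.1 ty.2).
  apply: glue_continuous => [|||[t y] /= t2].
  - exact: c1.
  - exact: (cf _ _ _ _ (@iso_cont _ F) c2 cy).
  - exact: (cf _ _ _ _ (@iso_cont _ G) c21 (cf _ _ _ _ (@iso_cont _ F) cone cy)).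
  - by rewrite t2 mulfV ?pnatr_eq0 // subrr clamp0 clamp1 G0.
have ce' : continuous (fun ty : I * R[i] => e' ty.1 ty.2).
  apply: glue_continuous => [|||[t y] /= t2].
  - exact: c1.
  - exact: (cf _ _ _ _ (@iso_inv_cont _ F) c2 cy).
  - exact: (cf _ _ _ _ (@iso_inv_cont _ F) cone (cf _ _ _ _ (@iso_inv_cont _ G) c21 cy)).
  - by rewrite t2 mulfV ?pnatr_eq0 // subrr clamp0 clamp1 G0'.
have eK t y : e' t (e t y) = y.
  by rewrite /e /e'; case: (val t <= _); rewrite !isoK.
have e'K t y : e t (e' t y) = y.
  by rewrite /e /e'; case: (val t <= _); rewrite !iso_invK.
by exists (Isotopy ce ce' eK e'K).
Qed.

Lemma carries_cat (x x' x'' : base A) (g : {path I from x to x' in base A})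
    (g' : {path I from x' to x'' in base A}) F G :
  carries F x g -> carries G x' g' ->
  exists2 E, carries E x (path_cat g g') &
    forall y, iso_fun E one y = iso_fun G one (iso_fun F one y).
Proof.
move=> [Fh Fy F0] [Gh Gy G0]; have [E EE] := isotopy_cat F G0.
have half : (1 <= 2^-1 :> R) = false by lra.
have half0 : (0 <= 2^-1 :> R) by lra.
exists E; last first.
  by move=> y; rewrite EE val_one half mulr1 (_ : 2 - 1 = 1) //; lra.
split=> [i t|t|y].
- rewrite EE -[path_cat g g' t]/(path_cat_fun g g' t) /path_cat_fun; case: ifP => _ //.
  by rewrite Fh path_one Gh.
- by rewrite EE !Fy Gy; case: ifP.
- by rewrite EE val_zero half0 mulr0.
Qed.

Lemma isotopy_id : exists F : isotopy R, forall t y, iso_fun F t y = y.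
Proof.
have c : continuous (fun ty : I * R[i] => ty.2) by exact: cont_snd.
by exists (Isotopy (iso_fun := fun _ y => y) (iso_inv := fun _ y => y) c c
  (fun _ _ => erefl) (fun _ _ => erefl)).
Qed.

Lemma carries_fiber (x x' : base A) (f f' : R[i] -> R[i]) y : cancel f f' ->
  (forall i : 'I_(nhor A), f (hline i (val x)) = hline i (val x')) ->
  fiber_set A (val x) y -> fiber_set A (val x') (f y).
Proof.
move=> fK fh yx i fy; apply: (yx i).
have yE : y = hline i (val x) by rewrite -[LHS]fK -[RHS]fK fh; congr f'; exact: fy.
exact: yE.
Qed.

End Carries.

(** * Existence and uniqueness of transport *)

Section FiberConnected.
Context (R : realType) (A : fibered_arrangement R) (x : base A).
Local Notation I := (unit_interval R).

(* Among the parabolas from z to w, each point to be avoided lies on at most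
   one. *)
Lemma fiber_connected (z w : fiber x) : exists p : {path I from z to w in fiber x}, True.
Proof.
pose d := val w - val z.
pose q (i : 'I_(nhor A)) := (hline i (val x) - val z) / d.
(* In the coordinate where [z] is 0 and [w] is 1, the point [q i] lies on the parabola of height [l]
   only for this [l]. *)
pose v (i : 'I_(nhor A)) := complex.Im (q i) / (complex.Re (q i) * (1 - complex.Re (q i))).
pose l : R := 1 + \sum_i `|v i|.
have vl i : v i < l.
  rewrite /l; apply: le_lt_trans (ler_norm _) _; rewrite (bigD1 i) //= addrCA.
  by rewrite ltrDl ltr_wpDr ?ltr01 // sumr_ge0.
pose f (t : I) := val z + (val t +i* (l * (val t * (1 - val t)))) * d.
have cf : continuous f.
  apply: contcD; first exact: cont_cst.
  by apply: contcM; cont.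
have f0 : f zero = val z.
  by rewrite /f val_zero mul0r mulr0 (_ : 0 +i* 0 = 0) // mul0r addr0.
have f1 : f one = val w.
  by rewrite /f val_one subrr !mulr0 (_ : 1 +i* 0 = 1) // mul1r /d addrC subrK.
have fS t : fiber_set A (val x) (f t).
  move=> i ft; have {}ft : f t = hline i (val x) by [].
  have [t0|t0] := eqVneq (val t) 0.
    by apply: (@fiber_neq _ _ _ z i); rewrite -f0 -ft /f t0 val_zero.
  have [t1|t1] := eqVneq (val t) 1.
    by apply: (@fiber_neq _ _ _ w i); rewrite -f1 -ft /f t1 val_one.
  (* For [z] equal to [w] the coordinate [q] divides by zero, but the path is constant. *)
  have [d0|d0] := eqVneq d 0.
    by apply: (@fiber_neq _ _ _ z i); rewrite -ft /f d0 mulr0 addr0.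
  have qE : q i = val t +i* (l * (val t * (1 - val t))).
    by rewrite /q -ft /f addrC addKr mulfK.
  have := vl i; rewrite /v qE /= mulfK ?ltxx //.
  by rewrite mulf_neq0 // subr_eq0 eq_sym.
by have [p _] := @set_type_path R _ (fiber_set A (val x)) f z w cf fS f0 f1; exists p.
Qed.

End FiberConnected.

Section Transport.
Context (R : realType) (A : fibered_arrangement R).
Variable L : local_system R (complement A).
Variable y0 : R[i].
Local Notation I := (unit_interval R).
Local Notation H1F x := (H1 (fiber_system L x)).

Lemma cont_iso (F : isotopy R) (X : topologicalType) (u : X -> I) (v : X -> R[i]) :
  continuous u -> continuous v -> continuous (fun a => iso_fun F (u a) (v a)).
Proof.
move=> cu cv.
by apply: (@cont_comp _ _ _ (fun a => (u a, v a))
  (fun ty => iso_fun F ty.1 ty.2) (@iso_cont _ F)); cont.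
Qed.

Lemma cont_iso_inv (F : isotopy R) (X : topologicalType) (u : X -> I) (v : X -> R[i]) :
  continuous u -> continuous v -> continuous (fun a => iso_inv F (u a) (v a)).
Proof.
move=> cu cv.
by apply: (@cont_comp _ _ _ (fun a => (u a, v a))
  (fun ty => iso_inv F ty.1 ty.2) (@iso_inv_cont _ F)); cont.
Qed.

Lemma cont_fiber_val (X : topologicalType) (x : base A) (u : X -> fiber x) :
  continuous u -> continuous (fun a => val (u a)).
Proof. exact: cont_val. Qed.

Lemma cont_bundle_val (X : topologicalType) (x x' : base A)
    (g : {path I from x to x' in base A}) (u : X -> pullback_bundle g) :
  continuous u -> continuous (fun a => val (u a)).
Proof. exact: cont_val. Qed.

Section AlongPath.
Context (x x' : base A) (g : {path I from x to x' in base A}).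
Variable E : isotopy R.
Hypothesis gE : carries y0 E x g.

Lemma carries_fiberP t y : fiber_set A (val x) y -> fiber_set A (val (g t)) (iso_fun E t y).
Proof.
by move=> xy; apply: (carries_fiber (isoK E t) _ xy) => i; exact: (carries_hline gE).
Qed.

Lemma carries_inv_fiberP t y :
  fiber_set A (val (g t)) y -> fiber_set A (val x) (iso_inv E t y).
Proof.
move=> xy; apply: (carries_fiber (iso_invK E t) _ xy) => i.
by rewrite -(carries_hline gE) isoK.
Qed.

Lemma end_map_exists : exists f : continuousType (fiber x) (fiber x'),
  forall z, val (f z) = iso_fun E one (val z).
Proof.
have cf : continuous (fun z : fiber x => iso_fun E one (val z)).
  exact: (cont_iso (@cont_cst _ _ one) (cont_fiber_val (@cont_id _))).
have Sf (z : fiber x) : fiber_set A (val x') (iso_fun E one (val z)).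
  have := @carries_fiberP one _ (set_mem (valP z)).
  by rewrite path_one.
have [u cu uE] := @set_type_lift _ (fiber_set A (val x')) _ _ cf Sf.
by exists (mkcts cu).
Qed.

Lemma trivialization_exists : exists h : I * fiber x -> pullback_bundle g,
  pointed_trivialization y0 h /\ forall t z, val (h (t, z)) = (t, iso_fun E t (val z)).
Proof.
have ch : continuous (fun tz : I * fiber x => (tz.1, iso_fun E tz.1 (val tz.2))).
  apply: continuous_pair; first exact: cont_fst.
  exact: (cont_iso (@cont_fst _ _) (cont_fiber_val (@cont_snd _ _))).
have [h {}ch hE] := @set_type_lift _ [set ty : I * R[i] | fiber_set A (val (g ty.1)) ty.2]
  _ _ ch (fun tz => @carries_fiberP tz.1 _ (set_mem (valP tz.2))).
have ck : continuous (fun e : pullback_bundle g => iso_inv E (val e).1 (val e).2).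
  have ce := cont_bundle_val (@cont_id (pullback_bundle g)).
  exact: (cont_iso_inv (cont_fst_comp ce) (cont_snd_comp ce)).
have [k {}ck kE] := @set_type_lift _ (fiber_set A (val x)) (pullback_bundle g) _ ck
  (fun e => @carries_inv_fiberP (val e).1 (val e).2 (set_mem (valP e))).
exists h; split=> [|t z]; last exact: (hE (t, z)).
split=> [//| |t z|z|t z zy].
- exists (fun e => ((val e).1, k e)).
    apply: continuous_pair => //.
    exact: (cont_fst_comp (cont_bundle_val (@cont_id (pullback_bundle g)))).
  split=> [[t z]|e].
    by congr pair; [rewrite hE|apply: val_inj; rewrite kE hE /= isoK].
  by apply: val_inj; rewrite hE kE /= iso_invK; case: (val e).
- by rewrite hE.
- by rewrite hE /= (carries_zero gE).
- by rewrite hE /= zy (carries_y0 gE).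
Qed.

(** The track of [z] under the isotopy is a path in the complement, and its holonomy identifies the
    stalks; dividing by the holonomy of the track of [y0] normalizes it. Naturality is the holonomy
    of the square swept out by a path of the fiber. *)
Lemma stalk_iso_exists (f : continuousType (fiber x) (fiber x')) :
  (forall z, val (f z) = iso_fun E one (val z)) -> (exists z : fiber x, val z = y0) ->
  exists phi, is_local_system_iso (fiber_system L x) (fiber_system L x') f phi /\
    forall z, val z = y0 -> phi z = 1.
Proof.
move=> fE [z0 z0E].
have cg := cont_base_val (@cts_fun _ _ g).
have cQ : continuous (fun tz : I * fiber x => (val (g tz.1), iso_fun E tz.1 (val tz.2))).
  apply: continuous_pair; first exact: (@cont_comp _ _ _ fst _ cg (@cont_fst _ _)).
  exact: (cont_iso (@cont_fst _ _) (cont_fiber_val (@cont_snd _ _))).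
have SQ (tz : I * fiber x) : complement_set A (val (g tz.1), iso_fun E tz.1 (val tz.2)).
  have := @carries_fiberP tz.1 _ (set_mem (valP tz.2)) => /mem_set Sf.
  exact: (set_mem (@fiber_incl_subproof _ _ (g tz.1) (SigSub Sf))).
have [Q {}cQ QE] := @set_type_lift _ (complement_set A) _ _ cQ SQ.
have Q0 z : Q (zero, z) = fiber_incl z.
  by apply: val_inj; rewrite QE /= path_zero (carries_zero gE).
have Q1 z : Q (one, z) = fiber_incl (f z).
  by apply: val_inj; rewrite QE /= path_one fE.
have cQz z : continuous (fun t => Q (t, z)) by apply: (@cont_comp _ _ _ (fun t => (t, z)) Q cQ); cont.
pose tr z : {path I from fiber_incl z to fiber_incl (f z) in complement A} :=
  mk_path (@cQz z) (Q0 z) (Q1 z).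
exists (fun z => hol L (tr z) / hol L (tr z0)); split=> [|z zE]; last first.
  have -> : z = z0 by apply: val_inj; rewrite zE z0E.
  by rewrite divff // hol_neq0.
split=> [z|z w p]; first by rewrite mulf_neq0 ?invr_neq0 // hol_neq0.
rewrite mulrAC mulrA; congr (_ / _).
rewrite [LHS]mulrC [RHS]mulrC.
have cQ2 : continuous (fun ab : I * I => Q (ab.2, p ab.1)).
  have cp : continuous (fun ab : I * I => p ab.1).
    by apply: (@cont_comp _ _ _ fst p (@cts_fun _ _ p)); cont.
  by apply: (@cont_comp _ _ _ (fun ab : I * I => (ab.2, p ab.1)) Q cQ); cont.
pose b : {path I from fiber_incl z to fiber_incl w in complement A} :=
  Defs.path_map (@fiber_incl R A x) p.
pose t : {path I from fiber_incl (f z) to fiber_incl (f w) in complement A} :=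
  Defs.path_map (@fiber_incl R A x') (Defs.path_map f p).
have sq : hol L b * hol L (tr w) = hol L (tr z) * hol L t.
  apply: (hol_square L cQ2) => a.
  - by rewrite Q0.
  - by cbn beta iota delta [fst snd]; rewrite path_one.
  - by cbn beta iota delta [fst snd]; rewrite path_zero.
  - by rewrite Q1.
exact: sq.
Qed.

End AlongPath.

Lemma hol_constant (T : topologicalType) (M : local_system R T) (u v : T)
    (p : {path I from u to v in T}) : (forall t, p t = u) -> hol M p = 1.
Proof.
move=> pu; have uv : u = v by rewrite -(pu one); exact: path_one.
case: _ / uv p pu => p pu; rewrite -(hol_cst M u); congr (hol M _).
exact/path_eqP.
Qed.

Section LiftData.
Context (x x' : base A).

(** Transport data given by an isotopy of the complex line. They can be concatenated and inverted,
    and compared with an arbitrary trivialization. *)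
Record lift_data (g : {path I from x to x' in base A}) (E : isotopy R)
    (f : continuousType (fiber x) (fiber x')) (phi : fiber x -> R[i])
    (F : H1F x -> H1F x') : Prop := LiftData {
  lift_carries : carries y0 E x g;
  lift_end : forall z, val (f z) = iso_fun E one (val z);
  lift_iso : is_local_system_iso (fiber_system L x) (fiber_system L x') f phi;
  lift_base : forall z, val z = y0 -> phi z = 1;
  lift_induced : induces_on_H1 f phi F }.

Definition lifts (g : {path I from x to x' in base A}) (F : H1F x -> H1F x') : Prop :=
  exists E f phi, lift_data g E f phi F.

Lemma lifts_exists (g : {path I from x to x' in base A}) : below y0 g ->
  exists F : {linear H1F x -> H1F x'}, lifts g F.
Proof.
move=> bg; have [E gE] := carries_exists bg.
have [f fE] := end_map_exists gE.
have [|phi [phi_iso phi1]] := stalk_iso_exists gE fE.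
  by apply: low_fiber => i; have := bg zero i; rewrite path_zero.
have [F FE] := induced_exists phi_iso.
by exists F, E, f, phi.
Qed.

Lemma lifts_transport (g : {path I from x to x' in base A})
    (F : {linear H1F x -> H1F x'}) : lifts g F -> is_transport y0 g F.
Proof.
move=> [E [f [phi [gE fE phi_iso phi1 FE]]]].
have [h [ht hE]] := trivialization_exists gE.
by exists h, f, phi; split=> // z; rewrite hE fE.
Qed.

(* Composing the trivialization over g with an isotopy that pushes g to g',
   and with the isotopy over g' read backwards, gives a homotopy between the
   two maps at the end fiber. *)
Lemma transport_unique (g g' : {path I from x to x' in base A})
    (F F' : {linear H1F x -> H1F x'}) (H : I * I -> base A) :
  continuous H -> (forall st, low A y0 (val (H st))) ->
  (forall t, H (zero, t) = g t) -> (forall t, H (one, t) = g' t) ->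
  (forall s, H (s, zero) = x) -> (forall s, H (s, one) = x') ->
  is_transport y0 g F -> lifts g' F' -> F =1 F'.
Proof.
move=> cH Hlow Hg Hg' Hx Hx' [h [f [phi [[ch _ ht h0 hy] fE [phi0 phiE] phi1 FE]]]].
move=> [E [f' [phi' [gE f'E [phi'0 phi'E] phi'1 F'E]]]].
have [X [Xh Xy Xcst]] := carry_homotopy cH Hlow.
(* At time zero [X], [h] and the inverse of [E] are the identity, which leaves [f']. At time one [X]
   is the identity and [E] cancels, which leaves [f]. *)
pose T (sz : I * fiber x) :=
  iso_fun E one (iso_inv E sz.1 (iso_fun X sz.1 (val (h sz)).2)).
have chv : continuous (fun sz => (val (h sz)).2).
  exact: (cont_snd_comp (cont_bundle_val ch)).
have cT : continuous T.
  apply: (cont_iso (@cont_cst _ _ one)).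
  by apply: (cont_iso_inv (@cont_fst _ _)); exact: (cont_iso (@cont_fst _ _) chv).
have ST sz : fiber_set A (val x') (T sz).
  rewrite /T; case: sz => t z; rewrite -[val x'](congr1 val (path_one : g' one = x')).
  apply: (carries_fiberP gE); apply: (carries_inv_fiberP gE).
  have hS : fiber_set A (val (g t)) (val (h (t, z))).2.
    by have := set_mem (valP (h (t, z))); rewrite /= ht.
  apply: (carries_fiber (isoK X t) _ hS) => i.
  by rewrite -Hg -Hg'; exact: Xh.
have [W {}cT TE] := @set_type_lift _ (fiber_set A (val x')) _ _ cT ST.
have T0 z : W (zero, z) = f' z.
  apply: val_inj; rewrite TE /T /= f'E h0 Xcst; last by move=> s; rewrite !Hx.
  by rewrite -{1}(carries_zero gE (val z)) isoK.
have T1 z : W (one, z) = f z.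
  apply: val_inj; rewrite TE /T /= fE Xcst ?iso_invK //.
  by move=> s; rewrite !Hx'.
have [z0 z0E] : exists z : fiber x, val z = y0.
  by apply: low_fiber; rewrite -(Hx zero).
have Ty s : val (W (s, z0)) = y0.
  rewrite TE /T /= hy // Xy -{1}(carries_y0 gE s) isoK (carries_y0 gE) //.
(* Both stalk maps are 1 at [z0], and the trace of [z0] is constant because [y0] stays fixed. A path
   from [z0] to [z] propagates the relation, by naturality and the holonomy of the square it sweeps
   out. *)
have trE z : phi z = hol (fiber_system L x') (trace cT T0 T1 z) * phi' z.
  have [p _] := fiber_connected z0 z.
  have := phiE _ _ p; rewrite (phi1 z0 z0E) mulr1 => phip.
  have := phi'E _ _ p; rewrite (phi'1 z0 z0E) mulr1 => phi'p.
  apply: (mulIf (hol_neq0 (fiber_system L x) p)); rewrite -mulrA phip phi'p mulrC.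
  have tr0 : hol (fiber_system L x') (trace cT T0 T1 z0) = 1.
    apply: hol_constant => s; rewrite -[trace _ _ _ _ s]/(W (s, z0)) -T0.
    by apply: val_inj; rewrite !Ty.
  have cp : continuous (fun ab : I * I => p ab.1).
    by apply: (@cont_comp _ _ _ fst p (@cts_fun _ _ p)); cont.
  have cQ : continuous (fun ab : I * I => W (ab.2, p ab.1)).
    by apply: (@cont_comp _ _ _ (fun ab : I * I => (ab.2, p ab.1)) W cT); cont.
  have sq : hol (fiber_system L x') (Defs.path_map f' p) *
      hol (fiber_system L x') (trace cT T0 T1 z) =
      hol (fiber_system L x') (trace cT T0 T1 z0) * hol (fiber_system L x') (Defs.path_map f p).
    apply: (hol_square (fiber_system L x') cQ) => a.
    - exact: (esym (T0 (p a))).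
    - by cbn beta iota delta [fst snd]; rewrite path_one.
    - by cbn beta iota delta [fst snd]; rewrite path_zero.
    - exact: (esym (T1 (p a))).
  by rewrite sq tr0 mul1r.
move=> u; apply: esym.
exact: (induced_homotopic (conj phi'0 phi'E) trE F'E FE u).
Qed.

Lemma lifts_is_transport_unique (g g' : {path I from x to x' in base A})
    (F F' : {linear H1F x -> H1F x'}) : 0 < complex.Im y0 -> is_real x -> is_real x' ->
  below y0 g -> below y0 g' -> path_homotopic g g' ->
  is_transport y0 g F -> lifts g' F' -> F =1 F'.
Proof.
move=> y0p xR x'R bg bg' gg'.
have [H [cH Hg Hg' [Hx Hx'] Hlow]] := low_homotopy y0p xR x'R bg bg' gg'.
exact: transport_unique cH Hlow Hg Hg' Hx Hx'.
Qed.

End LiftData.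

Lemma lifts_cat (x x' x'' : base A) (g : {path I from x to x' in base A})
    (g' : {path I from x' to x'' in base A}) (F : H1F x -> H1F x') (F' : H1F x' -> H1F x'') :
  lifts g F -> lifts g' F' -> lifts (path_cat g g') (F' \o F).
Proof.
move=> [E [f [phi [gE fE phi_iso phi1 FE]]]] [E' [f' [phi' [gE' fE' phi_iso' phi1' FE']]]].
have [D gD DE] := carries_cat gE gE'.
exists D, (f' \o f), (fun z => phi' (f z) * phi z); split=> //.
- by move=> z; rewrite DE -fE -fE'.
- exact: (local_system_iso_comp phi_iso phi_iso').
- move=> z zE; rewrite phi1 // phi1' ?mulr1 // fE zE.
  exact: (carries_y0 gE).
- exact: (induced_comp FE FE').
Qed.

Lemma lifts_id (x : base A) : lifts (path_cst R x) (idfun : H1F x -> H1F x).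
Proof.
have [E EE] := isotopy_id R.
exists E, idfun, (fun=> 1); split.
- by split=> [i t|t|y]; rewrite EE.
- by move=> z; rewrite EE.
- exact: local_system_iso_id.
- by [].
- exact: induced_id.
Qed.

End Transport.

(** * Functoriality of transport on homotopy classes *)

Section TransportFunctor.
Context (R : realType) (A : fibered_arrangement R).
Variable L : local_system R (complement A).
Variable y0 : R[i].
Hypothesis y0_gt0 : 0 < complex.Im y0.
Local Notation I := (unit_interval R).
Local Notation H1F x := (H1 (fiber_system L x)).

(** [F] shows that the set under [xget] is inhabited, so the chosen map is a transport over some low
    representative; uniqueness identifies it with [F] whatever the choice was. *)
Lemma transport_eq (x x' : base A) (c : pi1 R x x') (g : {path I from x to x' in base A})
    (F : {linear H1F x -> H1F x'}) : is_real x -> is_real x' ->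
  hclass g = c -> below y0 g -> lifts y0 g F -> transport L y0 c =1 F.
Proof.
move=> xR x'R gc bg gF.
have [g' [g'c bg' g'T]] : exists g' : {path I from x to x' in base A},
    [/\ hclass g' = c, below y0 g' & is_transport y0 g' (transport L y0 c)].
  pose S := [set G : {linear H1F x -> H1F x'} | exists g' : {path I from x to x' in base A},
    [/\ hclass g' = c, below y0 g' & is_transport y0 g' G]].
  have SF : exists G, S G by exists F, g; split=> //; exact: lifts_transport.
  exact: (xgetPex (\0 : {linear H1F x -> H1F x'}) SF).
apply: (lifts_is_transport_unique y0_gt0 xR x'R bg' bg _ g'T gF).
by apply/hclassE; rewrite g'c.
Qed.

Lemma transport_lifts (x x' : base A) (c : pi1 R x x') : is_real x -> is_real x' ->
  exists g, exists F : {linear H1F x -> H1F x'},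
    [/\ hclass g = c, below y0 g, lifts y0 g F & transport L y0 c =1 F].
Proof.
move=> xR x'R; have [g gg bg] := below_representative y0_gt0 xR x'R (repr c).
have [F gF] := lifts_exists L bg.
have gc : hclass g = c by rewrite -(hclass_repr c); apply/hclassE/path_homotopic_sym.
by exists g, F; split=> //; exact: transport_eq gF.
Qed.

Lemma transport_mul (x x' x'' : base A) (c : pi1 R x x') (d : pi1 R x' x'') :
  is_real x -> is_real x' -> is_real x'' ->
  transport L y0 (pi1_mul c d) =1 transport L y0 d \o transport L y0 c.
Proof.
move=> xR x'R x''R u.
have [g [F [gc bg gF cF]]] := transport_lifts c xR x'R.
have [h [G [hd bh hG dG]]] := transport_lifts d x'R x''R.
rewrite /= cF dG.
apply: (@transport_eq _ _ _ (path_cat g h) (G \o F)) => //.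
- by rewrite -gc -hd pi1_mulE.
- move=> t; rewrite -[path_cat g h t]/(path_cat_fun g h t) /path_cat_fun.
  by case: ifP => _ i; [exact: bg|exact: bh].
- exact: lifts_cat.
Qed.

Lemma transport_cst (x : base A) : is_real x ->
  transport L y0 (hclass (path_cst R x)) =1 id.
Proof.
move=> xR; apply: (@transport_eq _ _ _ (path_cst R x) idfun) => //.
- by move=> t; exact: low_real.
- exact: lifts_id.
Qed.

Lemma transport_VK (x x' : base A) (c : pi1 R x x') : is_real x -> is_real x' ->
  cancel (transport L y0 c) (transport L y0 (pi1_inv c)).
Proof.
by move=> xR x'R u; rewrite -[LHS](transport_mul c (pi1_inv c)) // pi1_mulV transport_cst.
Qed.

Lemma transport_K (x x' : base A) (c : pi1 R x x') : is_real x -> is_real x' ->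
  cancel (transport L y0 (pi1_inv c)) (transport L y0 c).
Proof.
by move=> xR x'R u; rewrite -[LHS](transport_mul (pi1_inv c) c) // pi1_Vmul transport_cst.
Qed.

Lemma transport_bij (x x' : base A) (c : pi1 R x x') : is_real x -> is_real x' ->
  bijective (transport L y0 c).
Proof.
by move=> xR x'R; exists (transport L y0 (pi1_inv c)); [exact: transport_VK|exact: transport_K].
Qed.

(** Every [v] has the preimage [g v], so the default value in [inverse] is never taken. *)
Lemma inverse_bij (U V : nmodType) (f : U -> V) (g : V -> U) :
  cancel f g -> cancel g f -> inverse f =1 g.
Proof.
move=> fK gK v; apply: (can_inj fK); rewrite gK.
exact: (xgetPex 0 (ex_intro (fun u => f u = v) (g v) (gK v))).
Qed.

Lemma inverse_transport (x x' : base A) (c : pi1 R x x') : is_real x -> is_real x' ->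
  inverse (transport L y0 c) =1 transport L y0 (pi1_inv c).
Proof. by move=> xR x'R; apply: inverse_bij; [exact: transport_VK|exact: transport_K]. Qed.

End TransportFunctor.

(** * Generation by the elementary loops *)

Section LineHomotopy.
Context (R : realType) (A : fibered_arrangement R).
Local Notation I := (unit_interval R).
Implicit Types (a b : base A).

Definition lin (s : R) (z w : R[i]) : R[i] :=
  ((1 - s) * complex.Re z + s * complex.Re w) +i*
  ((1 - s) * complex.Im z + s * complex.Im w).

Lemma lin0 z w : lin 0 z w = z.
Proof. by case: z => x y; rewrite /lin subr0 !mul1r !mul0r !addr0. Qed.

Lemma lin1 z w : lin 1 z w = w.
Proof. by case: w => x y; rewrite /lin subrr !mul1r !mul0r !add0r. Qed.

Lemma lin_id s z : lin s z z = z.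
Proof. by case: z => x y; rewrite /lin -!mulrDl subrK !mul1r. Qed.

Lemma cont_lin (X : topologicalType) (s : X -> R) (z w : X -> R[i]) :
  continuous s -> continuous z -> continuous w ->
  continuous (fun x => lin (s x) (z x) (w x)).
Proof. by move=> cs cz cw; rewrite /lin; cont. Qed.

Lemma line_homotopic a b (p q : {path I from a to b in base A}) :
  (forall (s : R) t, 0 <= s <= 1 -> ~ piS A (lin s (val (p t)) (val (q t)))) ->
  path_homotopic p q.
Proof.
move=> pqS.
have cp : continuous (fun st : I * I => val (p st.2)).
  exact: (@cont_comp _ _ _ snd (fun t => val (p t)) (cont_base_val (@cts_fun _ _ p)) (@cont_snd _ _)).
have cq : continuous (fun st : I * I => val (q st.2)).
  exact: (@cont_comp _ _ _ snd (fun t => val (q t)) (cont_base_val (@cts_fun _ _ q)) (@cont_snd _ _)).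
have cs : continuous (fun st : I * I => val st.1 : R) by cont.
apply: (@set_type_homotopic R _ (~` piS A) a b p q
  (fun st => lin (val st.1) (val (p st.2)) (val (q st.2)))).
- exact: (cont_lin cs cp cq).
- by move=> st; apply: pqS; rewrite unit_interval_ge0 unit_interval_le1.
- by move=> t; cbn beta iota delta [fst snd]; rewrite val_zero lin0.
- by move=> t; cbn beta iota delta [fst snd]; rewrite val_one lin1.
- by move=> s; cbn beta iota delta [fst snd]; rewrite !path_zero lin_id.
- by move=> s; cbn beta iota delta [fst snd]; rewrite !path_one lin_id.
Qed.

Lemma line_path a b : (forall s : R, 0 <= s <= 1 -> ~ piS A (lin s (val a) (val b))) ->
  exists p : {path I from a to b in base A}, forall t, val (p t) = lin (val t) (val a) (val b).
Proof.
move=> abS.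
apply: (@set_type_path R _ (~` piS A) (fun t => lin (val t) (val a) (val b)) a b).
- by apply: (cont_lin _ (@cont_cst _ _ _) (@cont_cst _ _ _)); cont.
- by move=> t; apply: abS; rewrite unit_interval_ge0 unit_interval_le1.
- by rewrite val_zero lin0.
- by rewrite val_one lin1.
Qed.

(** The half plane is recorded by any nonzero real, so that a difference of abscissas can serve as a
    sign. *)
Definition in_half (sg : R) a b (p : {path I from a to b in base A}) : Prop :=
  forall t, 0 <= sg * complex.Im (val (p t)).

(** The segment is bent by [sg] times t (1 - t); multiplied by [sg], this adds a square factor and
    is positive inside the interval. *)
Lemma arc_exists (sg : R) a b : sg != 0 ->
  0 <= sg * complex.Im (val a) -> 0 <= sg * complex.Im (val b) ->
  exists q : {path I from a to b in base A},
    forall t, [\/ t = zero, t = one | 0 < sg * complex.Im (val (q t))].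
Proof.
move=> sg0 a0 b0.
pose f (t : I) : R[i] := ((1 - val t) * complex.Re (val a) + val t * complex.Re (val b)) +i*
  ((1 - val t) * complex.Im (val a) + val t * complex.Im (val b) + sg * (val t * (1 - val t))).
have fpos t : [\/ t = zero, t = one | 0 < sg * complex.Im (f t)].
  have [t0|t0] := eqVneq (val t) 0.
    by constructor 1; apply: val_inj; rewrite val_zero.
  have [t1|t1] := eqVneq (val t) 1.
    by constructor 2; apply: val_inj; rewrite val_one.
  constructor 3; rewrite /f; cbn beta iota delta [complex.Im].
  have t_gt0 : 0 < val t by rewrite lt_neqAle eq_sym t0 unit_interval_ge0.
  have t_lt1 : 0 < 1 - val t by rewrite subr_gt0 lt_neqAle t1 unit_interval_le1.
  have sg2 : 0 < sg * sg by rewrite -expr2 exprn_even_gt0.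
  rewrite [ltRHS](_ : _ = (1 - val t) * (sg * complex.Im (val a)) +
    val t * (sg * complex.Im (val b)) + sg * sg * (val t * (1 - val t))); last by ring.
  apply: ltr_wpDl; last by apply: mulr_gt0 => //; exact: mulr_gt0.
  by apply: addr_ge0; apply: mulr_ge0 => //; exact: ltW.
have f0 : f zero = val a.
  by rewrite /f val_zero subr0 !mul0r mulr0 !addr0 !mul1r; case: (val a).
have f1 : f one = val b.
  by rewrite /f val_one subrr !mul0r !mulr0 !add0r addr0 !mul1r; case: (val b).
have [|t|||q qE] := @set_type_path R _ (~` piS A) f a b.
- by rewrite /f; cont.
- case: (fpos t) => [->|->|ft]; rewrite ?f0 ?f1; [exact: base_notin..|].
  by move=> /piS_real f0'; rewrite f0' mulr0 ltxx in ft.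
- by [].
- by [].
by exists q => t; rewrite qE; exact: fpos.
Qed.

(* Two paths in the same closed half plane are both homotopic to an arc which
   meets the real line at most at its ends. *)
Lemma in_half_homotopic (sg : R) a b (p q : {path I from a to b in base A}) :
  sg != 0 -> in_half sg p -> in_half sg q -> path_homotopic p q.
Proof.
move=> sg0 psg qsg.
have [] := @arc_exists sg a b sg0.
- by have := psg zero; rewrite path_zero.
- by have := psg one; rewrite path_one.
move=> r rpos.
have toarc (p' : {path I from a to b in base A}) : in_half sg p' -> path_homotopic p' r.
  move=> p'sg; apply: line_homotopic => s t /andP[s0 s1].
  case: (rpos t) => [->|->|rt].
  - by rewrite !path_zero lin_id; exact: base_notin.
  - by rewrite !path_one lin_id; exact: base_notin.
  have [->|s_n0] := eqVneq s 0; first by rewrite lin0; exact: base_notin.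
  move=> /piS_real; rewrite /lin; cbn beta iota delta [complex.Im] => /(congr1 (fun u => sg * u)).
  have s_gt0 : 0 < s by rewrite lt_neqAle eq_sym s_n0.
  rewrite [X in X = _](_ : _ = (1 - s) * (sg * complex.Im (val (p' t))) +
    s * (sg * complex.Im (val (r t)))); last by ring.
  move=> /eqP; rewrite mulr0 gt_eqF //; apply: ltr_wpDl; last by rewrite mulr_gt0.
  by apply: mulr_ge0; [rewrite subr_ge0|exact: p'sg].
apply: path_homotopic_trans (toarc p psg) _.
exact/path_homotopic_sym/toarc.
Qed.

End LineHomotopy.

Section Between.
Context (R : realType).
Implicit Types (X P W a e : R).

Definition between (a b q : R) : bool := ((a < q) && (q < b)) || ((b < q) && (q < a)).

(** [X] is the abscissa of the base point, [P] a point of pi(S), [W] the target; [P + e] and [P - e]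
    are the abscissas of the close pair at [P], the first on the side of [X]. *)
Variables (X P W e : R).
Hypothesis X_lt : X < P -> X - P <= e < 0.
Hypothesis X_gt : P < X -> 0 < e <= X - P.

Lemma between_cases : between X W P ->
  [/\ X < P, P < W, X - P <= e & e < 0] \/ [/\ W < P, P < X, 0 < e & e <= X - P].
Proof.
case/orP=> /andP[h1 h2]; [left|right].
  by have /andP[] := X_lt h1.
by have /andP[] := X_gt h2.
Qed.

Lemma between_sub a : between X W P -> between X (P + e) a -> between X W a.
Proof.
move=> /between_cases[] [? ? ? ?] /orP[] /andP[? ?]; apply/orP.
- by left; apply/andP; split; lra.
- by exfalso; lra.
- by exfalso; lra.
- by right; apply/andP; split; lra.
Qed.

Lemma between_self : between X W P -> ~~ between X (P + e) P.
Proof.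
by move=> /between_cases[] [? ? ? ?]; apply/negP => /orP[] /andP[? ?]; lra.
Qed.

Lemma between_side : between X W P ->
  0 < (X - P) * (X - W) /\ 0 < (X - P) * (X - (P - e)).
Proof.
move=> /between_cases[] [? ? ? ?]; split.
- by rewrite nmulr_rgt0; lra.
- by rewrite nmulr_rgt0; lra.
- by apply: mulr_gt0; lra.
- by apply: mulr_gt0; lra.
Qed.

(** A point between [P - e] and [W] is either closer to [P] than the close pair allows, or lies
    between [X] and [W] and is nearer to [W] than [P] is. *)
Lemma between_reflect a : between X W P -> (a != P -> `|e| < `|a - P|) ->
  (between X W a -> `|P - W| <= `|a - W|) -> ~~ between (P - e) W a.
Proof.
move=> XWP aP amin; apply/negP => kb.
have {}aP : `|e| < `|a - P|.
  apply: aP; apply: contraTneq kb => ->; apply/negP.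
  by move: XWP => /between_cases[] [? ? ? ?] /orP[] /andP[? ?]; lra.
move: XWP aP amin => /[dup] XWP /between_cases[] [h1 h2 h3 h4].
  rewrite (ltr0_norm h4) (ltr0_norm (x := P - W)); last by lra.
  case/orP: kb => /andP[k1 k2].
    rewrite (ltr0_norm (x := a - W)); last by lra.
    move=> aP amin; suff : - (P - W) <= - (a - W) by rewrite ger0_norm in aP; lra.
    by apply: amin; apply/orP; left; apply/andP; split; lra.
  by move=> + _; rewrite ger0_norm; lra.
rewrite (gtr0_norm h3) (gtr0_norm (x := P - W)); last by lra.
case/orP: kb => /andP[k1 k2].
  by move=> + _; rewrite ler0_norm; lra.
rewrite (gtr0_norm (x := a - W)); last by lra.
move=> aP amin; suff : P - W <= a - W by lra.
by apply: amin; apply/orP; right; apply/andP; split; lra.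
Qed.

End Between.

Section Generation.
Context (R : realType) (A : fibered_arrangement R).
Local Notation I := (unit_interval R).
Local Notation B := (base A).
Variable x0 : B.
Hypothesis x0R : is_real x0.
Variable gamma : forall x x' : B, {path I from x to x' in B}.
Hypothesis hgamma : forall x x' : B, is_real x -> is_real x' -> half_plane_path (gamma x x').

Local Notation Re x := (complex.Re (val x)).
Local Notation Im x := (complex.Im (val x)).

Lemma base_real_eq (a b : B) : is_real a -> is_real b -> Re a = Re b -> a = b.
Proof. by move=> aR bR ab; apply/val_inj/complex_ext => //; rewrite aR bR. Qed.

Lemma gamma_in_half (sg : R) (a b : B) : is_real a -> is_real b ->
  0 < sg * (Re a - Re b) -> in_half sg (gamma a b).
Proof.
move=> aR bR sgab t; have [_ /(_ t) h] := hgamma aR bR.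
have sg2 : 0 <= sg ^+ 2 by exact: sqr_ge0.
have : 0 <= (sg * Im (gamma a b t)) * (sg * (Re a - Re b)).
  rewrite (_ : _ * _ = sg ^+ 2 * (Im (gamma a b t) * (Re a - Re b))); last by ring.
  exact: mulr_ge0.
by rewrite pmulr_lge0.
Qed.

(** For equal ends the sign condition on [gamma a a] is empty and the path may visit both half
    planes, but [a] is its only real value. Shrinking it linearly to [a] thus avoids pi(S). The case
    occurs because x_p may be x0. *)
Lemma gamma_loop (a : B) : is_real a -> hclass (gamma a a) = hclass (path_cst R a).
Proof.
move=> aR; apply/hclassE/line_homotopic => s t /andP[s0 s1].
have [/(_ t) h _] := hgamma aR aR.
have [gR|gR] := eqVneq (Im (gamma a a t)) 0.
  have -> : gamma a a t = a by case: (h gR).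
  by rewrite lin_id; exact: base_notin.
have [->|s_n1] := eqVneq s 1; first by rewrite lin1; exact: base_notin.
move=> /piS_real; rewrite /lin; cbn beta iota delta [complex.Im].
rewrite -[path_cst R a t]/a aR mulr0 addr0 => /eqP; rewrite mulf_eq0 (negbTE gR) orbF.
by rewrite subr_eq0 eq_sym (negbTE s_n1).
Qed.

Lemma in_half_cat (sg : R) (a b c : B) (p : {path I from a to b in B})
    (q : {path I from b to c in B}) :
  in_half sg p -> in_half sg q -> in_half sg (path_cat p q).
Proof.
move=> psg qsg t; rewrite -[path_cat p q t]/(path_cat_fun p q t) /path_cat_fun.
by case: ifP => _; [exact: psg|exact: qsg].
Qed.

Lemma in_half_rev (sg : R) (a b : B) (p : {path I from a to b in B}) :
  in_half sg p -> in_half sg (path_rev p).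
Proof. by move=> psg t; exact: psg. Qed.

Lemma in_half_cst (sg : R) (a : B) : 0 <= sg * Im a -> in_half sg (path_cst R a).
Proof. by move=> asg t. Qed.

Lemma in_half_hclass (sg : R) (a b : B) (p q : {path I from a to b in B}) :
  sg != 0 -> in_half sg p -> in_half sg q -> hclass p = hclass q.
Proof. by move=> sg0 psg qsg; apply/hclassE; exact: in_half_homotopic psg qsg. Qed.

(** For [a], [b], [c] in this order on the line, the three arcs lie in the same half plane; [a] and
    [b] may coincide. *)
Lemma gamma_mul (sg : R) (a b c : B) : is_real a -> is_real b -> is_real c ->
  0 <= sg * (Re a - Re b) -> 0 < sg * (Re b - Re c) ->
  pi1_mul (hclass (gamma a b)) (hclass (gamma b c)) = hclass (gamma a c).
Proof.
move=> aR bR cR ab bc.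
have sg0 : sg != 0 by apply: contraTneq bc => ->; rewrite mul0r ltxx.
have [ab0|ab0] := eqVneq (Re a) (Re b).
  rewrite (base_real_eq aR bR ab0) gamma_loop // pi1_1mul //.
have ab' : 0 < sg * (Re a - Re b).
  by rewrite lt_neqAle ab eq_sym mulf_neq0 ?subr_eq0.
rewrite pi1_mulE; apply: (in_half_hclass sg0).
  by apply: in_half_cat; exact: gamma_in_half.
apply: gamma_in_half => //.
rewrite (_ : Re a - Re c = (Re a - Re b) + (Re b - Re c)); last by ring.
by rewrite mulrDr addr_gt0.
Qed.

(* The loop going to w in one half plane and back in the other. *)
Definition real_loop (w : B) : pi1 R x0 x0 :=
  pi1_mul (hclass (gamma x0 w)) (hclass (gamma w x0)).

Variables (xp xp' : R[i] -> B).
Hypothesis hxp : forall p : R[i], piS A p -> close_pair x0 p (xp p) (xp' p).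

Lemma close_pair_real p : piS A p -> exists t : R,
  [/\ 0 < t <= 1, Re (xp p) = complex.Re p + t * (Re x0 - complex.Re p),
      Re (xp' p) = complex.Re p - t * (Re x0 - complex.Re p) &
      is_real (xp p) /\ is_real (xp' p)].
Proof.
move=> pS; have pR := piS_real pS; have [[t /andP[t0 t1] xpE] xp'E _] := hxp pS.
exists t.
have E : val (xp p) = (complex.Re p + t * (Re x0 - complex.Re p))%:C.
  rewrite xpE; apply: complex_ext.
    by rewrite ReD ReM /= mul0r subr0 raddfB.
  by rewrite ImD ImM /= mul0r addr0 raddfB /= x0R pR subr0 mulr0 addr0.
have E' : val (xp' p) = (complex.Re p - t * (Re x0 - complex.Re p))%:C.
  rewrite -[val (xp' p)](subrK p) xp'E E; apply: complex_ext.
    by rewrite ReD raddfN raddfB /=; ring.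
  by rewrite ImD raddfN raddfB /= pR; ring.
split; [|by rewrite E|by rewrite E'|by rewrite /is_real E E'].
(* [t] is nonzero, as otherwise x_p would be the point [p] of pi(S). *)
rewrite t1 andbT lt_neqAle t0 andbT eq_sym; apply/eqP => t_0.
apply: (@base_notin _ _ (xp p)); suff -> : val (xp p) = p by [].
by rewrite E t_0 mul0r addr0; apply: complex_ext.
Qed.

(** The first two arcs compose to the one from x0 to x'_p. On the way back, in the other half plane,
    the arc from x'_p to x_p is the one from x'_p to x0 followed by the inverse of the one from x_p
    to x0. *)
Lemma elementary_loopE p : piS A p ->
  elementary_loop gamma x0 (xp p) (xp' p) =
  pi1_mul (real_loop (xp' p)) (pi1_inv (real_loop (xp p))).
Proof.
move=> pS; have [t [/andP[t0 t1] xpE xp'E [xpR xp'R]]] := close_pair_real pS.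
pose d := Re x0 - complex.Re p.
have d0 : d != 0.
  rewrite subr_eq0; apply/eqP => x0p; apply: (@base_notin _ _ x0).
  by suff -> : val x0 = p by []; apply: complex_ext => //; rewrite x0R (piS_real pS).
have sg0 : 0 < d * d by rewrite -expr2 exprn_even_gt0.
have far0 : 0 <= d * (Re x0 - Re (xp p)).
  rewrite xpE -/d (_ : _ * _ = (1 - t) * (d * d)); last by rewrite /d; ring.
  by apply: mulr_ge0; [rewrite subr_ge0|exact: ltW].
have far1 : 0 < d * (Re (xp p) - Re (xp' p)).
  rewrite xpE xp'E -/d (_ : _ * _ = 2 * t * (d * d)); last by rewrite /d; ring.
  by apply: mulr_gt0 => //; exact: mulr_gt0.
have back : pi1_mul (hclass (gamma (xp' p) (xp p))) (hclass (gamma (xp p) x0)) =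
    hclass (gamma (xp' p) x0).
  have far1' : 0 < - d * (Re (xp' p) - Re (xp p)) by rewrite mulNr -mulrN opprB.
  have [x0xp|x0xp] := eqVneq (Re (xp p)) (Re x0).
    by rewrite (base_real_eq xpR x0R x0xp) gamma_loop // pi1_mul1.
  apply: (@gamma_mul (- d)) => //; first exact: ltW.
  by rewrite mulNr -mulrN opprB lt_neqAle far0 eq_sym mulf_neq0 // subr_eq0 eq_sym.
rewrite /elementary_loop /real_loop (gamma_mul x0R xpR xp'R far0 far1).
rewrite -back pi1_invM !pi1_mulA pi1_mulKV //.
Qed.

(** A subgroup containing the elementary loops, given as a predicate. *)
Variable K : pi1 R x0 x0 -> Prop.
Hypothesis K1 : K (hclass (path_cst R x0)).
Hypothesis KM : forall c d, K c -> K d -> K (pi1_mul c d).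
Hypothesis KV : forall c, K c -> K (pi1_inv c).
Hypothesis Kloop : forall p, piS A p -> K (elementary_loop gamma x0 (xp p) (xp' p)).

Lemma real_loop_step p : piS A p -> K (real_loop (xp p)) -> K (real_loop (xp' p)).
Proof.
move=> pS Kp; have := KM (Kloop pS) Kp.
by rewrite elementary_loopE // pi1_mulVK.
Qed.

Lemma real_segment (w w' : B) : is_real w -> is_real w' ->
  (forall s : R, 0 <= s <= 1 -> ~ piS A (lin s (val w) (val w'))) ->
  exists p : {path I from w to w' in B}, forall sg, in_half sg p.
Proof.
move=> wR w'R /line_path[p pE]; exists p => sg t.
by rewrite pE /lin; cbn beta iota delta [complex.Im]; rewrite wR w'R !mulr0 addr0 mulr0.
Qed.

(** The real segment from [w] to [w'] lies in both closed half planes, so it can be absorbed by the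
    outgoing and by the returning arc. *)
Lemma real_loop_same (sg : R) (w w' : B) : is_real w -> is_real w' ->
  0 < sg * (Re x0 - Re w) -> 0 < sg * (Re x0 - Re w') ->
  (forall s : R, 0 <= s <= 1 -> ~ piS A (lin s (val w) (val w'))) ->
  real_loop w = real_loop w'.
Proof.
move=> wR w'R xw xw' ww'; have [p ph] := real_segment wR w'R ww'.
have sg0 : sg != 0 by apply: contraTneq xw => ->; rewrite mul0r ltxx.
have out : pi1_mul (hclass (gamma x0 w)) (hclass p) = hclass (gamma x0 w').
  rewrite pi1_mulE; apply: (in_half_hclass sg0); last exact: gamma_in_half.
  by apply: in_half_cat => //; exact: gamma_in_half.
have back : pi1_mul (hclass (path_rev p)) (hclass (gamma w x0)) = hclass (gamma w' x0).
  have nsg0 : - sg != 0 by rewrite oppr_eq0.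
  rewrite pi1_mulE; apply: (in_half_hclass nsg0).
    apply: in_half_cat; first exact: in_half_rev.
    by apply: gamma_in_half => //; rewrite mulNr -mulrN opprB.
  by apply: gamma_in_half => //; rewrite mulNr -mulrN opprB.
by rewrite /real_loop -out -back -pi1_invE !pi1_mulA pi1_mulKV.
Qed.

Lemma real_loop_near (w : B) : is_real w ->
  (forall s : R, 0 <= s <= 1 -> ~ piS A (lin s (val x0) (val w))) -> K (real_loop w).
Proof.
move=> wR xw; have [p ph] := real_segment x0R wR xw.
have [wx|wx] := eqVneq (Re x0) (Re w).
  rewrite -(base_real_eq x0R wR wx) /real_loop gamma_loop // pi1_mul1 //.
pose sg := Re x0 - Re w; have sg0 : sg != 0 by rewrite subr_eq0.
have sg2 : 0 < sg * (Re x0 - Re w) by rewrite -expr2 exprn_even_gt0.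
rewrite /real_loop (in_half_hclass sg0 (gamma_in_half x0R wR sg2) (ph sg)).
have nsg0 : - sg != 0 by rewrite oppr_eq0.
have nsg2 : 0 < - sg * (Re w - Re x0) by rewrite mulNr -mulrN opprB.
rewrite (in_half_hclass nsg0 (gamma_in_half wR x0R nsg2) (in_half_rev (ph (- sg)))).
by rewrite -pi1_invE pi1_mulV.
Qed.

Lemma lin_notin (a b : B) : is_real a -> is_real b ->
  (forall j : 'I_(nver A), ~~ between (Re a) (Re b) (abscissa j)) ->
  forall s : R, 0 <= s <= 1 -> ~ piS A (lin s (val a) (val b)).
Proof.
move=> aR bR nb s /andP[s0 s1] /piS_abscissa[j jE].
have {}jE : (1 - s) * Re a + s * Re b = abscissa j by move: jE => /(congr1 (@complex.Re R)).
have aj : Re a != abscissa j.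
  apply/eqP => aj; apply: (@base_notin _ _ a); apply/piS_abscissa; exists j.
  exact: complex_ext.
have bj : Re b != abscissa j.
  apply/eqP => bj; apply: (@base_notin _ _ b); apply/piS_abscissa; exists j.
  exact: complex_ext.
have sn0 : s != 0 by apply: contraNneq aj => s_0; rewrite -jE s_0 subr0 mul1r mul0r addr0.
have sn1 : s != 1 by apply: contraNneq bj => s_1; rewrite -jE s_1 subrr mul1r mul0r add0r.
have s_gt0 : 0 < s by rewrite lt_neqAle eq_sym sn0.
have s_lt1 : 0 < 1 - s by rewrite subr_gt0 lt_neqAle sn1.
apply/negP: (nb j); rewrite negbK /between -jE.
have [ab|ab|ab] := ltgtP (Re a) (Re b).
- apply/orP; left; apply/andP; split; nra.
- apply/orP; right; apply/andP; split; nra.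
- by move: aj; rewrite -jE -ab -mulrDl subrK mul1r eqxx.
Qed.

(** Take the point P of pi(S) between x0 and [w] that is nearest to [w]. Fewer points lie between x0
    and x_p, since P is lost, and none lies between x'_p and [w], so the loops of x'_p and [w]
    agree. *)
Lemma K_real_loop (w : B) : is_real w -> K (real_loop w).
Proof.
have [n] := ubnP #|[set j : 'I_(nver A) | between (Re x0) (Re w) (abscissa j)]|.
elim: n w => // n IH w cw wR.
have [j0 j0P|none] := pickP [pred j : 'I_(nver A) | between (Re x0) (Re w) (abscissa j)]; last first.
  by apply: real_loop_near => //; apply: lin_notin => // j; rewrite [between _ _ _]none.
have [j jP' jmin'] := @Order.TotalTheory.arg_minP _ _ _ j0
  [pred j : 'I_(nver A) | between (Re x0) (Re w) (abscissa j)]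
  (fun j => `|abscissa j - Re w|) j0P.
pose P := abscissa j; pose p : R[i] := P%:C.
have jP : between (Re x0) (Re w) P := jP'.
have jmin (k : 'I_(nver A)) : between (Re x0) (Re w) (abscissa k) ->
  `|P - Re w| <= `|abscissa k - Re w| := jmin' k.
have pS : piS A p by apply/piS_abscissa; exists j.
have [t [/andP[t0 t1] xpE xp'E [xpR xp'R]]] := close_pair_real pS.
rewrite [complex.Re p]/= -/P in xpE xp'E.
have [_ _ closest] := hxp pS.
have {}closest (k : 'I_(nver A)) : abscissa k != P -> `|t * (Re x0 - P)| < `|abscissa k - P|.
  move=> kP; have kS : piS A (abscissa k)%:C by apply/piS_abscissa; exists k.
  have kp : (abscissa k)%:C != p by apply: contraNneq kP => /(congr1 (@complex.Re R)) /= ->.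
  have := closest _ kS kp.
  have -> : val (xp p) - p = (t * (Re x0 - P))%:C.
    apply: complex_ext; first by rewrite raddfB /= xpE addrAC subrr add0r.
    by rewrite raddfB /= xpR subr0.
  rewrite -raddfB !normc_def /= !expr0n !addr0 !sqrtr_sqr.
  by rewrite ltcR.
have P0 : Re x0 != P.
  apply/eqP => x0P; apply: (@base_notin _ _ x0); apply/piS_abscissa; exists j.
  by apply: complex_ext.
have x0_lt : Re x0 < P -> Re x0 - P <= t * (Re x0 - P) < 0.
  move=> xP; rewrite nmulr_llt0 ?subr_lt0 // t0 andbT.
  by rewrite ler_niMl ?subr_le0 // ltW.
have x0_gt : P < Re x0 -> 0 < t * (Re x0 - P) <= Re x0 - P.
  move=> xP; rewrite mulr_gt0 ?subr_gt0 //=.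
  by rewrite ler_piMl ?subr_ge0 // ltW.
set e := t * (Re x0 - P) in xpE xp'E closest x0_lt x0_gt.
have smaller : (#|[set k : 'I_(nver A) | between (Re x0) (Re (xp p)) (abscissa k)]| < n)%N.
  move: cw; rewrite ltnS; apply: leq_trans; apply: proper_card; apply/properP; split.
    by apply/fintype.subsetP => k; rewrite !inE xpE; exact: between_sub.
  exists j; first by rewrite inE.
  by apply/negP; rewrite inE xpE; apply/negP; exact: (between_self x0_lt x0_gt jP).
have := real_loop_step pS (IH _ smaller xpR).
have no_between (k : 'I_(nver A)) : ~~ between (Re (xp' p)) (Re w) (abscissa k).
  by rewrite xp'E; apply: (between_reflect x0_lt x0_gt jP); [exact: closest|exact: jmin].
have [side side'] := between_side x0_lt x0_gt jP; rewrite -xp'E in side'.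
by rewrite (real_loop_same xp'R wR side' side (lin_notin xp'R wR no_between)).
Qed.

Definition reference (sg : R) (z : B) (r : {path I from x0 to z in B}) : Prop :=
  (sg = 1 \/ sg = -1) /\ in_half sg r.

Lemma reference_exists (sg : R) (z : B) : sg = 1 \/ sg = -1 -> 0 <= sg * Im z ->
  exists r, reference sg (z := z) r.
Proof.
move=> sg1 zsg.
have sg0 : sg != 0 by case: sg1 => ->; rewrite ?oppr_eq0 oner_eq0.
have [|q qpos] := @arc_exists R A sg x0 z sg0 _ zsg; first by rewrite x0R mulr0.
exists q; split=> // t; case: (qpos t) => [->|->|/ltW //].
  by rewrite path_zero x0R mulr0.
by rewrite path_one.
Qed.

Lemma sign_exists (z : B) : exists2 sg : R, sg = 1 \/ sg = -1 & 0 <= sg * Im z.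
Proof.
have [z0|/ltW z0] := leP 0 (Im z); first by exists 1; [left|rewrite mul1r].
by exists (-1); [right|rewrite mulN1r oppr_ge0].
Qed.

(** Reference paths in the same half plane are homotopic. Opposite signs force [z] to be real, and
    the loop is then [real_loop z] or its inverse, according to the side of x0 on which [z] lies. *)
Lemma K_reference (sg sg' : R) (z : B) (r r' : {path I from x0 to z in B}) :
  reference sg r -> reference sg' r' -> K (pi1_mul (hclass r) (pi1_inv (hclass r'))).
Proof.
have nz (s : R) : s = 1 \/ s = -1 -> s != 0 by case=> ->; rewrite ?oppr_eq0 oner_eq0.
move=> [sg1 rsg] [sg1' r'sg].
have [E|E] := eqVneq sg sg'.
  have -> : hclass r' = hclass r by apply: (in_half_hclass (nz _ sg1) _ rsg); rewrite E.
  by rewrite pi1_mulV.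
have {E} nsg : sg' = - sg.
  by case: sg1 sg1' E => -> [] ->; rewrite ?opprK ?eqxx.
have zR : is_real z.
  have := rsg one; have := r'sg one; rewrite nsg !path_one mulNr oppr_ge0 => h1 h2.
  have /eqP : sg * Im z = 0 by apply/eqP; rewrite eq_le h1 h2.
  by rewrite mulf_eq0 (negbTE (nz _ sg1)) /= => /eqP.
have [xz|xz] := eqVneq (Re x0) (Re z).
  move: r r' rsg r'sg; rewrite -(base_real_eq x0R zR xz) => r r' rsg r'sg.
  have cst_half s : in_half s (path_cst R x0) by apply: in_half_cst; rewrite x0R mulr0.
  rewrite (in_half_hclass (nz _ sg1) rsg (cst_half sg)).
  by rewrite (in_half_hclass (nz _ sg1') r'sg (cst_half sg')) pi1_mulV.
have K_z := K_real_loop zR.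
have sgz : 0 < sg * (Re x0 - Re z) \/ 0 < - sg * (Re x0 - Re z).
  rewrite mulNr oppr_gt0; apply/orP.
  have : sg * (Re x0 - Re z) != 0 by apply: mulf_neq0; [exact: nz|rewrite subr_eq0].
  by rewrite neq_lt orbC.
have half s : s != 0 -> 0 < s * (Re x0 - Re z) ->
    forall q q' : {path I from x0 to z in B}, in_half s q -> in_half (- s) q' ->
    pi1_mul (hclass q) (pi1_inv (hclass q')) = real_loop z.
  move=> s0 sz q q' qs q's; rewrite /real_loop; congr pi1_mul.
    by apply: (in_half_hclass s0 qs); exact: gamma_in_half.
  have ns0 : - s != 0 by rewrite oppr_eq0.
  rewrite pi1_invE; apply: (in_half_hclass ns0 (in_half_rev q's)).
  by apply: gamma_in_half => //; rewrite mulNr -mulrN opprB.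
case: sgz => sgz.
  by rewrite (half _ (nz _ sg1) sgz r r') // -nsg.
rewrite -[pi1_mul _ _]pi1_invK; apply: KV; rewrite pi1_invM pi1_invK.
by rewrite (half _ _ sgz r' r) ?opprK -?nsg //; exact: nz.
Qed.

(** Quantifying over all reference paths at both ends lets the one at an intermediate point cancel
    in a concatenation. *)
Definition tame (z w : B) (p : {path I from z to w in B}) : Prop :=
  forall sg sg' r r', reference sg (z := z) r -> reference sg' (z := w) r' ->
  K (pi1_mul (pi1_mul (hclass r) (hclass p)) (pi1_inv (hclass r'))).

Lemma tame_hclass (z w : B) (p q : {path I from z to w in B}) :
  hclass p = hclass q -> tame p -> tame q.
Proof. by move=> pq pt sg sg' r r' hr hr'; rewrite -pq; exact: pt hr hr'. Qed.

Lemma tame_cat (z w v : B) (p : {path I from z to w in B}) (q : {path I from w to v in B}) :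
  tame p -> tame q -> tame (path_cat p q).
Proof.
move=> pt qt sg sg' r r' hr hr'.
have [s s1 ws] := sign_exists w; have [u hu] := reference_exists s1 ws.
have := KM (pt _ _ _ _ hr hu) (qt _ _ _ _ hu hr').
by rewrite -pi1_mulE !pi1_mulA pi1_mulVK.
Qed.

Lemma tame_rev (z w : B) (p : {path I from z to w in B}) : tame p -> tame (path_rev p).
Proof.
move=> pt sg sg' r r' hr hr'; have := KV (pt _ _ _ _ hr' hr).
by rewrite !pi1_invM pi1_invK -pi1_invE pi1_mulA.
Qed.

(** A reference path in the half plane of [p], continued by [p], is a reference path to the end of
    [p]; only changes of reference paths remain. *)
Lemma tame_half (sg : R) (z w : B) (p : {path I from z to w in B}) :
  sg = 1 \/ sg = -1 -> in_half sg p -> tame p.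
Proof.
move=> sg1 psg s s' r r' hr hr'.
have [|u hu] := reference_exists sg1 (z := z); first by have := psg zero; rewrite path_zero.
have hup : reference sg (path_cat u p) by split=> //; apply: in_half_cat; [case: hu|].
have := KM (K_reference hr hu) (K_reference hup hr').
by rewrite -pi1_mulE !pi1_mulA pi1_mulVK.
Qed.

Definition box (e : R) (z w : R[i]) : Prop :=
  `|complex.Re w - complex.Re z| < e /\ `|complex.Im w - complex.Im z| < e.

Lemma box_exists (z : B) : exists2 e : R, 0 < e &
  forall w, box e (val z) w -> ~ piS A w /\ exists2 sg : R, sg = 1 \/ sg = -1 &
    0 <= sg * Im z /\ 0 <= sg * complex.Im w.
Proof.
have [z0|z0] := eqVneq (Im z) 0; last first.
  exists `|Im z|; rewrite ?normr_gt0 // => w [_ wz].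
  have [zp|zn] := ltP 0 (Im z).
    rewrite (gtr0_norm zp) ltr_norml in wz; have /andP[w1 w2] := wz.
    have w0 : 0 < complex.Im w by lra.
    split; first by move=> /piS_real wR; rewrite wR ltxx in w0.
    by exists 1; [left|rewrite !mul1r !ltW].
  have {}zn : Im z < 0 by rewrite lt_neqAle z0.
  rewrite (ltr0_norm zn) ltr_norml in wz; have /andP[w1 w2] := wz.
  have w0 : complex.Im w < 0 by lra.
  split; first by move=> /piS_real wR; rewrite wR ltxx in w0.
  by exists (-1); [right|rewrite !mulN1r !oppr_ge0 !ltW].
have : \forall e \near (0 : R)^'+, forall j : 'I_(nver A), e < `|abscissa j - Re z|.
  apply: filter_forall => j; apply: nbhs_right_lt.
  rewrite normr_gt0 subr_eq0; apply/eqP => jz.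
  apply: (@base_notin _ _ z); apply/piS_abscissa; exists j; exact: complex_ext.
move=> /(filterI (nbhs_right_gt (0 : R)))/filter_ex[e [e0 ej]].
exists e => // w [wRe wIm]; split.
  by move=> /piS_abscissa[j wE]; move: wRe; rewrite wE /= ltNge ltW //; exact: ej.
rewrite z0; have [w0|/ltW w0] := leP 0 (complex.Im w).
  by exists 1; [left|rewrite !mul1r].
by exists (-1); [right|rewrite !mulN1r !oppr_ge0].
Qed.

Lemma box_lin (e : R) (z w v : R[i]) (s : R) : 0 <= s <= 1 ->
  box e z w -> box e z v -> box e z (lin s w v).
Proof.
move=> /andP[s0 s1].
have aux (x a b : R) : `|a - x| < e -> `|b - x| < e -> `|(1 - s) * a + s * b - x| < e.
  rewrite !ltr_norml => /andP[? ?] /andP[? ?].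
  have -> : (1 - s) * a + s * b - x = (1 - s) * (a - x) + s * (b - x) by ring.
  have [s_lt|s_ge] := ltP s 1; apply/andP; split; nra.
by move=> [? ?] [? ?]; split; exact: aux.
Qed.

Lemma box_center (e : R) (z : R[i]) : 0 < e -> box e z z.
Proof. by move=> e0; rewrite /box !subrr normr0. Qed.

(** A path in the square may change half planes infinitely often. It is homotopic in the square to
    the segment to the centre followed by a segment out of it, and each of these stays in one closed
    half plane. *)
Lemma tame_box (z : B) : exists2 e : R, 0 < e & forall (w v : B) (p : {path I from w to v in B}),
  (forall t, box e (val z) (val (p t))) -> tame p.
Proof.
have [e e0 boxP] := box_exists z; exists e => // w v p pbox.
have ray (u : B) : box e (val z) (val u) -> exists q : {path I from z to u in B},
    (forall t, box e (val z) (val (q t))) /\ tame q.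
  move=> ub; have lb (s : R) : 0 <= s <= 1 -> box e (val z) (lin s (val z) (val u)).
    by move=> s01; apply: box_lin => //; exact: box_center.
  have [|q qE] := @line_path R A z u; first by move=> s /lb/boxP[].
  exists q; split=> [t|]; first by rewrite qE; apply: lb; rewrite unit_interval_ge0 unit_interval_le1.
  have [_ [sg sg1 [zsg usg]]] := boxP _ ub.
  apply: (tame_half sg1) => t; rewrite qE /lin; cbn beta iota delta [complex.Im].
  rewrite mulrDr mulrCA [sg * (_ * _)]mulrCA.
  by apply: addr_ge0; apply: mulr_ge0 => //; rewrite ?subr_ge0 ?unit_interval_ge0 ?unit_interval_le1.
have [|q [qb qt]] := ray w; first by have := pbox zero; rewrite path_zero.
have [|q' [qb' qt']] := ray v; first by have := pbox one; rewrite path_one.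
apply: tame_hclass (tame_cat (tame_rev qt) qt').
apply/hclassE/line_homotopic => s t s01; apply: (proj1 (boxP _ _)).
apply: box_lin => //.
rewrite -[path_cat _ _ t]/(path_cat_fun (path_rev q) q' t) /path_cat_fun.
by case: ifP => _; [exact: qb|exact: qb'].
Qed.

Section Subdivision.
Variables (w v : B) (g : {path I from w to v in B}).

(** Stated for every path with this parametrization, since the ends of a restriction of [g] agree
    with given points only up to a proof. *)
Let tame_on (a b : R) := forall (z u : B) (p : {path I from z to u in B}),
  (forall t, p t = g (clamp (a + val t * (b - a)))) -> tame p.

Lemma tame_on_refl a : tame_on a a.
Proof.
move=> z u p pE; have {}pE t : p t = g (clamp a) by rewrite pE subrr mulr0 addr0.
have [sg sg1 asg] := sign_exists (g (clamp a)).
by apply: (tame_half sg1) => t; rewrite pE.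
Qed.

Lemma tame_on_trans a b c : tame_on a b -> tame_on b c -> tame_on a c.
Proof.
move=> ab bc z u p pE.
have cg : continuous (fun r : R => g (clamp r)) by exact: path_clamp_continuous.
have csub (d e : R) : continuous (fun t : I => g (clamp (d + val t * (e - d)))).
  by apply: (@cont_comp _ _ _ (fun t : I => d + val t * (e - d)) (fun r => g (clamp r)) cg); cont.
have p0 : g (clamp a) = z by have pz : p zero = z := path_zero; rewrite -pz pE val_zero mul0r addr0.
have p1 : g (clamp c) = u by have pu : p one = u := path_one; rewrite -pu pE val_one mul1r addrC subrK.
have sub0 (d e : R) : g (clamp (d + val (zero : I) * (e - d))) = g (clamp d).
  by rewrite val_zero mul0r addr0.
have sub1 (d e : R) : g (clamp (d + val (one : I) * (e - d))) = g (clamp e).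
  by rewrite val_one mul1r addrC subrK.
pose q : {path I from z to g (clamp b) in B} :=
  mk_path (@csub a b) (etrans (sub0 a b) p0) (sub1 a b).
pose r : {path I from g (clamp b) to u in B} :=
  mk_path (@csub b c) (sub0 b c) (etrans (sub1 b c) p1).
have qr : tame (path_cat q r) by apply: tame_cat; [exact: ab|exact: bc].
apply: tame_hclass qr; apply/hclassE.
apply: (@path_homotopic_reparam _ _ (fun r => g (clamp r))
  (fun t => a + Order.min 1 (2 * val t) * (b - a) + Order.max 0 (2 * val t - 1) * (c - b))
  (fun t => a + val t * (c - a))).
- exact: cg.
- by cont.
- by cont.
- by rewrite val_zero min_r ?max_l; [ring|lra|lra].
- by rewrite val_one min_l ?max_r; [ring|lra|lra].
- move=> t; rewrite -[t in LHS]clamp_val path_catE; case: leP => t2.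
    rewrite min_r ?max_l; [|lra|lra].
    rewrite mul0r addr0 -[q _]/(g (clamp (a + val (clamp (2 * val t)) * (b - a)))).
    by have t0 := unit_interval_ge0 t; rewrite clampE //; apply/andP; split; lra.
  rewrite min_l ?max_r; [|lra|lra].
  rewrite -[r _]/(g (clamp (b + val (clamp (2 * val t - 1)) * (c - b)))).
  rewrite clampE; first by congr (g (clamp _)); ring.
  by have := unit_interval_le1 t; move=> ?; apply/andP; split; lra.
- exact: pE.
Qed.

(** A Lebesgue number for the covering of [g] by the squares of [tame_box]. *)
Lemma tame_on_small : exists2 e : R, 0 < e & forall a b : R, 0 <= a <= 1 ->
  `|b - a| <= e -> tame_on a b.
Proof.
(* The second coordinate is idle; the statement for the interval is read off on the diagonal of the
   square. *)
have [e e0 He] : exists2 e : R, 0 < e & forall x : R * R, 0 <= x.1 <= 1 -> 0 <= x.2 <= 1 ->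
    forall b, `|b - x.1| <= e -> tame_on x.1 b.
  apply: segment2_near => x.
  have [d d0 dP] := tame_box (g (clamp x.1)).
  have cgv := cont_base_val (@path_clamp_continuous R _ _ _ g).
  have near_x (h : R -> R) : continuous h -> \forall a \near x.1, `|h a - h x.1| < d.
    move=> ch; have /cvgrPdist_lt/(_ _ d0) := ch x.1.
    by apply: filterS => a; rewrite distrC.
  have H : nbhs x.1 [set a | box d (val (g (clamp x.1))) (val (g (clamp a)))].
    apply: filterI; first exact: (near_x _ (cont_Re cgv)).
    exact: (near_x _ (cont_Im cgv)).
  have /nbhs_ballP[r /= r0 xr] := H.
  exists (ball x (r / 2), [set e | e < r / 2]) => /=.
    split; first by apply: nbhsx_ballx; lra.
    by apply: nbhs_right_lt; lra.
  move=> [y e] /= [[y1 y2] er] b yb z u p pE.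
  apply: dP => t; rewrite pE; apply: xr.
  move: y1; rewrite /ball /= => y1.
  have -> : x.1 - (y.1 + val t * (b - y.1)) = (x.1 - y.1) + - (val t * (b - y.1)) by ring.
  apply: le_lt_trans (ler_normD _ _) _; rewrite normrN normrM (ger0_norm (unit_interval_ge0 t)).
  have : val t * `|b - y.1| <= `|b - y.1| by rewrite ler_piMl // unit_interval_le1.
  lra.
exists e => // a b a01 ab; exact: (He (a, a)).
Qed.

Lemma tame_path : tame g.
Proof.
have [e e0 He] := tame_on_small.
pose N := Num.truncn e^-1.
have Ne : N.+1%:R^-1 <= e.
  rewrite -[leRHS]invrK lef_pV2 ?posrE ?invr_gt0 ?ltr0n //.
  by apply/ltW; apply: truncnS_gt.
have step k : (k <= N.+1)%N -> tame_on 0 (k%:R / N.+1%:R).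
  elim: k => [_|k IH kN]; first by rewrite mul0r; exact: tame_on_refl.
  apply: (tame_on_trans (IH (ltnW kN))); apply: He.
    exact: frac01 (ltnW kN).
  by rewrite -mulrBl -natrB // subSnn mul1r normfV ger0_norm.
have := step N.+1 (leqnn _); rewrite divff ?pnatr_eq0 // => tg.
by apply: tg => t; rewrite subr0 mulr1 add0r clamp_val.
Qed.

End Subdivision.

Lemma elementary_loops_generate (c : pi1 R x0 x0) : K c.
Proof.
elim/pi1_ind: c => g.
have h : reference 1 (path_cst R x0).
  by split; [left|apply: in_half_cst; rewrite x0R mulr0].
have := tame_path g h h.
by rewrite pi1_1mul -{1}(pi1_mul1 (hclass g)) pi1_mulKV.
Qed.

End Generation.

(** * The global monodromy and its values on the elementary loops *)

Theorem theorem2p7 (R : realType) (A : fibered_arrangement R)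
    (s : line_index A -> R[i]) (hs : forall l, s l != 0)
    (L : local_system R (complement A)) (hL : has_parameters L s)
    (y0 : R[i]) (hy0 : 0 < complex.Im y0)
    (x0 : base A) (hx0 : is_real x0)
    (gamma : forall x x' : base A,
       {path (unit_interval R) from x to x' in (base A)})
    (hgamma : forall x x' : base A, is_real x -> is_real x' ->
       half_plane_path (gamma x x'))
    (xp xp' : R[i] -> base A)
    (hxp : forall p : R[i], piS A p -> close_pair x0 p (xp p) (xp' p)) :
  let H1F (x : base A) := H1 (fiber_system L x) in
  let tau (x x' : base A) : H1F x -> H1F x' :=
    transport L y0 (hclass (gamma x x')) in
  let mu (c : pi1 R x0 x0) : H1F x0 -> H1F x0 := transport L y0 c in
  let mu_loc (p : R[i]) : H1F (xp p) -> H1F (xp p) :=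
    tau (xp' p) (xp p) \o tau (xp p) (xp' p) in
  let gamma_ (p : R[i]) : pi1 R x0 x0 :=
    elementary_loop gamma x0 (xp p) (xp' p) in
  let mu_p (p : R[i]) : H1F x0 -> H1F x0 :=
    inverse (tau x0 (xp p)) \o mu_loc p \o tau x0 (xp p) in
  [/\ (* mu takes its values in the linear automorphisms and is compatible with
         products: paths compose in sequence, maps from right to left *)
      forall c : pi1 R x0 x0, bijective (mu c),
      forall c d : pi1 R x0 x0, mu (pi1_mul c d) =1 mu d \o mu c,
      forall p : R[i], piS A p ->
        bijective (tau x0 (xp p)) /\ mu (gamma_ p) =1 mu_p p
    & (* mu is determined by these values *)
      forall nu : pi1 R x0 x0 -> {linear H1F x0 -> H1F x0},
        (forall c, bijective (nu c)) ->
        (forall c d, nu (pi1_mul c d) =1 nu d \o nu c) ->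
        (forall p : R[i], piS A p -> nu (gamma_ p) =1 mu_p p) ->
        forall c, nu c =1 mu c].
Proof.
move=> H1F tau mu mu_loc gamma_ mu_p.
have mu_mul c d : mu (pi1_mul c d) =1 mu d \o mu c by exact: transport_mul.
have mu_gamma p : piS A p -> bijective (tau x0 (xp p)) /\ mu (gamma_ p) =1 mu_p p.
  move=> pS; have [t [_ _ _ [xpR xp'R]]] := close_pair_real hx0 hxp pS.
  split; first exact: transport_bij.
  move=> u; rewrite /mu /gamma_ /elementary_loop /mu_p /mu_loc /tau.
  rewrite (transport_mul hy0 _ (pi1_inv _)) // [LHS]/=.
  rewrite (transport_mul hy0 _ (hclass (gamma (xp' p) (xp p)))) // [X in transport L y0 (pi1_inv _) X]/=.
  rewrite (transport_mul hy0 (hclass (gamma x0 (xp p)))) //.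
  by rewrite [RHS]/= inverse_transport.
split=> //; first by move=> c; exact: transport_bij.
move=> nu nu_bij nu_mul nu_gamma.
(* The value of [nu] at the unit is idempotent and injective. *)
have nu1 : nu (hclass (path_cst R x0)) =1 id.
  move=> u; apply: (bij_inj (nu_bij (hclass (path_cst R x0)))).
  by rewrite -[LHS](nu_mul _ _ u) pi1_mul1.
have mu1 : mu (hclass (path_cst R x0)) =1 id by exact: transport_cst.
(* The subgroup consists of the classes on which [nu] and [mu] agree. *)
apply: (elementary_loops_generate hx0 hgamma hxp) => [u|c d cE dE u|c cE u|p pS u].
- by rewrite nu1 mu1.
- by rewrite nu_mul mu_mul /= cE dE.
(* Writing the argument as [mu c v], which is also [nu c v], makes both sides the value at [v] of
   the product of [c] with its inverse. *)
- have uE : mu c (mu (pi1_inv c) u) = u by exact: transport_K.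
  rewrite -uE; set v := mu (pi1_inv c) u.
  rewrite -[in LHS]cE -[LHS](nu_mul c (pi1_inv c)) -[RHS](mu_mul c (pi1_inv c)).
  by rewrite pi1_mulV nu1 mu1.
- by rewrite nu_gamma // (proj2 (mu_gamma p pS)).
Qed.
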